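(* Let $g\ge1$. There exists an explicit algorithm which, given any ''basepoint'' marked bordered fatgraph $G\hookrightarrow\Sigma_{g,1}$ of genus $g$ (given by its $\pi$-marking) and the action of a mapping class $\varphi\in MC_{g,1}$ on $\pi$ (given by the images under $\varphi$ of a fixed free basis of $\pi$), determines a finite sequence of Whitehead moves on marked bordered fatgraphs $$G=G_0\to G_1\to\cdots\to G_k=\varphi(G)$$ beginning at $G$ and representing $\varphi$.
   Context: $\Sigma_{g,1}$ is a compact connected oriented surface of genus $g$ with one boundary component, $p\neq q$ are two points of $\partial\Sigma_{g,1}$, $\pi=\pi_1(\Sigma_{g,1},p)$, and $\partial\Sigma_{g,1}$ also denotes the element of $\pi$ represented by the boundary; $\bar x$ denotes the inverse of $x$. Algebraically, $\pi$ is free on $\alpha_1,\beta_1,\dots,\alpha_g,\beta_g$ with $\partial\Sigma_{g,1}=\prod_{i=1}^g\alpha_i\beta_i\bar\alpha_i\bar\beta_i$. The mapping class group $MC_{g,1}$ is the group of isotopy classes of self-diffeomorphisms of $\Sigma_{g,1}$ fixing the boundary pointwise; via its action on $\pi$ it is identified (Dehn–Nielsen) with the group of automorphisms of $\pi$ fixing $\partial\Sigma_{g,1}$. A fatgraph is a finite graph with a cyclic ordering of the half-edges at each vertex. Its boundary cycles are the cyclically ordered sequences of oriented edges in which an incoming edge at a vertex $v$ is followed by the outgoing edge which is next in the cyclic ordering at $v$; gluing a disc along each boundary cycle gives a closed oriented surface whose genus is the genus of the fatgraph. A genus $g$ bordered fatgraph is a connected genus $g$ fatgraph with exactly one boundary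 cycle, all of whose vertices are trivalent except one, which is univalent. The edge $t$ at the univalent vertex is the tail, oriented away from the univalent vertex. A marking of a genus $g$ bordered fatgraph $G$ is an isotopy class of embeddings $G\hookrightarrow\Sigma_{g,1}$ as a spine (compatible with the cyclic orderings) sending the univalent vertex to $q$. Taking Poincaré dual arcs based at $p$ assigns to each oriented edge $e$ of $G$ an element $\pi(e)\in\pi$ (the loop at $p$ meeting $G$ once, transversally, in $e$, with a fixed convention for its direction); this assignment, the $\pi$-marking, determines the marking. It satisfies: reversing the orientation of $e$ inverts $\pi(e)$; if $e_1,e_2,e_3$ are the edges pointing toward a trivalent vertex, in cyclic order, then $\pi(e_1)\pi(e_2)\pi(e_3)=1$; the values $\pi(e)$ generate $\pi$; and $\pi(t)=\overline{\partial\Sigma_{g,1}}$. Marked bordered fatgraphs are considered up to isomorphism of fatgraphs respecting tails and $\pi$-markings. $MC_{g,1}$ acts on marked bordered fatgraphs by composing the embedding with $\varphi$; the $\pi$-marking of $\varphi(G)$ is $e\mapsto\varphi(\pi(e))$. A Whitehead move $G\to G'$ collapses a non-tail edge $e$ with distinct trivalent endpoints and expands the resulting four-valent vertex in the unique other way compatible with the cyclic ordering. The marking evolves by performing the move inside $\Sigma_{g,1}$: all edges other than $e$ keep their $\pi$-markings, and that of the new edge is determined by the vertex condition. A sequence of Whitehead moves represents $\varphi$ if it starts at some $G$ and ends at $\varphi(G)$. *)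

(* Defs.v *)
From HB Require Import structures.
From mathcomp Require Import all_boot all_fingroup.

Set Implicit Arguments.
Unset Strict Implicit.
Unset Printing Implicit Defensive.

Section FreeGroup.

Variable I : countType.

(* (i, false) stands for the generator i and (i, true) for its inverse. *)
Local Notation letter := (I * bool)%type.

Definition linv (x : letter) : letter := (x.1, ~~ x.2).
Arguments linv : simpl never.

Definition reduced (w : seq letter) : bool :=
  sorted (fun x y => y != linv x) w.

Definition cons_red (x : letter) (w : seq letter) : seq letter :=
  if w is y :: w' then if y == linv x then w' else x :: w else [:: x].

Definition reduce (w : seq letter) : seq letter := foldr cons_red [::] w.

Lemma linvK : involutive linv.
Proof. by case=> i b; rewrite /linv /= negbK. Qed.

Lemma cons_red_reduced x w : reduced w -> reduced (cons_red x w).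
Proof.
case: w => [|y w] //= yw; case: eqP => [_|/eqP ne]; first exact: path_sorted yw.
by rewrite /reduced /= ne.
Qed.

Lemma foldr_reduced u w : reduced w -> reduced (foldr cons_red w u).
Proof. by move=> rw; elim: u => //= x u; apply: cons_red_reduced. Qed.

Lemma reduce_reduced w : reduced (reduce w).
Proof. exact: foldr_reduced. Qed.

Lemma reduce_id w : reduced w -> reduce w = w.
Proof.
elim: w => //= x w IH rxw; rewrite IH; last exact: path_sorted rxw.
by case: w rxw {IH} => //= y w /andP[/negPf-> _].
Qed.

Lemma cons_redK x w : reduced w -> cons_red x (cons_red (linv x) w) = w.
Proof.
case: w => [|y w] /=; first by rewrite eqxx.
rewrite linvK; case: eqP => [-> |_ _] /=; last by rewrite eqxx.
by case: w => //= z w /andP[/negPf-> _].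
Qed.

Lemma reduce_cat u v : reduce (u ++ v) = foldr cons_red (reduce v) u.
Proof. by rewrite /reduce foldr_cat. Qed.

Lemma foldr_reduce u w :
  reduced w -> foldr cons_red w (reduce u) = foldr cons_red w u.
Proof.
move=> rw; elim: u => //= x u <-.
case: (reduce u) => [|y r] //=; case: eqP => [->|] //=.
by rewrite cons_redK ?foldr_reduced.
Qed.

Definition word_inv (w : seq letter) : seq letter := rev (map linv w).

Lemma word_inv_reduced w : reduced w -> reduced (word_inv w).
Proof.
rewrite /reduced /word_inv rev_sorted sorted_map.
apply: sub_sorted => x y /=; apply: contra => /eqP e.
by rewrite e linvK.
Qed.

Record free_group := FreeGroup {
  fg_word :> seq letter;
  fg_reduced : reduced fg_word }.

HB.instance Definition _ := [isSub for fg_word].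
HB.instance Definition _ := [Countable of free_group by <:].

Definition fg_one : free_group := @FreeGroup [::] isT.
Definition fg_mul (u v : free_group) : free_group :=
  FreeGroup (reduce_reduced (u ++ v)).
Definition fg_inv (u : free_group) : free_group :=
  FreeGroup (word_inv_reduced (fg_reduced u)).

Lemma fg_mulA : associative fg_mul.
Proof.
move=> u v w; apply: val_inj; rewrite /= [RHS]reduce_cat.
rewrite foldr_reduce ?reduce_reduced // foldr_cat !reduce_cat.
by rewrite reduce_id // foldr_reduced ?reduce_reduced.
Qed.

Lemma fg_mul1g : left_id fg_one fg_mul.
Proof. by move=> u; apply: val_inj => /=; apply: reduce_id (fg_reduced u). Qed.

Lemma fg_mulg1 : right_id fg_one fg_mul.
Proof.
move=> u; apply: val_inj; rewrite /= cats0.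
exact: reduce_id (fg_reduced u).
Qed.

Lemma fg_mulVg : left_inverse fg_one fg_inv fg_mul.
Proof.
case=> w rw; apply: val_inj; rewrite /= reduce_cat (reduce_id rw) {rw} /word_inv; elim: w => //= x w IH.
by rewrite rev_cons foldr_rcons /= linvK eqxx.
Qed.

Lemma fg_mulgV : right_inverse fg_one fg_inv fg_mul.
Proof.
move=> u; rewrite -{1}(_ : fg_inv (fg_inv u) = u) ?fg_mulVg //.
apply: val_inj; rewrite /= /word_inv map_rev revK -map_comp.
by rewrite (eq_map linvK) map_id.
Qed.

HB.instance Definition _ :=
  isGroup.Build free_group fg_mulA fg_mul1g fg_mulg1 fg_mulVg fg_mulgV.

Definition fg_gen (i : I) : free_group := @FreeGroup [:: (i, false)] isT.

End FreeGroup.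

Arguments fg_gen {I} i.

(* (i, false) is alpha_(i+1) and (i, true) is beta_(i+1), for i < g. *)
Definition surface_group (g : nat) : groupType :=
  free_group ('I_g * bool)%type.

Definition alpha (g : nat) (i : 'I_g) : surface_group g := fg_gen (i, false).
Definition beta (g : nat) (i : 'I_g) : surface_group g := fg_gen (i, true).

Definition boundary (g : nat) : surface_group g :=
  (\prod_(i < g) (alpha i * beta i * (alpha i)^-1 * (beta i)^-1))%g.

(* Mapping classes are identified, through Dehn-Nielsen, with the automorphisms
   of the fundamental group that fix the boundary element. *)
Record mapping_class (g : nat) := MappingClass {
  mc_aut :> {multiplicative surface_group g -> surface_group g};
  mc_bij : bijective mc_aut;
  mc_boundary : mc_aut (boundary g) = boundary g }.

Lemma mc1 (g : nat) (phi : mapping_class g) : phi 1%g = 1%g.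
Proof. by apply: (mulgI (phi 1%g)); rewrite -gmulfM !mulg1. Qed.

Lemma mcV (g : nat) (phi : mapping_class g) x : phi x^-1%g = (phi x)^-1%g.
Proof. by apply: (mulgI (phi x)); rewrite -gmulfM !mulgV mc1. Qed.

Definition generates (T : Type) (K : groupType) (f : T -> K) : Prop :=
  forall S : K -> Prop,
    S 1%g -> (forall x y, S x -> S y -> S (x * y)%g) ->
    (forall x, S x -> S x^-1%g) -> (forall t, S (f t)) ->
  forall x, S x.

(* A fatgraph given by its half-edges: [nexth] is the cyclic ordering at the
   vertices and [opph] exchanges the two halves of each edge.  A half-edge h
   attached to a vertex v also denotes the oriented edge pointing toward v whose
   last half is h; [opph h] is then the same edge with the other orientation. *)
Record fatgraph (H : finType) := Fatgraph {
  nexth : {perm H};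
  opph : {perm H};
  opphK : involutive opph;
  opph_neq : forall h, opph h != h }.

Section Fatgraph.

Variables (H : finType) (G : fatgraph H).

Definition valence (h : H) : nat := #|porbit (nexth G) h|.

(* The perm h |-> opph (nexth h): the edge pointing toward v along h is followed
   by the edge leaving v along [nexth h]. *)
Definition boundary_next : {perm H} := (nexth G * opph G)%g.

Definition num_vertices : nat := #|porbits (nexth G)|.
Definition num_edges : nat := #|porbits (opph G)|.
Definition num_boundary_cycles : nat := #|porbits boundary_next|.

Definition connected_fatgraph : Prop :=
  forall x y, connect (fun a b => (b == nexth G a) || (b == opph G a)) x y.

(* For a connected fatgraph: V - E + F = 2 - 2 g, without subtraction. *)
Definition has_genus (g : nat) : Prop :=
  num_vertices + num_boundary_cycles + 2 * g = num_edges + 2.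

End Fatgraph.

(* [root] is the half-edge at the univalent vertex, so the tail, oriented away
   from that vertex, is [opph root]. *)
Record bordered_fatgraph (g : nat) (H : finType) := BorderedFatgraph {
  bf_graph :> fatgraph H;
  bf_connected : connected_fatgraph bf_graph;
  bf_genus : has_genus bf_graph g;
  bf_boundary : num_boundary_cycles bf_graph = 1;
  root : H;
  bf_univalent : valence bf_graph root = 1;
  bf_trivalent : forall h, h != root -> valence bf_graph h = 3 }.

Definition tail (g : nat) (H : finType) (G : bordered_fatgraph g H) : H :=
  opph G (root G).

(* A marking is recorded by its pi-marking.  By Hopficity and Dehn-Nielsen, the
   assignments with the properties below are exactly those that come from an
   embedding as a spine. *)
Record marked_fatgraph (g : nat) (H : finType) := MarkedFatgraph {
  mf_graph :> bordered_fatgraph g H;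
  mark : H -> surface_group g;
  mark_opp : forall h, mark (opph mf_graph h) = (mark h)^-1%g;
  mark_vertex : forall h, h != root mf_graph ->
    (mark h * mark (nexth mf_graph h) *
       mark (nexth mf_graph (nexth mf_graph h)))%g = 1%g;
  mark_gen : generates mark;
  mark_tail : mark (tail mf_graph) = (boundary g)^-1%g }.

Definition marked_iso (g : nat) (H1 H2 : finType)
    (G1 : marked_fatgraph g H1) (G2 : marked_fatgraph g H2) : Prop :=
  exists2 f : H1 -> H2, bijective f &
    [/\ forall h, f (nexth G1 h) = nexth G2 (f h),
        forall h, f (opph G1 h) = opph G2 (f h),
        f (tail G1) = tail G2
      & forall h, mark G2 (f h) = mark G1 h].

Section Action.

Variables (g : nat) (H : finType).
Variables (phi : mapping_class g) (G : marked_fatgraph g H).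

Let act_mark (h : H) : surface_group g := phi (mark G h).

Lemma act_mark_opp h : act_mark (opph G h) = (act_mark h)^-1%g.
Proof. by rewrite /act_mark mark_opp mcV. Qed.

Lemma act_mark_vertex h : h != root G ->
  (act_mark h * act_mark (nexth G h) * act_mark (nexth G (nexth G h)))%g = 1%g.
Proof. by move=> hr; rewrite /act_mark -!gmulfM mark_vertex // mc1. Qed.

Lemma act_mark_gen : generates act_mark.
Proof.
move=> S S1 SM SV Sm x; have [psi _ phiK] := mc_bij phi.
rewrite -(phiK x); apply: (@mark_gen g H G (fun y => S (phi y))) => [|y z Sy Sz|y Sy|//].
- by rewrite mc1.
- by rewrite gmulfM; apply: SM.
- by rewrite mcV; apply: SV.
Qed.

Lemma act_mark_tail : act_mark (tail G) = (boundary g)^-1%g.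
Proof. by rewrite /act_mark mark_tail mcV mc_boundary. Qed.

Definition mc_act : marked_fatgraph g H :=
  MarkedFatgraph act_mark_opp act_mark_vertex act_mark_gen act_mark_tail.

End Action.

Section Collapse.

Variables (H : finType) (G : fatgraph H) (e : H).

Definition collapsible : bool :=
  [&& valence G e == 3, valence G (opph G e) == 3
    & opph G e \notin porbit (nexth G) e].

(* The cyclic ordering on the half-edges other than e and opph e once the edge
   {e, opph e} is collapsed. *)
Definition collapse_next (x : H) : H :=
  if nexth G x == e then nexth G (opph G e)
  else if nexth G x == opph G e then nexth G e
  else nexth G x.

End Collapse.

(* G and G' share all their half-edges, and e, opph e stand for the collapsed edge
   in G and for the new one in G'.  Collapsing gives the same fatgraph, and the
   two half-edges that follow e at its vertex in G are no longer at a common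
   vertex in G', which singles out the other expansion.  It only remains free to
   exchange the names e and opph e in G', which is an isomorphism.  The tail is
   excluded since its univalent end makes it not collapsible. *)
Definition whitehead_move (g : nat) (H : finType)
    (G : marked_fatgraph g H) (e : H) (G' : marked_fatgraph g H) : Prop :=
  [/\ collapsible G e /\ collapsible G' e,
      forall x, opph G' x = opph G x,
      forall x, x != e -> x != opph G e ->
        collapse_next G' e x = collapse_next G e x,
      nexth G (nexth G e) \notin porbit (nexth G') (nexth G e)
    & forall x, x != e -> x != opph G e -> mark G' x = mark G x].

Fixpoint whitehead_sequence (g : nat) (H : finType)
    (G : marked_fatgraph g H) (es : seq H) (K : marked_fatgraph g H) : Prop :=
  if es is e :: es' then
    exists2 G', whitehead_move G e G' & whitehead_sequence G' es' K
  else marked_iso G K.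

Definition represents (g : nat) (H : finType)
    (G : marked_fatgraph g H) (es : seq H) (phi : mapping_class g) : Prop :=
  whitehead_sequence G es (mc_act phi G).

(* Programs for the partial recursive functions ([PMin] is unbounded search).
   Missing arguments read as 0. *)
Inductive program : Type :=
| PZero
| PSucc
| PProj of nat
| PComp of program & seq program
| PRec of program & program
| PMin of program.

(* [computes p v y]: the program p halts on the arguments v, with result y. *)
Fixpoint computes (p : program) (v : seq nat) (y : nat) {struct p} : Prop :=
  match p with
  | PZero => y = 0
  | PSucc => y = (head 0 v).+1
  | PProj i => y = nth 0 v i
  | PComp f gs =>
      exists2 ws : seq nat,
        (fix computes_all gs ws {struct gs} : Prop :=
           match gs, ws with
           | [::], [::] => True
           | h :: gs', w :: ws' => computes h v w /\ computes_all gs' ws'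
           | _, _ => False
           end) gs ws
        & computes f ws y
  | PRec f h =>
      (fix iterates n y {struct n} : Prop :=
         if n is m.+1 then
           exists2 z, iterates m z & computes h [:: m, z & behead v] y
         else computes f (behead v) y) (head 0 v) y
  | PMin f =>
      computes f (y :: v) 0 /\
      forall z, z < y -> exists w, computes f (z :: v) w.+1
  end.

Lemma computes_fun p v y z : computes p v y -> computes p v z -> y = z.
Proof.
move: p v y z; fix IH 1; case=> [||i|f gs|f h|f] v y z /=.
- by move=> -> ->.
- by move=> -> ->.
- by move=> -> ->.
- case=> ws Hws fy [xs Hxs fz].
  suff E : ws = xs by apply: IH fy _; rewrite E.
  elim: gs ws xs Hws Hxs {fy fz} => [|h gs IHgs] [|w ws] [|x xs] //=.
  by case=> hw Hws [hx Hxs]; congr cons; [apply: IH hw hx | apply: IHgs].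
- elim: (head 0 v) y z => [|n IHn] y z /=; first exact: IH.
  by case=> a /IHn Ea hy [b /Ea Eb]; rewrite -Eb; apply: IH.
- case=> fy ly [fz lz]; case: (ltngtP y z) => // [/lz|/ly] [w fw].
  + by have := IH _ _ _ _ fy fw.
  + by have := IH _ _ _ _ fz fw.
Qed.

Definition code_letter (g : nat) (x : 'I_g * bool * bool) : nat :=
  let: (i, b, s) := x in (i.*2 + b).*2 + s.

Definition code_elt (g : nat) (x : free_group ('I_g * bool)%type) : nat :=
  CodeSeq.code (map (@code_letter g) (fg_word x)).

Definition code_perm (n : nat) (s : {perm 'I_n}) : nat :=
  CodeSeq.code [seq val (s i) | i <- enum 'I_n].

Definition code_mark (g n : nat) (m : 'I_n -> surface_group g) : nat :=
  CodeSeq.code [seq code_elt (m i) | i <- enum 'I_n].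

(* The images of alpha_1, beta_1, ..., alpha_g, beta_g, in this order. *)
Definition code_mapping_class (g : nat) (phi : mapping_class g) : nat :=
  CodeSeq.code
    (flatten [seq [:: code_elt (phi (alpha i)); code_elt (phi (beta i))]
             | i <- enum 'I_g]).

Definition input (g n : nat) (G : marked_fatgraph g 'I_n)
    (phi : mapping_class g) : seq nat :=
  [:: code_perm (nexth G); code_perm (opph G); code_mark (mark G);
      code_mapping_class phi].

(* Main.v *)
From HB Require Import structures.
From mathcomp Require Import all_boot all_fingroup.
From mathcomp Require Import zify.
Require Import Defs.

Set Implicit Arguments.
Unset Strict Implicit.
Unset Printing Implicit Defensive.

(** The algorithm is a search.  It enumerates pairs made of a sequence of
half-edges and a relabelling of the half-edges, carries out the corresponding
moves on the data, and stops as soon as the relabelling matches the outcome with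
phi(G).  Moves and comparison are elementary operations on lists of numbers and
on words, so the stopping criterion is computable ([computable_accepts]), and the
whole point is that the search ends: any two marked bordered fatgraphs of genus
at least 1 are connected by Whitehead moves ([linked_any]).

This is proved by Nielsen reduction.  Cut G along the edges outside a spanning
tree.  What remains is a planar binary tree with 4g leaves, growing from the
tail; the marks u_1, ..., u_4g of the leaves multiply to the boundary element,
and the two ends of a cut edge, a chord, carry inverse marks.  Three facts allow
this picture to be reshaped.  Whitehead moves on the edges of the tree reach every
tree with the same leaves ([spans_rots]).  If the leaves y and x are neighbours at
a vertex, then the third edge at that vertex may replace the chord of x as an edge
outside the tree; without moving anything, one end of y has slid along x and the
mark x has become yx ([slide]).  And a marked fatgraph is determined, up to
isomorphism, by the shape of the tree and the marks of the leaves
([same_shape_iso]).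

Slides are used as long as they lower the total length of the marks or, for equal
length, a rank that orders the first halves of the words.  When no slide helps,
only the first margin(u) letters of a mark u can be cancelled from the left, where
margin(u) + margin(1/u) + 1 is the length of u; so at least one letter of each
leaf survives in the product ([irreducible_prod]).  The product is the boundary
word, which has exactly 4g letters, so all these estimates are equalities: the
margin of a leaf equals the margin of the inverse of its left neighbour, and the
margin at the beginning of the word is 0 ([irreducible_margins]).  In terms of G
this says that a function on the half-edges is constant along the boundary cycle;
there is only one such cycle, hence all margins vanish and all marks are single
letters ([irreducible_sizes]).  They must then be the letters of the boundary word
in order.  Thus G and phi(G) are both connected to fatgraphs with the same leaf
marks, and moves are reversible ([flip_twice]). *)

(** * Vertices, edges and the boundary cycle of a bordered fatgraph *)

Section Valence.
Variables (T : finType) (s : {perm T}).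

(** A cycle of length 3 is described by equations, which are easier to check for a
new permutation than a cardinal. *)
Lemma card_porbit3 x : (#|porbit s x| == 3) = (s (s (s x)) == x) && (s x != x).
Proof.
apply/idP/andP=> [/eqP c3|[/eqP s3 s1]].
  have := iter_porbit s x; have := uniq_traject_porbit s x.
  by rewrite c3 /= !inE negb_or => /andP[/andP[xs _] _] ->; split; rewrite // eq_sym.
have s2 : s (s x) != x by apply: contra s1 => /eqP e; rewrite -{1}e s3.
have u3 : uniq [:: x; s x; s (s x)].
  by rewrite /= !inE (inj_eq perm_inj) negb_or !(eq_sym x) s1 s2.
have closed : porbit s x =i [:: x; s x; s (s x)].
  move=> y; apply/porbitP/idP=> [[i ->]|].
    elim: i => [|i IHi]; first by rewrite expg0 perm1 inE eqxx.
    rewrite expgSr permM; move: IHi; rewrite !inE.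
    by case/or3P=> /eqP ->; rewrite ?s3 eqxx ?orbT.
  rewrite !inE => /or3P[] /eqP ->.
  - by exists 0; rewrite expg0 perm1.
  - by exists 1; rewrite expg1.
  - by exists 2; rewrite expgSr expg1 permM.
by rewrite (eq_card closed) (card_uniqP u3).
Qed.

Lemma card_porbit1 x : (#|porbit s x| == 1) = (s x == x).
Proof.
apply/idP/idP=> [/eqP c1|/eqP s1].
  by have := iter_porbit s x; rewrite c1 /= => ->.
have closed : porbit s x =i [:: x].
  move=> y; apply/porbitP/idP=> [[i ->]|].
    elim: i => [|i IHi]; first by rewrite expg0 perm1 inE eqxx.
    by rewrite expgSr permM; move: IHi; rewrite !inE => /eqP ->; rewrite s1.
  by rewrite inE => /eqP ->; exists 0; rewrite expg0 perm1.
by rewrite (eq_card closed) (card_uniqP _).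
Qed.

Lemma mem_porbit3 x y :
  #|porbit s x| = 3 -> (y \in porbit s x) = (y \in [:: x; s x; s (s x)]).
Proof. by rewrite porbit_traject => ->. Qed.

End Valence.

Section Univalent.
Variables (g : nat) (H : finType) (G : bordered_fatgraph g H).

Lemma next_root : nexth G (root G) = root G.
Proof. by apply/eqP; rewrite -card_porbit1; apply/eqP/bf_univalent. Qed.

Lemma next3 h : nexth G (nexth G (nexth G h)) = h.
Proof.
have [->|hr] := eqVneq h (root G); first by rewrite !next_root.
by have /eqP := bf_trivalent hr; rewrite card_porbit3 => /andP[/eqP].
Qed.

Lemma next_neq h : (nexth G h == h) = (h == root G).
Proof.
have [->|hr] := eqVneq h (root G); first by rewrite next_root eqxx.
by have /eqP := bf_trivalent hr; rewrite card_porbit3 => /andP[_ /negPf].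
Qed.

Lemma next2_neq h : (nexth G (nexth G h) == h) = (h == root G).
Proof.
by rewrite -next_neq -(inj_eq (@perm_inj _ (nexth G))) next3 eq_sym.
Qed.

Lemma collapsibleE e :
  collapsible G e = [&& e != root G, opph G e != root G,
                     nexth G e != opph G e & nexth G (nexth G e) != opph G e].
Proof.
have v3 h : (valence G h == 3) = (h != root G).
  by rewrite card_porbit3 next3 eqxx next_neq.
rewrite /collapsible !v3; case: (eqVneq e) => //= er.
rewrite (mem_porbit3 _ (bf_trivalent er)) !inE (negPf (opph_neq G e)) /=.
by rewrite negb_or ![opph G e == _]eq_sym.
Qed.

(** There is only one boundary cycle, so a predicate that propagates along it holds
everywhere as soon as it holds once.  All global properties of fatgraphs are used
below through this induction principle. *)
Lemma boundary_all (C : pred H) x :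
  C x -> (forall y, C y -> C (opph G (nexth G y))) -> forall y, C y.
Proof.
move=> Cx Cs y; have := bf_boundary G; rewrite /num_boundary_cycles.
case/eqP/cards1P=> A eqA.
have inA z : porbit (boundary_next G) z = A.
  by apply/set1P; rewrite -eqA imset_f.
have : y \in porbit (boundary_next G) x by rewrite -eq_porbit_mem !inA.
case/porbitP=> i ->; elim: i => [|i IHi]; first by rewrite expg0 perm1.
by rewrite expgSr !permM; apply: Cs.
Qed.

End Univalent.

Section Build.
Variables (H : finType) (G' : fatgraph H).

(** Converse of [boundary_all]; connectedness comes for free because a step along
the boundary follows one vertex and one edge. *)
Lemma boundary_connected (x0 : H) :
  (forall (C : pred H), C x0 -> (forall y, C y -> C (opph G' (nexth G' y))) ->
     forall y, C y) ->
  connected_fatgraph G' /\ num_boundary_cycles G' = 1.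
Proof.
move=> all.
have orb y : y \in porbit (boundary_next G') x0.
  apply: (all (fun y => y \in porbit (boundary_next G') x0)).
    exact: porbit_id.
  move=> {}y /porbitP[i ->]; apply/porbitP; exists i.+1.
  by rewrite expgSr [in RHS]permM permM.
split; last first.
  apply/eqP/cards1P; exists (porbit (boundary_next G') x0).
  apply/setP=> A; rewrite inE; apply/imsetP/eqP=> [[y _ ->]|->]; last by exists x0.
  by apply/eqP; rewrite eq_porbit_mem.
pose e (a b : H) := (b == nexth G' a) || (b == opph G' a).
have step a : connect e a (opph G' (nexth G' a)).
  apply: (connect_trans (y := nexth G' a)); apply: connect1; rewrite /e eqxx ?orbT //.
have reach x y : connect e x y.
  have toy i z : connect e z ((boundary_next G' ^+ i)%g z).
    elim: i z => [|i IHi] z; first by rewrite expg0 perm1.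
    by rewrite expgS permM; apply: connect_trans (IHi _); rewrite permM; apply: step.
  have : y \in porbit (boundary_next G') x.
    by rewrite -eq_porbit_mem; apply/eqP; transitivity (porbit (boundary_next G') x0);
       [|apply/esym]; apply/eqP; rewrite eq_porbit_mem.
  by case/porbitP=> i ->.
exact: reach.
Qed.

Lemma porbits_sum (s : {perm H}) : \sum_(A in porbits s) #|A| = #|H|.
Proof.
have := card_partition (P := porbits s) (D := [set: H]); rewrite cardsT => -> //.
apply/and3P; split.
- apply/eqP/setP=> x; rewrite inE; apply/bigcupP; exists (porbit s x).
    exact: imset_f.
  exact: porbit_id.
- apply/trivIsetP=> _ _ /imsetP[x _ ->] /imsetP[y _ ->] nxy.
  apply/pred0P=> z; apply/negbTE/andP=> -[/= zx zy]; case/eqP: nxy.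
  by move: zx zy; rewrite -!eq_porbit_mem => /eqP <- /eqP <-.
- by apply/imsetP=> -[x _ /setP/(_ x)]; rewrite inE porbit_id.
Qed.

End Build.

(** With the valences fixed, the number of half-edges determines the number of
vertices; a move therefore preserves the genus once it preserves the valences and
the boundary cycle. *)
Lemma num_verticesE (H : finType) (G : fatgraph H) (r : H) :
  valence G r = 1 -> (forall h, h != r -> valence G h = 3) ->
  #|H| + 2 = 3 * num_vertices G.
Proof.
move=> v1 v3; rewrite -(porbits_sum (nexth G)) /num_vertices.
have rP : porbit (nexth G) r \in porbits (nexth G) by exact: imset_f.
rewrite (cardsD1 (porbit (nexth G) r)) rP.
rewrite (bigD1 (porbit (nexth G) r)) //= [#|porbit _ _|]v1.
rewrite mulnDr (eq_bigr (fun=> 3)).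
  rewrite sum_nat_const (eq_card (B := porbits (nexth G) :\ porbit (nexth G) r)).
    by rewrite addnAC mulnC.
  by move=> A; rewrite !inE andbC.
move=> A /andP[/imsetP[x _ ->] xr]; apply: v3.
by apply: contraNneq xr => ->.
Qed.

Lemma num_edgesE (H : finType) (G : fatgraph H) : #|H| = 2 * num_edges G.
Proof.
rewrite -(porbits_sum (opph G)) (eq_bigr (fun=> 2)) => [|_ /imsetP[x _ ->]].
  by rewrite sum_nat_const mulnC.
have closed : porbit (opph G) x =i [:: x; opph G x].
  move=> y; apply/porbitP/idP=> [[i ->]|].
    elim: i => [|i IHi]; first by rewrite expg0 perm1 inE eqxx.
    rewrite expgSr permM; move: IHi; rewrite !inE.
    by case/orP=> /eqP ->; rewrite ?opphK eqxx ?orbT.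
  rewrite !inE => /orP[] /eqP ->.
  - by exists 0; rewrite expg0 perm1.
  - by exists 1; rewrite expg1.
rewrite (eq_card closed); apply/card_uniqP.
by rewrite /= inE eq_sym opph_neq.
Qed.

Lemma card_half_edges (g : nat) (H : finType) (G : bordered_fatgraph g H) :
  #|H| + 2 = 12 * g.
Proof.
have := num_verticesE (bf_univalent G) (@bf_trivalent _ _ G).
have := num_edgesE G; have := bf_genus G; rewrite /has_genus bf_boundary.
move: #|H| (num_vertices G) (num_edges G) => n v e h1 h2 h3.
lia.
Qed.

(** * The Whitehead move as an operation on marked fatgraphs *)

(** In the form of rewrite rules, to evaluate the case distinctions of a move. *)
Lemma uniq6 (T : eqType) (a b c d e f : T) : uniq [:: a; b; c; d; e; f] ->
  ((a == b) = false)*((a == c) = false)*((a == d) = false)*((a == e) = false)*((a == f) = false) *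
  ((b == a) = false)*((b == c) = false)*((b == d) = false)*((b == e) = false)*((b == f) = false) *
  ((c == a) = false)*((c == b) = false)*((c == d) = false)*((c == e) = false)*((c == f) = false) *
  ((d == a) = false)*((d == b) = false)*((d == c) = false)*((d == e) = false)*((d == f) = false) *
  ((e == a) = false)*((e == b) = false)*((e == c) = false)*((e == d) = false)*((e == f) = false) *
  ((f == a) = false)*((f == b) = false)*((f == c) = false)*((f == d) = false)*((f == e) = false).
Proof.
rewrite /= !inE !negb_or => /and5P[].
case/and5P=> ? ? ? ? ? /and4P[? ? ? ?] /and3P[? ? ?] /andP[? ?] /andP[? _].
by do ?split; apply/negbTE => //; rewrite eq_sym.
Qed.

Section Flip.
Variables (g : nat) (H : finType) (G : marked_fatgraph g H) (e : H).

(* The vertices of the edge e, in cyclic order, are (e a b) and (e' c d). *)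
Let e' := opph G e.
Let a := nexth G e.
Let b := nexth G a.
Let c := nexth G e'.
Let d := nexth G c.

(** The vertices (e a b) and (e' c d) become (e b c) and (e' d a).  Among the two
possible namings of the new edge this one has the advantage that the move turns
the quadrilateral a b c d by a quarter, so that moves can be composed without case
distinctions. *)
Definition flip_map (x : H) : H :=
  if x == e then b else if x == b then c else if x == c then e
  else if x == e' then d else if x == d then a else if x == a then e'
  else nexth G x.

(** The composition of the old permutation with two 3-cycles, a formula that makes
bijectivity evident; computations use [flip_map] instead. *)
Definition flip_perm : {perm H} :=
  (nexth G * (tperm a b * tperm a e' * (tperm c d * tperm c e)))%g.

Definition flip_mark (x : H) : surface_group g :=
  if x == e then (mark G b * mark G c)^-1%g
  else if x == e' then (mark G b * mark G c)%g else mark G x.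

Hypothesis ce : collapsible G e.

Let six := [:: e; a; b; e'; c; d].

Lemma next_b : nexth G b = e. Proof. exact: next3. Qed.
Lemma next_d : nexth G d = e'. Proof. exact: next3. Qed.

Lemma e_neq_root : e != root G.
Proof. by move: ce; rewrite collapsibleE => /and4P[]. Qed.

Lemma opp_e_neq_root : e' != root G.
Proof. by move: ce; rewrite collapsibleE => /and4P[]. Qed.

Lemma vertex_uniq h : h != root G -> uniq [:: h; nexth G h; nexth G (nexth G h)].
Proof.
move=> hr; rewrite /= !inE (inj_eq perm_inj) negb_or !(eq_sym h).
by rewrite next_neq next2_neq hr.
Qed.

Lemma six_uniq : uniq six.
Proof.
rewrite -[six]/([:: e; a; b] ++ [:: e'; c; d]) cat_uniq.
rewrite !vertex_uniq ?e_neq_root ?opp_e_neq_root // andbT.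
have stable y : y \in [:: e; a; b] -> nexth G y \in [:: e; a; b].
  by rewrite !inE => /or3P[] /eqP ->; rewrite ?next_b eqxx ?orbT.
have ne' : e' \notin [:: e; a; b].
  move: (ce); rewrite collapsibleE => /and4P[_ _ ae be].
  by rewrite !inE !negb_or opph_neq ![e' == _]eq_sym ae be.
apply/hasPn=> y yin; apply: contra ne' => yS.
have [<-|yc|yd] : [\/ y = e', y = c | y = d].
- by move: yin; rewrite !inE => /or3P[] /eqP; [constructor 1|constructor 2|constructor 3].
- by [].
- by have := stable _ (stable _ yS); rewrite yc -/d next_d.
- by have := stable _ yS; rewrite yd next_d.
Qed.

Let ne := uniq6 six_uniq.

Lemma next_six x : (nexth G x \in six) = (x \in six).
Proof.
have stable y : y \in six -> nexth G y \in six.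
  by rewrite !inE => /or4P[|||/or3P[]] /eqP ->; rewrite ?next_b ?next_d eqxx ?orbT.
apply/idP/idP=> [xS|]; last exact: stable.
by rewrite -(next3 G x); apply/stable/stable.
Qed.

Variant six_spec x : bool -> Type :=
| SixE of x = e : six_spec x true
| SixA of x = a : six_spec x true
| SixB of x = b : six_spec x true
| SixE' of x = e' : six_spec x true
| SixC of x = c : six_spec x true
| SixD of x = d : six_spec x true
| SixN of (x == e) = false & (x == a) = false & (x == b) = false &
          (x == e') = false & (x == c) = false & (x == d) = false : six_spec x false.

Lemma sixP x : six_spec x (x \in six).
Proof.
rewrite !inE.
have [|?] := eqVneq x e; first by constructor.
have [|?] := eqVneq x a; first by constructor.
have [|?] := eqVneq x b; first by constructor.
have [|?] := eqVneq x e'; first by constructor.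
have [|?] := eqVneq x c; first by constructor.
have [|?] := eqVneq x d; first by constructor.
by constructor; apply/negbTE.
Qed.

Lemma flip_permE x : flip_perm x = flip_map x.
Proof.
rewrite /flip_map /flip_perm !permM; have := next_six x.
case: (sixP x) => [->|->|->|->|->|->|xe xa xb xe' xc xd].
1-6: rewrite ?ne ?eqxx -?/a -?/b -?/c -?/d ?next_b ?next_d !permE /=.
1-6: by do ?[rewrite ?ne ?eqxx /=].
case: (sixP (nexth G x)) => // ye ya yb ye' yc yd _.
by rewrite !permE /= ya yb ya ye' yc yd yc ye xe xb xc xe' xd xa.
Qed.

Lemma flip_e : flip_map e = b. Proof. by rewrite /flip_map eqxx. Qed.
Lemma flip_b : flip_map b = c. Proof. by rewrite /flip_map ne eqxx. Qed.
Lemma flip_c : flip_map c = e. Proof. by rewrite /flip_map !ne eqxx. Qed.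
Lemma flip_e' : flip_map e' = d. Proof. by rewrite /flip_map !ne eqxx. Qed.
Lemma flip_d : flip_map d = a. Proof. by rewrite /flip_map !ne eqxx. Qed.
Lemma flip_a : flip_map a = e'. Proof. by rewrite /flip_map !ne eqxx. Qed.

Lemma flip_out x : x \notin six -> flip_map x = nexth G x.
Proof.
by case: (sixP x) => // xe xa xb xe' xc xd _; rewrite /flip_map xe xb xc xe' xd xa.
Qed.

Let flipE := (flip_e, flip_b, flip_c, flip_e', flip_d, flip_a).

Definition flip_graph : fatgraph H :=
  @Fatgraph H flip_perm (opph G) (@opphK H G) (opph_neq G).

Let flip_next x : nexth flip_graph x = flip_map x. Proof. exact: flip_permE. Qed.

Lemma root_six : root G \notin six.
Proof.
apply/negP; have := next_root G.
by case: (sixP (root G)) => // -> /eqP; rewrite -?/a -?/b -?/c -?/d ?next_b ?next_d ne.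
Qed.

Let opp_e' : opph G e' = e. Proof. exact: opphK. Qed.

Let opp_eqe x : (opph G x == e) = (x == e').
Proof. by rewrite -(inj_eq (@perm_inj _ (opph G))) opphK. Qed.

Let opp_eqe' x : (opph G x == e') = (x == e).
Proof. exact: inj_eq perm_inj _ _. Qed.

(** On the half-edges other than e and e' the boundary cycle before the move visits
the same half-edges in the same order as after it.  A predicate C that propagates
along the new boundary is turned into one that propagates along the old boundary
by giving e and e' the values at the half-edges d and b that precede them there. *)
Lemma flip_boundary (C : pred H) : C (root G) ->
  (forall y, C y -> C (opph G (flip_map y))) -> forall y, C y.
Proof.
move=> C0 Cs.
(* b and d are followed by e' and e along the boundary before the move *)
pose C1 x := if x == e then C d else if x == e' then C b else C x.
have C1out x : x != e -> x != e' -> C1 x = C x.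
  by rewrite /C1 => /negPf-> /negPf->.
have all1 : forall y, C1 y.
  apply: (@boundary_all _ _ G C1 (root G)).
    by move: root_six; rewrite !inE !negb_or => /and5P[r1 _ _ r2 _]; rewrite C1out.
  move=> y; have := next_six y; case: (sixP y) => [->|->|->|->|->|->|ye ya yb ye' yc yd].
  - by move=> _; rewrite /C1 eqxx -/a opp_eqe opp_eqe' !ne /= => /Cs; rewrite flipE.
  - move=> _; rewrite C1out ?ne // -/b => /Cs; rewrite flipE opp_e' => /Cs.
    by rewrite flipE C1out // ?opp_eqe ?opp_eqe' ?ne.
  - by move=> _; rewrite C1out ?ne // next_b -/e' /C1 eqxx ne.
  - by move=> _; rewrite {1}/C1 eqxx ne /= => /Cs;
    rewrite flipE -/c C1out // ?opp_eqe ?opp_eqe' ne.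
  - move=> _; rewrite C1out ?ne // -/d => /Cs; rewrite flipE => /Cs.
    by rewrite flipE C1out // ?opp_eqe ?opp_eqe' ?ne.
  - by move=> _; rewrite C1out ?ne // next_d opp_e' /C1 eqxx.
  case: (sixP (nexth G y)) => // ze _ _ ze' _ _ _.
  rewrite C1out ?ye ?ye' // => /Cs; rewrite flip_out.
    by rewrite C1out // ?opp_eqe ?opp_eqe' ?ze ?ze'.
  by rewrite !inE ye ya yb ye' yc yd.
have Cc : C c by rewrite -C1out ?ne.
have Ca : C a by rewrite -C1out ?ne.
move=> y; have [->|ye] := eqVneq y e; first by move/Cs: Ca; rewrite flipE opp_e'.
have [->|ye'] := eqVneq y e'; first by move/Cs: Cc; rewrite flipE.
by rewrite -C1out.
Qed.

Lemma flip_valence x : x != root G -> valence flip_graph x = 3.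
Proof.
move=> xr; apply/eqP; rewrite card_porbit3 !flip_next.
have := next_six x; have := next_six (nexth G x).
case: (sixP x) => [->|->|->|->|->|->|xe xa xb xe' xc xd];
  rewrite ?flipE ?flipE ?flipE ?ne ?eqxx //.
case: (sixP (nexth G x)) => // ye ya yb ye' yc yd /negbT n2 _.
have n1 : nexth G x \notin six by rewrite !inE ye ya yb ye' yc yd.
rewrite (@flip_out x); last by rewrite !inE xe xa xb xe' xc xd.
by rewrite !flip_out // next3 eqxx next_neq xr.
Qed.

Lemma flip_root : valence flip_graph (root G) = 1.
Proof.
by apply/eqP; rewrite card_porbit1 flip_next flip_out ?root_six ?next_root.
Qed.

Lemma flip_connected : connected_fatgraph flip_graph.
Proof.
case: (@boundary_connected _ flip_graph (root G)) => // C Cr Cs.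
by apply: flip_boundary => // y; rewrite -flip_next => /Cs.
Qed.

Lemma flip_boundary1 : num_boundary_cycles flip_graph = 1.
Proof.
case: (@boundary_connected _ flip_graph (root G)) => // C Cr Cs.
by apply: flip_boundary => // y; rewrite -flip_next => /Cs.
Qed.

Lemma flip_genus : has_genus flip_graph g.
Proof.
have := bf_genus G; rewrite /has_genus bf_boundary flip_boundary1.
have := num_verticesE (bf_univalent G) (@bf_trivalent _ _ G).
have := num_verticesE flip_root flip_valence.
have -> : num_edges flip_graph = num_edges G by [].
lia.
Qed.

Definition flip_bordered : bordered_fatgraph g H :=
  BorderedFatgraph flip_connected flip_genus flip_boundary1 flip_root flip_valence.

Lemma flip_mark_out x : x != e -> x != e' -> flip_mark x = mark G x.
Proof. by rewrite /flip_mark => /negPf-> /negPf->. Qed.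

Lemma flip_mark_opp x : flip_mark (opph flip_bordered x) = (flip_mark x)^-1%g.
Proof.
rewrite /flip_mark /= opp_eqe opp_eqe'.
have [->|xe] := eqVneq x e; first by rewrite ne invgK.
have [_|xe'] := eqVneq x e'; first by [].
exact: mark_opp.
Qed.

Let vertexE x : x != root G ->
  mark G x = (mark G (nexth G x) * mark G (nexth G (nexth G x)))^-1%g.
Proof.
move=> xr; apply: (mulIg (mark G (nexth G x) * mark G (nexth G (nexth G x)))%g).
by rewrite mulVg mulgA mark_vertex.
Qed.

Lemma flip_mark_vertex x : x != root flip_bordered ->
  (flip_mark x * flip_mark (nexth flip_bordered x) *
     flip_mark (nexth flip_bordered (nexth flip_bordered x)))%g = 1%g.
Proof.
move=> xr; rewrite [nexth _]/(nexth flip_graph) !flip_next.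
have mab : (mark G a * mark G b = (mark G e)^-1)%g by rewrite (vertexE e_neq_root) invgK.
have mcd : (mark G c * mark G d = (mark G e')^-1)%g by rewrite (vertexE opp_e_neq_root) invgK.
have mda : (mark G d * mark G a = (mark G b * mark G c)^-1)%g.
  apply: (mulgI (mark G c)); apply: (mulIg (mark G b)).
  by rewrite mulgA mcd -[LHS]mulgA mab invMg mulKVg mulVg mark_opp invgK mulgV.
have mbc : (mark G b * mark G c = (mark G a)^-1 * (mark G d)^-1)%g.
  by rewrite -invMg mda invgK.
have := next_six x; have := next_six (nexth G x).
case: (sixP x) => [->|->|->|->|->|->|xe xa xb xe' xc xd].
1-6: rewrite ?flipE ?flipE /flip_mark ?ne ?eqxx //= => _ _.
- by rewrite -mulgA mulVg.
- by rewrite mbc mulKVg mulVg.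
- by rewrite mulgV.
- by rewrite -mulgA mda mulgV.
- by rewrite invMg mulKVg mulVg.
- by rewrite mda mulVg.
case: (sixP (nexth G x)) => // ye ya yb ye' yc yd /negbT n2 _.
have n1 : nexth G x \notin six by rewrite !inE ye ya yb ye' yc yd.
rewrite (@flip_out x); last by rewrite !inE xe xa xb xe' xc xd.
rewrite flip_out // /flip_mark xe xe' ye ye'.
move: n2; case: (sixP (nexth G (nexth G x))) => // -> _ _ -> _ _ _.
exact: mark_vertex.
Qed.

Lemma flip_mark_gen : generates flip_mark.
Proof.
move=> S S1 SM SV Sm; apply: (@mark_gen _ _ G) => // x.
have Sout y : y != e -> y != e' -> S (mark G y).
  by move=> ye ye'; rewrite -flip_mark_out.
have Se : S (mark G e).
  by rewrite (vertexE e_neq_root); apply: SV; apply: SM; apply: Sout; rewrite -/a -/b ne.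
have [->|xe] := eqVneq x e; first by [].
have [->|xe'] := eqVneq x e'; first by rewrite mark_opp; apply: SV.
exact: Sout.
Qed.

Lemma flip_mark_tail : flip_mark (tail flip_bordered) = (boundary g)^-1%g.
Proof.
rewrite -(mark_tail G) flip_mark_out // /tail /=.
  by rewrite opp_eqe eq_sym opp_e_neq_root.
by rewrite opp_eqe' eq_sym e_neq_root.
Qed.

Definition flip : marked_fatgraph g H :=
  MarkedFatgraph flip_mark_opp flip_mark_vertex flip_mark_gen flip_mark_tail.

Lemma flip_nextE x : nexth flip x = flip_map x. Proof. exact: flip_permE. Qed.

Lemma flip_collapsible : collapsible flip e.
Proof.
rewrite collapsibleE /= e_neq_root opp_e_neq_root -/e' !flip_nextE !flipE.
by rewrite !ne.
Qed.

Lemma flip_whitehead : whitehead_move G e flip.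
Proof.
split=> //.
- by split; [|exact: flip_collapsible].
- move=> x xe xe'; rewrite /collapse_next !flip_nextE -/e' -/a -/c flipE flipE.
  have := next_six x; move: xe xe'.
  case: (sixP x) => [->|->|->|->|->|->|xe xa xb xe' xc xd];
    rewrite -?/b -?/d ?next_b ?next_d ?flipE ?ne ?eqxx // => _ _.
  rewrite flip_out; last by rewrite !inE xe xa xb xe' xc xd.
  by case: (sixP (nexth G x)) => // -> _ _ -> _ _ _.
- rewrite -/a -/b mem_porbit3 ?inE; last first.
    apply: flip_valence; have := root_six.
    by rewrite !inE !negb_or ![root G == _]eq_sym => /and3P[].
  by rewrite !(flip_nextE, flipE) !ne.
- by move=> x; apply: flip_mark_out.
Qed.

End Flip.
Arguments flip {g H G e} ce.

(** * Isomorphisms, and being connected by Whitehead moves *)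

Section Isomorphisms.
Variable g : nat.

Lemma marked_iso_refl (H : finType) (G : marked_fatgraph g H) : marked_iso G G.
Proof. by exists id; [exact: inv_bij|split]. Qed.

Lemma marked_iso_sym (H1 H2 : finType) (G1 : marked_fatgraph g H1)
    (G2 : marked_fatgraph g H2) : marked_iso G1 G2 -> marked_iso G2 G1.
Proof.
case=> f bf [fn fo ft fm]; have [f' fK f'K] := bf.
exists f'; first by exists f.
split=> [h|h||h]; try by apply: (can_inj fK); rewrite f'K ?ft ?fn ?fo ?f'K.
by rewrite -fm f'K.
Qed.

Lemma marked_iso_trans (H1 H2 H3 : finType) (G1 : marked_fatgraph g H1)
    (G2 : marked_fatgraph g H2) (G3 : marked_fatgraph g H3) :
  marked_iso G1 G2 -> marked_iso G2 G3 -> marked_iso G1 G3.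
Proof.
case=> f bf [fn fo ft fm] [k bk [kn ko kt km]].
exists (k \o f); first exact: bij_comp.
by split=> [h|h||h] /=; rewrite ?ft ?fn ?fo ?fm ?kt ?kn ?ko ?km.
Qed.

(** Moves do not depend on the names of half-edges. *)
Lemma flip_natural (H1 H2 : finType) (G1 : marked_fatgraph g H1)
    (G2 : marked_fatgraph g H2) (e : H2) (ce : collapsible G2 e) :
  marked_iso G1 G2 ->
  exists e1, exists ce1 : collapsible G1 e1, marked_iso (flip ce1) (flip ce).
Proof.
case=> f bf [fn fo ft fm]; have fi := bij_inj bf; have [f' fK f'K] := bf.
have fr : f (root G1) = root G2.
  by rewrite -(@opphK _ G1 (root G1)) fo -[opph G1 (root G1)]/(tail G1) ft opphK.
move: ce; rewrite -(f'K e); move: (f' e) => {}e ce.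
have ce1 : collapsible G1 e.
  by move: ce; rewrite !collapsibleE -!fo -!fn -!fr !(inj_eq fi).
exists e, ce1; exists f; first by [].
split=> [h|||h] //.
  rewrite !flip_nextE /flip_map -!fo -!fn !(inj_eq fi).
  by do !case: ifP => // _.
by rewrite /= /flip_mark -!fo -!fn !(inj_eq fi) !fm.
Qed.

(** Two moves on the same edge turn the quadrilateral by a half, which is the same
as exchanging the two halves of the edge.  Hence a move is undone by another move,
up to isomorphism. *)
Lemma flip_twice (H : finType) (G : marked_fatgraph g H) (e : H)
    (ce : collapsible G e) : exists ce' : collapsible (flip ce) e,
  marked_iso (flip ce') G.
Proof.
exists (flip_collapsible ce).
pose F := flip ce; pose e' := opph G e.
pose a := nexth G e; pose b := nexth G a; pose c := nexth G e'; pose d := nexth G c.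
have ne : _ := uniq6 (six_uniq ce); rewrite -/e' -/a -/b -/c -/d in ne.
have nb : nexth G b = e := next_b G e.
have nd : nexth G d = e' := next_d G e.
have Fe : nexth F e = b by rewrite flip_nextE flip_e.
have Fb : nexth F b = c by rewrite flip_nextE flip_b.
have Fe' : nexth F e' = d by rewrite flip_nextE flip_e'.
have Fd : nexth F d = a by rewrite flip_nextE flip_d.
have FFE x : flip_map F e x =
    if x == e then c else if x == c then d else if x == d then e
    else if x == e' then a else if x == a then b else if x == b then e'
    else nexth F x.
  by rewrite /flip_map -[opph F e]/e' Fe Fb Fe' Fd.
exists (tperm e e'); first exact: inv_bij (@tpermK _ e e').
split=> [x|x||x].
- rewrite flip_nextE FFE.
  have := next_six G e x; case: (sixP G e x) => [->|->|->|->|->|->|xe xa xb xe' xc xd].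
  1-6: by rewrite -?/e' -?/a -?/b -?/c -?/d !permE /= ?(ne, eqxx, nb, nd) /= ?(ne, eqxx, nb, nd).
  case: (sixP G e (nexth G x)) => // ye ya yb ye' yc yd _.
  rewrite xe xa xb xe' xc xd flip_nextE flip_out; last first.
    by rewrite !inE xe xa xb xe' xc xd.
  by rewrite !tpermD // eq_sym ?xe ?xe' ?ye ?ye'.
- rewrite /= -/e'; have [->|xe] := eqVneq x e; first by rewrite -/e' tpermR tpermL opphK.
  have [->|xe'] := eqVneq x e'; first by rewrite opphK tpermL tpermR.
  by rewrite !tpermD // eq_sym // -?/e' ?(inj_eq perm_inj) //
    -(inj_eq (@perm_inj _ (opph G))) opphK.
- have := opp_e_neq_root ce; have := e_neq_root ce; rewrite /tail /= -/e' => r1 r2.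
  rewrite tpermD // ?(inj_eq perm_inj) //.
  by apply: contra r2 => /eqP er; apply/eqP; rewrite /e' er opphK.
- have mcd : (mark G c * mark G d = mark G e)%g.
    apply: (mulgI (mark G e')); rewrite mulgA mark_vertex ?(opp_e_neq_root ce) //.
    by rewrite mark_opp mulVg.
  have -> : mark (flip (flip_collapsible ce)) x =
      if x == e then (mark G c * mark G d)^-1%g
      else if x == e' then (mark G c * mark G d)%g else flip_mark G e x.
    by rewrite /= /flip_mark -[opph (flip ce) e]/e' Fe Fb Fe' /= /flip_mark !ne.
  rewrite mcd; have [->|xe] := eqVneq x e; first by rewrite tpermL mark_opp.
  have [->|xe'] := eqVneq x e'; first by rewrite tpermR.
  by rewrite tpermD 1?eq_sym // flip_mark_out.
Qed.

End Isomorphisms.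

Section Linked.
Variables (g : nat) (H : finType).
Implicit Types G K L : marked_fatgraph g H.

(** Whitehead sequences in which each step is the explicit move [flip], so that
the data along the path can be computed from the names of the edges. *)
Fixpoint flip_path G (es : seq H) K : Prop :=
  if es is e :: es' then exists ce : collapsible G e, flip_path (flip ce) es' K
  else marked_iso G K.

Definition linked G K : Prop := exists es, flip_path G es K.

Lemma flip_path_whitehead G es K : flip_path G es K -> whitehead_sequence G es K.
Proof.
elim: es G => //= e es IHes G [ce /IHes rest].
by exists (flip ce) => //; apply: flip_whitehead.
Qed.

Lemma linked_iso_l G1 G2 K : marked_iso G1 G2 -> linked G2 K -> linked G1 K.
Proof.
move=> i12 [es]; elim: es G1 G2 i12 => [|e es IHes] G1 G2 i12 /=.
  by move=> i2; exists [::]; apply: marked_iso_trans i2.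
case=> ce /(IHes _ _ _); have [e1 [ce1 i]] := flip_natural ce i12.
by case/(_ _ i)=> es1 p1; exists (e1 :: es1), ce1.
Qed.

Lemma linked_iso G K : marked_iso G K -> linked G K.
Proof. by exists [::]. Qed.

Lemma linked_refl G : linked G G.
Proof. exact/linked_iso/marked_iso_refl. Qed.

Lemma linked_flip G e (ce : collapsible G e) K : linked (flip ce) K -> linked G K.
Proof. by case=> es p; exists (e :: es), ce. Qed.

Lemma linked_trans G K L : linked G K -> linked K L -> linked G L.
Proof.
case=> es; elim: es G => [|e es IHes] G /=; first exact: linked_iso_l.
by case=> ce /IHes p /p; apply: linked_flip.
Qed.

Lemma linked_sym G K : linked G K -> linked K G.
Proof.
case=> es; elim: es G => [|e es IHes] G /=.
  by move=> i; apply/linked_iso/marked_iso_sym.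
case=> ce /IHes p; apply: linked_trans p _; have [ce' i] := flip_twice ce.
by apply: (@linked_flip _ _ ce'); apply: linked_iso.
Qed.

End Linked.

(** * Planar binary trees inside a fatgraph, and rotations *)

Inductive btree (T : Type) := Leaf of T | Node of btree T & btree T.

Fixpoint leaves T (t : btree T) : seq T :=
  match t with Leaf x => [:: x] | Node t1 t2 => leaves t1 ++ leaves t2 end.

(** The normal form of the trees with given leaves. *)
Fixpoint comb T (x : T) (s : seq T) : btree T :=
  if s is y :: s' then Node (Leaf x) (comb y s') else Leaf x.

Section Rotations.
Variable T : Type.
Implicit Types t : btree T.

Lemma leaves_comb (x : T) s : leaves (comb x s) = x :: s.
Proof. by elim: s x => //= y s IHs x; rewrite IHs. Qed.

Lemma leaves_neq0 t : exists x s, leaves t = x :: s.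
Proof.
elim: t => [x|t1 [x [s e]] t2 _] /=; first by exists x, [::].
by exists x, (s ++ leaves t2); rewrite e.
Qed.

Inductive rot : btree T -> btree T -> Prop :=
| RotL t1 t2 t3 : rot (Node t1 (Node t2 t3)) (Node (Node t1 t2) t3)
| RotR t1 t2 t3 : rot (Node (Node t1 t2) t3) (Node t1 (Node t2 t3))
| RotNodeL t1 t1' t2 : rot t1 t1' -> rot (Node t1 t2) (Node t1' t2)
| RotNodeR t1 t2 t2' : rot t2 t2' -> rot (Node t1 t2) (Node t1 t2').

Inductive rots : btree T -> btree T -> Prop :=
| RotsRefl t : rots t t
| RotsStep t t' t'' : rot t t' -> rots t' t'' -> rots t t''.

Lemma rot_leaves t t' : rot t t' -> leaves t' = leaves t.
Proof. by elim=> //= *; rewrite ?catA //; congr (_ ++ _). Qed.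

Lemma rot_sym t t' : rot t t' -> rot t' t.
Proof. by elim=> *; constructor. Qed.

Lemma rots_trans t t' t'' : rots t t' -> rots t' t'' -> rots t t''.
Proof. by elim=> // u u' u'' r _ IH /IH; apply: RotsStep. Qed.

Lemma rots_sym t t' : rots t t' -> rots t' t.
Proof.
elim=> [u|u u' u'' r _ IH]; first exact: RotsRefl.
by apply: (rots_trans IH); apply: RotsStep (rot_sym r) (RotsRefl _).
Qed.

Lemma rots_nodeL t1 t1' t2 : rots t1 t1' -> rots (Node t1 t2) (Node t1' t2).
Proof.
elim=> [u|u u' u'' r _]; first exact: RotsRefl.
by apply: RotsStep; apply: RotNodeL.
Qed.

Lemma rots_nodeR t1 t2 t2' : rots t2 t2' -> rots (Node t1 t2) (Node t1 t2').
Proof.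
elim=> [u|u u' u'' r _]; first exact: RotsRefl.
by apply: RotsStep; apply: RotNodeR.
Qed.

Lemma rots_comb_cat x s y s' :
  rots (Node (comb x s) (comb y s')) (comb x (s ++ y :: s')).
Proof.
elim: s x => [|z s IHs] x /=; first exact: RotsRefl.
by apply: RotsStep (RotR _ _ _) _; apply/rots_nodeR/IHs.
Qed.

Lemma rots_comb t x s : leaves t = x :: s -> rots t (comb x s).
Proof.
elim: t x s => [z|t1 IH1 t2 IH2] x s /=.
  by case=> -> <-; apply: RotsRefl.
have [x1 [s1 e1]] := leaves_neq0 t1; have [x2 [s2 e2]] := leaves_neq0 t2.
rewrite e1 e2 => -[<- <-].
apply: (rots_trans (rots_nodeL _ (IH1 _ _ e1))).
by apply: (rots_trans (rots_nodeR _ (IH2 _ _ e2))); apply: rots_comb_cat.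
Qed.

(** The flip graph of the triangulations of a polygon is connected: every tree can
be rotated to a comb. *)
Lemma eq_leaves_rots t t' : leaves t = leaves t' -> rots t t'.
Proof.
have [x [s e]] := leaves_neq0 t => ett'.
by apply: (rots_trans (rots_comb e)); apply/rots_sym/rots_comb; rewrite -ett'.
Qed.

End Rotations.

Section Fits.
Variables (H : finType).

Section Graph.
Variable G : fatgraph H.

(** The tree t grows out of the half-edge h: the edge of h ends at a vertex, and
the two subtrees grow out of the half-edges that follow at this vertex in the
cyclic order.  Leaves are labelled by the half-edges where the growth stops. *)
Fixpoint fits (h : H) (t : btree H) : Prop :=
  match t with
  | Leaf x => x = h
  | Node t1 t2 => fits (nexth G (opph G h)) t1 /\
                  fits (nexth G (nexth G (opph G h))) t2
  end.

(** The half-edges attached to the vertices passed while t grows out of h.  The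
half-edge h itself belongs to the vertex below and is left out, which makes the
lists of the two subtrees of a vertex disjoint from the vertex. *)
Fixpoint below (h : H) (t : btree H) : seq H :=
  match t with
  | Leaf _ => [::]
  | Node t1 t2 =>
      let a := nexth G (opph G h) in
      [:: opph G h, a & below a t1 ++ nexth G a :: below (nexth G a) t2]
  end.

Lemma leaves_below h t : fits h t -> {subset leaves t <= h :: below h t}.
Proof.
elim: t h => [x|t1 IH1 t2 IH2] h /=; first by move=> -> l.
case=> /IH1 f1 /IH2 f2 l; rewrite mem_cat => /orP[/f1|/f2];
  by rewrite !(inE, mem_cat) => /orP[->|->]; rewrite ?orbT.
Qed.

End Graph.

Lemma fits_ext (G G' : fatgraph H) h t :
    opph G' =1 opph G -> {in below G h t, nexth G' =1 nexth G} ->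
  (fits G h t -> fits G' h t) /\ below G' h t = below G h t.
Proof.
move=> eo; elim: t h => [x|t1 IH1 t2 IH2] h //= en.
have ek : nexth G' (opph G' h) = nexth G (opph G h).
  by rewrite eo en // inE eqxx.
have ea : nexth G' (nexth G (opph G h)) = nexth G (nexth G (opph G h)).
  by rewrite en // !inE eqxx orbT.
have [|f1 b1] := IH1 (nexth G (opph G h)).
  by move=> x xb; apply: en; rewrite !inE mem_cat xb !orbT.
have [|f2 b2] := IH2 (nexth G (nexth G (opph G h))).
  by move=> x xb; apply: en; rewrite !(inE, mem_cat) xb !orbT.
by rewrite ek ea b1 b2 eo; split=> // -[/f1 ? /f2].
Qed.

End Fits.

Section RotationFlip.
Variables (g : nat) (H : finType) (G : marked_fatgraph g H).

(** A rotation of the tree is a move on the edge e between the two nodes that it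
involves.  The move changes the cyclic order only at the six half-edges of these
two vertices, so the rest of the tree still fits, and the edge e is inside the
tree, so no leaf is affected. *)
Lemma rot_flip h t t' : rot t t' ->
    fits G h t -> uniq (below G h t) -> root G \notin below G h t ->
  exists e, exists ce : collapsible G e,
    [/\ fits (flip ce) h t', perm_eq (below (flip ce) h t') (below G h t),
        {in [predC below G h t], nexth (flip ce) =1 nexth G},
        (e \in below G h t) /\ (opph G e \in below G h t)
      & (e \notin leaves t) /\ (opph G e \notin leaves t)].
Proof.
move=> r; elim: {t t'}r h => [t1 t2 t3|t1 t2 t3|t1 t1' t2 _ IH|t1 t2 t2' _ IH] h.
- set k := opph G h; set a := nexth G k; set e := nexth G a.
  set e' := opph G e; set c := nexth G e'; set d := nexth G c.
  case=> f1 [f2 f3]; set L := below G h _.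
  have LE : L = [:: k, a & below G a t1 ++
                 [:: e, e', c & below G c t2 ++ d :: below G d t3]] by [].
  (* S are the half-edges at the two ends of e, R are all others below h. *)
  pose S := [:: k; a; e; e'; c; d].
  pose R := below G a t1 ++ below G c t2 ++ below G d t3 => u nr.
  have pL : perm_eq L (S ++ R).
    by apply/seq.permP=> p; rewrite LE /S /R /= ?count_cat /= ?count_cat /=; clear; lia.
  have nek : nexth G e = k by apply: next3.
  have mL x : (x \in L) = (x \in S ++ R) by apply: perm_mem.
  move: u; rewrite (perm_uniq pL) cat_uniq => /and3P[uS /hasPn dis _].
  have ne := uniq6 uS.
  have Lr x : x \in L -> x != root G by apply: contraTneq => ->.
  have ce : collapsible G e.
    by rewrite collapsibleE nek -/e' -/a !ne !Lr // mL !inE eqxx ?orbT.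
  have six x : (x \in [:: e; nexth G e; nexth G (nexth G e); e'; c; d]) = (x \in S).
    by rewrite nek !inE; case: (x == k); case: (x == a); case: (x == e); rewrite ?orbT.
  have outS x : x \notin S -> nexth (flip ce) x = nexth G x.
    by rewrite -six => xS; rewrite flip_nextE flip_out.
  have out t b : {subset below G b t <= R} ->
      (fits G b t -> fits (flip ce) b t) /\ below (flip ce) b t = below G b t.
    by move=> sub; apply: fits_ext => // x /sub /dis; apply: outS.
  have [|g1 b1] := out t1 a; first by move=> x xb; rewrite mem_cat xb.
  have [|g2 b2] := out t2 c; first by move=> x xb; rewrite !mem_cat xb orbT.
  have [|g3 b3] := out t3 d; first by move=> x xb; rewrite !mem_cat xb !orbT.
  have Fe : nexth (flip ce) e = a by rewrite flip_nextE flip_e nek.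
  have Fa : nexth (flip ce) a = c.
    by rewrite flip_nextE -[a](_ : nexth G (nexth G e) = a) ?flip_b // nek.
  have Fe' : nexth (flip ce) e' = d by rewrite flip_nextE flip_e'.
  have Fk : nexth (flip ce) k = e' by rewrite flip_nextE -nek flip_a.
  have ee' : opph G e' = e by apply: opphK.
  exists e, ce.
  rewrite /= -/k Fk ee' Fe Fa Fe' b1 b2 b3; split=> //.
  + by split; [split; [apply: g1|apply: g2]|apply: g3].
  + by apply/seq.permP=> p; rewrite LE /= ?count_cat /= ?count_cat /=; clear; lia.
  + by move=> x; rewrite inE /= mL mem_cat negb_or => /andP[/outS].
  + by rewrite !mL !inE !eqxx !orbT.
  + have notin x : x \in S -> x \notin [:: a; c; d] ->
        x \notin leaves t1 ++ leaves t2 ++ leaves t3.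
      move=> xS; apply: contra; rewrite !mem_cat.
      have xR : x \in R = false by apply/negbTE/negP=> /dis; rewrite xS.
      move/negbT: xR; rewrite !mem_cat !negb_or => /and3P[n1 n2 n3].
      by case/or3P=> [/(leaves_below f1)|/(leaves_below f2)|/(leaves_below f3)];
        rewrite !inE ?(negPf n1) ?(negPf n2) ?(negPf n3) orbF => ->; rewrite ?orbT.
    by split; apply: notin; rewrite !inE ?ne ?eqxx ?orbT.
- set k := opph G h; set e := nexth G k; set d := nexth G e.
  set e' := opph G e; set a := nexth G e'; set c := nexth G a.
  case=> [[f1 f2] f3]; set L := below G h _.
  have LE : L = [:: k, e & [:: e', a & below G a t1 ++ c :: below G c t2] ++
                 d :: below G d t3] by [].
  (* S are the half-edges at the two ends of e, R are all others below h. *)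
  pose S := [:: k; a; e; e'; c; d].
  pose R := below G a t1 ++ below G c t2 ++ below G d t3 => u nr.
  have pL : perm_eq L (S ++ R).
    by apply/seq.permP=> p; rewrite LE /S /R /= ?count_cat /= ?count_cat /=; clear; lia.
  have ndk : nexth G d = k by apply: next3.
  have mL x : (x \in L) = (x \in S ++ R) by apply: perm_mem.
  move: u; rewrite (perm_uniq pL) cat_uniq => /and3P[uS /hasPn dis _].
  have ne := uniq6 uS.
  have Lr x : x \in L -> x != root G by apply: contraTneq => ->.
  have ce : collapsible G e.
    by rewrite collapsibleE -/e' -/d ndk !ne !Lr // mL !inE eqxx ?orbT.
  have six x : (x \in [:: e; nexth G e; nexth G (nexth G e); e'; a; c]) = (x \in S).
    by rewrite ndk !inE; do !case: eqP => //=.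
  have outS x : x \notin S -> nexth (flip ce) x = nexth G x.
    by rewrite -six => xS; rewrite flip_nextE flip_out.
  have out t b : {subset below G b t <= R} ->
      (fits G b t -> fits (flip ce) b t) /\ below (flip ce) b t = below G b t.
    by move=> sub; apply: fits_ext => // x /sub /dis; apply: outS.
  have [|g1 b1] := out t1 a; first by move=> x xb; rewrite mem_cat xb.
  have [|g2 b2] := out t2 c; first by move=> x xb; rewrite !mem_cat xb orbT.
  have [|g3 b3] := out t3 d; first by move=> x xb; rewrite !mem_cat xb !orbT.
  have Fe : nexth (flip ce) e = k by rewrite flip_nextE flip_e ndk.
  have Fk : nexth (flip ce) k = a by rewrite flip_nextE -ndk flip_b.
  have Fa : nexth (flip ce) a = e by rewrite flip_nextE flip_c.
  have Fe' : nexth (flip ce) e' = c by rewrite flip_nextE flip_e'.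
  have Fc : nexth (flip ce) c = d by rewrite flip_nextE flip_d.
  exists e, ce.
  rewrite /= -/k Fk Fa -/e' Fe' Fc b1 b2 b3; split=> //.
  + by split; [apply: g1|split; [apply: g2|apply: g3]].
  + by apply/seq.permP=> p; rewrite LE /= ?count_cat /= ?count_cat /=; clear; lia.
  + by move=> x; rewrite inE /= mL mem_cat negb_or => /andP[/outS].
  + by rewrite !mL !inE !eqxx !orbT.
  + have notin x : x \in S -> x \notin [:: a; c; d] ->
        x \notin (leaves t1 ++ leaves t2) ++ leaves t3.
      move=> xS; apply: contra; rewrite -catA !mem_cat.
      have xR : x \in R = false by apply/negbTE/negP=> /dis; rewrite xS.
      move/negbT: xR; rewrite !mem_cat !negb_or => /and3P[n1 n2 n3].
      by case/or3P=> [/(leaves_below f1)|/(leaves_below f2)|/(leaves_below f3)];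
        rewrite !inE ?(negPf n1) ?(negPf n2) ?(negPf n3) orbF => ->; rewrite ?orbT.
    by split; apply: notin; rewrite !inE ?ne ?eqxx ?orbT.
- set k := opph G h; set a := nexth G k; set b := nexth G a.
  set L := below G h _; case=> f1 f2.
  have LE : L = [:: k, a & below G a t1 ++ b :: below G b t2] by [].
  move=> u nr; have [||e [ce [f1' p1 out [eb eb'] [el el']]]] := IH a f1.
  - by move: u; rewrite LE /= cat_uniq => /and4P[].
  - by apply: contra nr; rewrite LE !inE mem_cat => ->; rewrite !orbT.
  have dis : uniq ([:: k; a] ++ below G a t1 ++ b :: below G b t2) by [].
  move: dis; rewrite cat_uniq => /and3P[_ /hasPn ka].
  rewrite cat_uniq => /and3P[_ /hasPn dis _].
  have out1 x : x \in b :: below G b t2 -> nexth (flip ce) x = nexth G x.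
    by move=> xb; apply: out; rewrite inE /=; apply: dis.
  have outka x : x \in [:: k; a] -> nexth (flip ce) x = nexth G x.
    move=> xka; apply: out; rewrite inE /=; apply: contraL xka => xb.
    by apply: ka; rewrite mem_cat xb.
  have [|g2 b2] := @fits_ext _ G (flip ce) b t2 (frefl _).
    by move=> x xb; apply: out1; rewrite inE xb orbT.
  have Fk : nexth (flip ce) k = a by rewrite outka // inE eqxx.
  have Fa : nexth (flip ce) a = b by rewrite outka // !inE eqxx orbT.
  exists e, ce; rewrite /= -/k Fk Fa b2; split.
  + by split; [|apply: g2].
  + by rewrite LE !perm_cons perm_cat2r.
  + move=> x; rewrite inE /= LE !inE mem_cat !negb_or => /and4P[_ _ xb _].
    by apply: out; rewrite inE.
  + by rewrite LE !inE !mem_cat eb eb' !orbT.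
  + have notin x : x \in below G a t1 -> x \notin leaves t2.
      move=> xb; apply/negP=> /(leaves_below f2) /dis /negP; exact.
    by rewrite !mem_cat !negb_or el el' !notin.
- set k := opph G h; set a := nexth G k; set b := nexth G a.
  set L := below G h _; case=> f1 f2.
  have LE : L = [:: k, a & below G a t1 ++ b :: below G b t2] by [].
  move=> u nr; have [||e [ce [f2' p2 out [eb eb'] [el el']]]] := IH b f2.
  - by move: u; rewrite LE /= cat_uniq => /and5P[_ _ _ _ /andP[]].
  - by apply: contra nr; rewrite LE !(inE, mem_cat) => ->; rewrite !orbT.
  have pL : perm_eq L (below G b t2 ++ [:: k, a, b & below G a t1]).
    by apply/seq.permP=> p; rewrite LE /= ?count_cat /= ?count_cat /=; clear; lia.
  move: (u); rewrite (perm_uniq pL) cat_uniq => /and3P[_ /hasPn dis _].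
  have out1 x : x \in [:: k, a, b & below G a t1] -> nexth (flip ce) x = nexth G x.
    by move=> xb; apply: out; rewrite inE /=; apply: dis.
  have [|g1 b1] := @fits_ext _ G (flip ce) a t1 (frefl _).
    by move=> x xb; apply: out1; rewrite !inE xb !orbT.
  have Fk : nexth (flip ce) k = a by rewrite out1 // inE eqxx.
  have Fa : nexth (flip ce) a = b by rewrite out1 // !inE eqxx orbT.
  exists e, ce; rewrite /= -/k Fk Fa b1; split.
  + by split; [apply: g1|].
  + by rewrite LE !perm_cons perm_cat2l perm_cons.
  + move=> x; rewrite inE /= LE !(inE, mem_cat) !negb_or => /and5P[_ _ _ _ xb].
    by apply: out; rewrite inE.
  + by rewrite LE !(inE, mem_cat) eb eb' !orbT.
  + have notin x : x \in below G b t2 -> x \notin leaves t1.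
      move=> xb; apply/negP=> /(leaves_below f1) xa.
      have /dis/negP[] // : x \in [:: k, a, b & below G a t1].
      by move: xa; rewrite !inE => /orP[] ->; rewrite !orbT.
    by rewrite !mem_cat !negb_or el el' !notin.
Qed.

End RotationFlip.

(** * Spanning trees *)

Section Inner.
Variables (H : finType) (G : fatgraph H).

(** The two halves of each edge that is not cut.  Unlike [below] this list is stable
under the reversal of edges. *)
Fixpoint inner (h : H) (t : btree H) : seq H :=
  match t with
  | Leaf _ => [::]
  | Node t1 t2 =>
      let a := nexth G (opph G h) in
      [:: h, opph G h & inner a t1 ++ inner (nexth G a) t2]
  end.

Lemma inner_opph h t x : x \in inner h t -> opph G x \in inner h t.
Proof.
elim: t h => [y|t1 IH1 t2 IH2] h //=; rewrite !inE !mem_cat.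
case/or4P=> [/eqP->|/eqP->|/IH1->|/IH2->]; rewrite ?opphK ?eqxx ?orbT //.
Qed.

(** Every half-edge met by the tree is a leaf or belongs to an edge inside the
tree.  As the second kind is stable under reversal of edges, so are the leaves of a
spanning tree: they are the two ends of each chord. *)
Lemma perm_below h t :
  fits G h t -> perm_eq (h :: below G h t) (leaves t ++ inner h t).
Proof.
elim: t h => [y|t1 IH1 t2 IH2] h /=; first by move=> ->.
case=> /IH1/seq.permP p1 /IH2/seq.permP p2; apply/seq.permP=> p.
have := p1 p; have := p2 p; rewrite /= !count_cat /= !count_cat; lia.
Qed.

(** A binary tree has one node less than it has leaves, and 3 half-edges for each
node. *)
Lemma size_below h t : size (below G h t) + 3 = 3 * size (leaves t).
Proof.
elim: t h => [y|t1 IH1 t2 IH2] h //=; rewrite !size_cat /=.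
have := IH1 (nexth G (opph G h)).
have := IH2 (nexth G (nexth G (opph G h))); lia.
Qed.

End Inner.

Section Subst.
Variable T : eqType.

Fixpoint subst (z : T) (s t : btree T) : btree T :=
  match t with
  | Leaf x => if x == z then s else Leaf x
  | Node t1 t2 => Node (subst z s t1) (subst z s t2)
  end.

Lemma subst_id z t : subst z (Leaf z) t = t.
Proof. by elim: t => [x|t1 IH1 t2 IH2] /=; [case: eqP => [->|]|rewrite IH1 IH2]. Qed.

Lemma subst_out z s t : z \notin leaves t -> subst z s t = t.
Proof.
elim: t => [x|t1 IH1 t2 IH2] /=; first by rewrite inE eq_sym => /negPf->.
by rewrite mem_cat negb_or => /andP[/IH1-> /IH2->].
Qed.

Lemma leaves_subst z s t w1 w2 : leaves t = w1 ++ z :: w2 -> z \notin w1 ++ w2 ->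
  leaves (subst z s t) = w1 ++ leaves s ++ w2.
Proof.
have fl : leaves (subst z s t) =
    flatten [seq if x == z then leaves s else [:: x] | x <- leaves t].
  elim: t => [x|t1 IH1 t2 IH2] /=; first by case: eqP; rewrite /= ?cats0.
  by rewrite map_cat flatten_cat IH1 IH2.
have out w : z \notin w ->
    flatten [seq if x == z then leaves s else [:: x] | x <- w] = w.
  elim: w => //= x w IHw; rewrite inE eq_sym negb_or.
  by case/andP=> /negPf-> /IHw->.
rewrite {}fl => -> nz; move: nz; rewrite mem_cat negb_or => /andP[n1 n2].
by rewrite map_cat flatten_cat /= eqxx !out.
Qed.

Lemma perm_leaves_subst z s t : count_mem z (leaves t) = 1 ->
  perm_eq (z :: leaves (subst z s t)) (leaves t ++ leaves s).
Proof.
move=> c1; have zt : z \in leaves t by rewrite -has_pred1 has_count c1.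
have [w1 [w2 e]] : exists w1 w2, leaves t = w1 ++ z :: w2.
  by case/splitPr: zt => w1 w2; exists w1, w2.
move: c1; rewrite e count_cat /= eqxx => c1.
have nz : z \notin w1 ++ w2 by rewrite -has_pred1 has_count count_cat; lia.
rewrite (leaves_subst _ e nz); apply/seq.permP=> p.
by rewrite /= !count_cat /=; lia.
Qed.

End Subst.

Section Spans.
Variables (g : nat) (H : finType).
Implicit Types G : marked_fatgraph g H.

(** The tree that grows out of the univalent vertex reaches every half-edge exactly
once. *)
Record spans G (t : btree H) : Prop := Spans {
  spans_fits : fits G (root G) t;
  spans_uniq : uniq (root G :: below G (root G) t);
  spans_all : forall x, x \in root G :: below G (root G) t }.

(** Replacing the leaf z by different trees takes place at one and the same
half-edge h of the fatgraph, and the half-edges met by the replaced part are just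
added. *)
Lemma subst_position G r z s t : fits G r (subst z s t) -> count_mem z (leaves t) = 1 ->
  exists h, fits G h s /\ forall s', fits G h s' ->
    fits G r (subst z s' t) /\
    perm_eq (below G r (subst z s' t)) (below G r (subst z (Leaf h) t) ++ below G h s').
Proof.
elim: t r => [x|t1 IH1 t2 IH2] r /=.
  rewrite addn0; case: eqP => // _ fs _; exists r; split=> // s' fs'; split=> //.
case=> f1 f2; rewrite count_cat => c.
have nil0 t : count_mem z (leaves t) = 0 -> z \notin leaves t.
  by move=> c0; rewrite -has_pred1 has_count c0.
have [c1|c1] := posnP (count_mem z (leaves t1)).
  have [|h [fs Hs]] := IH2 _ f2; first by rewrite c1 in c.
  exists h; split=> // s' /Hs[g2 p2].
  rewrite !(@subst_out _ z _ t1) ?nil0 // in f1 *; split=> //.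
  by rewrite !perm_cons -catA perm_cat2l perm_cons.
have [k1 k2] : count_mem z (leaves t1) = 1 /\ count_mem z (leaves t2) = 0.
  by move: c c1; case: (count _ (leaves t1)) => [|[|n]] //; case: (count _ (leaves t2)).
have [//|h [fs Hs]] := IH1 _ f1.
exists h; split=> // s' /Hs[g1 p1].
rewrite !(@subst_out _ z _ t2) ?nil0 // in f2 *; split=> //.
rewrite !perm_cons; apply/seq.permP=> p; move/seq.permP/(_ p): p1.
by rewrite !count_cat /=; lia.
Qed.

Lemma spans_rots G t t' : rots t t' -> spans G t ->
  exists G', [/\ linked G G', spans G' t' & {in leaves t, mark G' =1 mark G}].
Proof.
move=> r; elim: r G => {t t'} [t|t t' t'' r _ IH] G st.
  by exists G; split=> //; apply: linked_refl.
have [ft u al] := st; move: (u); rewrite cons_uniq => /andP[nr ub].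
have [e [ce [f1 p1 _ _ [el el']]]] := rot_flip r ft ub nr.
have p1' : perm_eq (root (flip ce) :: below (flip ce) (root (flip ce)) t')
                   (root G :: below G (root G) t) by rewrite perm_cons.
have [|G' [lG sG mG]] := IH (flip ce).
  by split=> // [|x]; rewrite ?(perm_uniq p1') ?(perm_mem p1').
exists G'; split=> //; first exact: linked_flip lG.
move=> l lt; rewrite mG ?(rot_leaves r) // /= flip_mark_out //.
  by apply: contraNneq el => <-.
by apply: contraNneq el' => <-.
Qed.

Section OneTree.
Variables (G : marked_fatgraph g H) (t : btree H).
Hypothesis st : spans G t.

Lemma leaves_uniq : uniq (leaves t).
Proof.
have := spans_uniq st; rewrite (perm_uniq (perm_below (spans_fits st))) cat_uniq.
by case/and3P.
Qed.

Lemma leaves_opph l : l \in leaves t -> opph G l \in leaves t.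
Proof.
move=> lt; have := spans_all st (opph G l).
rewrite (perm_mem (perm_below (spans_fits st))) mem_cat => /orP[//|/inner_opph].
rewrite opphK => li; have := spans_uniq st.
rewrite (perm_uniq (perm_below (spans_fits st))) cat_uniq => /and3P[_ /hasPn/(_ _ li)].
by rewrite lt.
Qed.

Lemma size_leaves : size (leaves t) = 4 * g.
Proof.
have := card_half_edges G; have := size_below G (root G) t.
have <- : size (root G :: below G (root G) t) = #|H|.
  rewrite -(card_uniqP (spans_uniq st)); apply: eq_card => x.
  by rewrite (spans_all st).
move=> /=; lia.
Qed.

(** The vertex relation says that the mark of the edge entering a vertex is the
product of the marks of the edges leaving it. *)
Lemma mark_leaves h s : fits G h s -> root G \notin below G h s ->
  mark G h = (\prod_(l <- leaves s) mark G l)%g.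
Proof.
elim: s h => [x|s1 IH1 s2 IH2] h /=; first by move=> ->; rewrite big_seq1.
case=> f1 f2; rewrite !(inE, mem_cat) !negb_or => /and5P[kr _ n1 _ n2].
rewrite big_cat /= -(IH1 _ f1 n1) -(IH2 _ f2 n2) eq_sym in kr *.
apply: (mulgI (mark G (opph G h))).
by rewrite mulgA mark_vertex // mark_opp mulVg.
Qed.

Lemma prod_leaves : (\prod_(l <- leaves t) mark G l)%g = boundary g.
Proof.
have /andP[nr _] := spans_uniq st.
rewrite -(mark_leaves (spans_fits st) nr) -[boundary g]invgK -(mark_tail G).
by rewrite -mark_opp /tail opphK.
Qed.

(** The marks of the chords generate the group, since all other marks are products
of them. *)
Lemma leaves_generate (S : surface_group g -> Prop) :
    S 1%g -> (forall x y, S x -> S y -> S (x * y)%g) ->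
    (forall x, S x -> S x^-1%g) -> (forall l, l \in leaves t -> S (mark G l)) ->
  forall x, S x.
Proof.
move=> S1 SM SV Sl; apply: (@mark_gen _ _ G) => // h.
have Sp s : (forall l, l \in s -> S (mark G l)) -> S (\prod_(l <- s) mark G l)%g.
  elim: s => [|l s IHs] Ss; first by rewrite big_nil.
  rewrite big_cons; apply: SM; first by apply: Ss; rewrite inE eqxx.
  by apply: IHs => l' ls; apply: Ss; rewrite inE ls orbT.
have /andP[nr _] := spans_uniq st.
have := spans_all st h; rewrite inE => /orP[/eqP->|].
  by rewrite (mark_leaves (spans_fits st) nr); apply: Sp.
suff key s r : fits G r s -> root G \notin below G r s ->
    (forall l, l \in leaves s -> S (mark G l)) -> h \in below G r s -> S (mark G h).
  exact: key (spans_fits st) nr Sl.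
elim: s r {Sl nr} => [//|s1 IH1 s2 IH2] r /= [f1 f2] nr Sl; have := nr;
  rewrite !(inE, mem_cat) !negb_or => /and5P[_ _ n1 _ n2].
have Sl1 l : l \in leaves s1 -> S (mark G l) by move=> ls; apply: Sl; rewrite mem_cat ls.
have Sl2 l : l \in leaves s2 -> S (mark G l) by move=> ls; apply: Sl; rewrite mem_cat ls orbT.
case/or4P=> [/eqP->|/eqP->|hs|/orP[/eqP->|hs]].
- rewrite mark_opp; apply: SV; rewrite (@mark_leaves r (Node s1 s2) (conj f1 f2) nr); exact: Sp.
- by rewrite (mark_leaves f1 n1); apply: Sp.
- exact: (IH1 _ f1 n1 Sl1 hs).
- by rewrite (mark_leaves f2 n2); apply: Sp.
- exact: (IH2 _ f2 n2 Sl2 hs).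
Qed.

End OneTree.
End Spans.

(** * Sliding a chord along its neighbour *)

Section Slide.
Variables (g : nat) (H : finType).
Implicit Types G : marked_fatgraph g H.

Lemma ex_tree (T : eqType) (s : seq T) : s != [::] -> exists t, leaves t = s.
Proof. by case: s => // x s _; exists (comb x s); apply: leaves_comb. Qed.

(** Consecutive leaves y and x can be brought to a common vertex by rotations.  The
third edge h of that vertex then is the leaf of a smaller tree t2, to which the
vertex may be added back in any position: only the list of half-edges matters for
the result to be a spanning tree. *)
Lemma join_leaves G t w1 y x w2 : spans G t -> leaves t = w1 ++ y :: x :: w2 ->
  exists G', [/\ linked G G', {in leaves t, mark G' =1 mark G},
    forall l, l \in leaves t -> opph G' l \in leaves t
    & exists h t2, [/\ fits G' h (Node (Leaf y) (Leaf x)),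
        leaves t2 = w1 ++ h :: w2,
        fits G' (root G') t2
      & forall r, perm_eq r (below G' (root G') t2 ++ [:: opph G' h; y; x]) ->
        uniq (root G' :: r) /\ forall z, z \in root G' :: r]].
Proof.
move=> st lt; have ul : uniq (w1 ++ y :: x :: w2) by rewrite -lt (leaves_uniq st).
have [t0 lt0] : exists t0, leaves t0 = w1 ++ y :: w2 by apply: ex_tree; case: (w1).
have ny : y \notin w1 ++ w2.
  have := ul; rewrite (_ : uniq _ = uniq (y :: w1 ++ x :: w2)); last first.
    by apply: perm_uniq; apply/seq.permP=> p; rewrite /= !count_cat /=; lia.
  rewrite cons_uniq => /andP[+ _]; rewrite !mem_cat !inE !negb_or.
  by case/and3P=> -> _ ->.
have lt1 := leaves_subst (Node (Leaf y) (Leaf x)) lt0 ny.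
have r1 : rots t (subst y (Node (Leaf y) (Leaf x)) t0).
  by apply: eq_leaves_rots; rewrite lt1 lt.
have [G' [lG sG mG]] := spans_rots r1 st.
exists G'; split=> //.
  by move=> l; have := leaves_opph sG (l := l); rewrite lt1 -lt.
have c1 : count_mem y (leaves t0) = 1.
  rewrite lt0 count_cat /= eqxx; move: ny; rewrite -has_pred1 has_count count_cat.
  by case: (count_mem y w1) => [|n] //; case: (count_mem y w2).
have [h [fh plug_h]] := subst_position (spans_fits sG) c1.
have [_ p0] := plug_h (Node (Leaf y) (Leaf x)) fh; have [f2 _] := plug_h (Leaf h) erefl.
exists h, (subst y (Leaf h) t0); split=> //.
  by rewrite (leaves_subst _ lt0 ny).
move=> r pr; case: (fh) => yk; rewrite /= in yk; rewrite -yk => xk.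
have {}pr : perm_eq r (below G' (root G') (subst y (Node (Leaf y) (Leaf x)) t0)).
  apply: (perm_trans pr); rewrite perm_sym; apply: (perm_trans p0).
  by rewrite perm_cat2l /= -yk -xk.
have pr' : perm_eq (root G' :: r)
    (root G' :: below G' (root G') (subst y (Node (Leaf y) (Leaf x)) t0)) by rewrite perm_cons.
split=> [|z]; first by rewrite (perm_uniq pr') (spans_uniq sG).
by rewrite (perm_mem pr') (spans_all sG).
Qed.

(** Once y and x end at a common vertex with third edge h, that edge replaces the
chord of z, where z is x or y: the vertex is removed from the tree at h and attached
again at the other end of z.  This is possible because the other end of z is not
at the same vertex; otherwise the chord would be a loop that bounds a boundary cycle
of its own. *)
Lemma slide G t w1 y x w2 z : spans G t -> leaves t = w1 ++ y :: x :: w2 ->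
    z \in [:: x; y] -> let v := (mark G y * mark G x)%g in
  exists G' t', [/\ linked G G', spans G' t'
    & perm_eq (map (mark G') (leaves t') ++ [:: mark G z; (mark G z)^-1%g])
              (map (mark G) (leaves t) ++ [:: v; v^-1%g])].
Proof.
move=> st lt zin v.
have [G' [lG mG oG [h [t2 [[/= yk xk] lt2 f2 all2]]]]] := join_leaves st lt.
set k := opph G' h in yk xk all2 *; rewrite -yk in xk.
have [] := all2 _ (perm_refl _); rewrite mem_cat negb_or.
case/andP=> /andP[nr nr3] u23 _.
have kr : k != root G' by move: nr3; rewrite inE negb_or eq_sym => /andP[].
have kx : nexth G' x = k by rewrite xk yk next3.
have yt : y \in leaves t by rewrite lt mem_cat inE eqxx orbT.
have xt : x \in leaves t by rewrite lt mem_cat !inE eqxx !orbT.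
have mh : mark G' h = v.
  rewrite /v -(mG y yt) -(mG x xt) [in mark G' x]xk yk; apply: (mulgI (mark G' k)).
  by rewrite mulgA mark_vertex // /k mark_opp mulVg.
have mk : mark G' k = v^-1%g by rewrite mark_opp mh.
have xy : x != opph G' y.
  apply/eqP=> xo; suff /eqP : pred1 y (opph G' y) by apply/eqP/opph_neq.
  apply: (@boundary_all _ _ G' (pred1 y) y) => [|u /eqP->] /=; first exact: eqxx.
  by rewrite -xk xo opphK.
(* p and q follow z at the common vertex; they become the leaves at the other end
   of z. *)
have [p [q [zp pq perm_pq]]] : exists p q,
    [/\ nexth G' z = p, nexth G' p = q & perm_eq [:: z; p; q] [:: k; y; x]].
  move: zin; rewrite !inE => /orP[/eqP->|/eqP->].
    by exists k, y; split=> //; apply/seq.permP=> p /=; clear; lia.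
  by exists x, k; split=> //; apply/seq.permP=> p /=; clear; lia.
pose z' := opph G' z.
have zt : z \in leaves t by move: zin; rewrite !inE => /orP[/eqP->|/eqP->].
have z't2 : count_mem z' (leaves t2) = 1.
  rewrite count_uniq_mem; last first.
    move: u23; rewrite cat_uniq => /andP[u2 _].
    have : uniq (root G' :: below G' (root G') t2) by rewrite /= nr.
    by rewrite (perm_uniq (perm_below f2)) cat_uniq => /andP[].
  have := oG z zt; rewrite lt lt2 !mem_cat !inE -/z'.
  have zy : z' != y.
    move: zin; rewrite !inE => /orP[]/eqP zE; rewrite /z' zE ?opph_neq //.
    by apply: contra xy => /eqP <-; rewrite opphK.
  have zx : z' != x.
    by move: zin; rewrite !inE => /orP[]/eqP zE; rewrite /z' zE ?opph_neq // eq_sym.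
  by rewrite (negPf zy) (negPf zx) /= => /orP[]->; rewrite ?orbT.
have := f2; rewrite -{1}(subst_id z' t2) => /subst_position /(_ z't2)[r [zr plug_r]].
have := plug_r (Node (Leaf p) (Leaf q)); rewrite /= -zr /z' opphK zp pq.
case=> // f3 p3; exists G', (subst z' (Node (Leaf p) (Leaf q)) t2); split=> //.
  have [|u3 a3] := all2 (below G' (root G') (subst z' (Node (Leaf p) (Leaf q)) t2)).
    apply: (perm_trans p3); rewrite subst_id; exact: perm_cat.
  by split.
have mz' : mark G' z' = (mark G z)^-1%g.
  by rewrite mark_opp mG.
have mz : mark G' z = mark G z by rewrite mG.
have := perm_leaves_subst (Node (Leaf p) (Leaf q)) z't2.
move/(perm_map (mark G'))/seq.permP => c3.
have := perm_map (mark G') perm_pq => /seq.permP c4.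
have ml : map (mark G) (leaves t) = map (mark G') (leaves t) by apply/esym/eq_in_map.
rewrite ml lt -mz; apply/seq.permP=> P; have := c3 P; have := c4 P.
by rewrite lt2 /= ?map_cat /= ?map_cat ?count_cat /= ?count_cat /= mz' -mz mh mk;
  do !move: (nat_of_bool _) => ?; do !move: (count _ _) => ?; clear; lia.
Qed.

End Slide.

(** * Existence of spanning trees, and isomorphism from leaf marks *)

Section Growth.
Variables (g : nat) (H : finType) (G : marked_fatgraph g H).

Lemma below_next h t x : x \in below G h t -> nexth G x \in below G h t.
Proof.
elim: t h => [//|t1 IH1 t2 IH2] h /=; rewrite !(inE, mem_cat).
case/or4P=> [/eqP->|/eqP->|/IH1->|/orP[/eqP->|/IH2->]]; rewrite ?orbT //.
- by rewrite eqxx orbT.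
- by rewrite eqxx !orbT.
- by rewrite next3 eqxx.
Qed.

(** A tree that cannot be enlarged contains with each of its half-edges the other
half and the next one in the cyclic order, hence everything. *)
Lemma spanning_tree : exists t, spans G t.
Proof.
suff grow m t : #|H| <= m + size (root G :: below G (root G) t) ->
    fits G (root G) t -> uniq (root G :: below G (root G) t) -> exists t, spans G t.
  by apply: (grow #|H| (Leaf (root G))); rewrite // leq_addr.
elim: m t => [|m IHm] t.
  rewrite add0n => c f u; exists t; split=> // x.
  have := subset_cardP _ (subset_predT (mem (root G :: below G (root G) t))).
  move=> -> //; apply/eqP; rewrite eqn_leq max_card /=.
  by rewrite (card_uniqP u).
move=> c f u.
have [/hasP[l lt lo]|/hasPn all] :=
    boolP (has (fun l => opph G l \notin root G :: below G (root G) t) (leaves t)); last first.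
  exists t; split=> // x.
  apply: (@boundary_all _ _ G (fun y => y \in root G :: below G (root G) t) (root G)).
    exact: mem_head.
  move=> y yt.
  have {yt} : nexth G y \in root G :: below G (root G) t.
    move: yt; rewrite !inE => /orP[/eqP->|/below_next ->]; last by rewrite orbT.
    by rewrite next_root eqxx.
  rewrite (perm_mem (perm_below f)) mem_cat => /orP[/all|/inner_opph yi].
    by rewrite negbK.
  by rewrite (perm_mem (perm_below f)) mem_cat yi orbT.
set k := opph G l in lo; pose a := nexth G k; pose b := nexth G a.
have [kr kb] : k != root G /\ k \notin below G (root G) t.
  by move: lo; rewrite inE negb_or => /andP[].
have ul : uniq (leaves t).
  by move: u; rewrite (perm_uniq (perm_below f)) cat_uniq => /andP[].
have := f; rewrite -{1}(subst_id l t) => /subst_position [|h [<- plug_l]].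
  by rewrite count_uniq_mem // lt.
have [//|f1] := plug_l (Node (Leaf a) (Leaf b)) _.
rewrite subst_id /= -/k -/a -/b => p1.
have u1 : uniq [:: k; a; b] := vertex_uniq kr.
apply: (IHm (subst l (Node (Leaf a) (Leaf b)) t)) => //.
  by move: c; rewrite /= (perm_size p1) size_cat /=; clear; lia.
have p2 : perm_eq (root G :: below G (root G) (subst l (Node (Leaf a) (Leaf b)) t))
    ((root G :: below G (root G) t) ++ [:: k; a; b]) by rewrite /= perm_cons.
rewrite (perm_uniq p2) cat_uniq; apply/and3P; split=> //; apply/hasPn=> z zin.
have nz : z \in below G (root G) t -> k \in below G (root G) t.
  move: zin; rewrite !inE => /or3P[]/eqP-> //.
    by move=> /below_next/below_next; rewrite next3.
  by move/below_next; rewrite next3.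
rewrite inE negb_or; apply/andP; split; last by apply: contra kb.
have nr y : (nexth G y == root G) = (y == root G).
  by rewrite -{1}(next_root G) (inj_eq perm_inj).
by move: zin; rewrite !inE => /or3P[]/eqP->; rewrite ?nr.
Qed.
End Growth.

Lemma uniq_map_inj (T1 T2 : eqType) (f : T1 -> T2) s :
  uniq (map f s) -> {in s &, injective f}.
Proof.
elim: s => //= x s IHs /andP[nx /IHs injs] y z; rewrite !inE.
case/orP=> [/eqP->|ys] /orP[/eqP->|zs] // e; last exact: injs.
  by case/negP: nx; rewrite e map_f.
by case/negP: nx; rewrite -e map_f.
Qed.

Section SameShape.
Variables (g : nat) (H1 H2 : finType).
Variables (G1 : marked_fatgraph g H1) (G2 : marked_fatgraph g H2).

Fixpoint same_shape (T1 T2 : Type) (t1 : btree T1) (t2 : btree T2) : bool :=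
  match t1, t2 with
  | Leaf _, Leaf _ => true
  | Node l1 r1, Node l2 r2 => same_shape l1 l2 && same_shape r1 r2
  | _, _ => false
  end.

Lemma same_shape_comb (T1 T2 : Type) (x1 : T1) (x2 : T2) s1 s2 :
  size s1 = size s2 -> same_shape (comb x1 s1) (comb x2 s2).
Proof. by elim: s1 x1 s2 x2 => [|y1 s1 IHs] x1 [|y2 s2] x2 //= [/IHs ->]. Qed.

Lemma size_leaves_shape (T1 T2 : Type) (t1 : btree T1) (t2 : btree T2) :
  same_shape t1 t2 -> size (leaves t1) = size (leaves t2).
Proof.
elim: t1 t2 => [x1|l1 IHl r1 IHr] [x2|l2 r2] //= /andP[/IHl el /IHr er].
by rewrite !size_cat el er.
Qed.

Lemma size_below_shape h1 h2 t1 t2 : same_shape t1 t2 ->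
  size (below G1 h1 t1) = size (below G2 h2 t2).
Proof.
move/size_leaves_shape=> e; apply: (@addIn 3).
by rewrite !size_below e.
Qed.

(** Two trees of the same shape are compared by walking through both of them
simultaneously; the isomorphism is read off from this list. *)
Definition pairs h1 h2 t1 t2 := zip (below G1 h1 t1) (below G2 h2 t2).

Lemma pairs_node h1 h2 l1 r1 l2 r2 : same_shape l1 l2 ->
  pairs h1 h2 (Node l1 r1) (Node l2 r2) =
  let k1 := opph G1 h1 in let k2 := opph G2 h2 in
  let a1 := nexth G1 k1 in let a2 := nexth G2 k2 in
  let b1 := nexth G1 a1 in let b2 := nexth G2 a2 in
  [:: (k1, k2), (a1, a2) & pairs a1 a2 l1 l2 ++ (b1, b2) :: pairs b1 b2 r1 r2].
Proof. by move=> e; rewrite /pairs /= zip_cat //; apply: size_below_shape. Qed.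

Lemma pairs_nodeP h1 h2 l1 r1 l2 r2 x1 x2 : same_shape l1 l2 ->
    (x1, x2) \in (h1, h2) :: pairs h1 h2 (Node l1 r1) (Node l2 r2) ->
  [\/ (x1, x2) = (h1, h2),
    (x1, x2) = (opph G1 h1, opph G2 h2),
    (x1, x2) \in (nexth G1 (opph G1 h1), nexth G2 (opph G2 h2))
     :: pairs (nexth G1 (opph G1 h1)) (nexth G2 (opph G2 h2)) l1 l2 |
    (x1, x2) \in (nexth G1 (nexth G1 (opph G1 h1)), nexth G2 (nexth G2 (opph G2 h2)))
     :: pairs (nexth G1 (nexth G1 (opph G1 h1))) (nexth G2 (nexth G2 (opph G2 h2))) r1 r2].
Proof.
move=> el; rewrite pairs_node //=.
rewrite -[_ :: _]/([:: (h1, h2); (opph G1 h1, opph G2 h2)] ++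
   ((nexth G1 (opph G1 h1), nexth G2 (opph G2 h2)) :: _) ++ _ :: _) !mem_cat.
case/or3P=> [|xl|xr]; last 2 first.
- by constructor 3.
- by constructor 4.
by rewrite !inE => /orP[]/eqP ?; [constructor 1|constructor 2].
Qed.

Lemma pairs_next h1 h2 t1 t2 x1 x2 : same_shape t1 t2 ->
  (x1, x2) \in pairs h1 h2 t1 t2 -> (nexth G1 x1, nexth G2 x2) \in pairs h1 h2 t1 t2.
Proof.
elim: t1 t2 h1 h2 => [y1|l1 IHl r1 IHr] [y2|l2 r2] h1 h2 //= /andP[el er].
rewrite pairs_node //= !(inE, mem_cat).
case/or4P=> [/eqP[-> ->]|/eqP[-> ->]|/(IHl _ _ _ el) ->|
             /orP[/eqP[-> ->]|/(IHr _ _ _ er) ->]]; rewrite ?eqxx ?orbT //.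
by rewrite !next3 eqxx.
Qed.

Lemma pairs_opph h1 h2 t1 t2 x1 x2 : same_shape t1 t2 ->
    fits G1 h1 t1 -> fits G2 h2 t2 ->
    (x1, x2) \in (h1, h2) :: pairs h1 h2 t1 t2 ->
  (x1, x2) \in zip (leaves t1) (leaves t2) \/
  (opph G1 x1, opph G2 x2) \in (h1, h2) :: pairs h1 h2 t1 t2.
Proof.
elim: t1 t2 h1 h2 => [y1|l1 IHl r1 IHr] [y2|l2 r2] h1 h2 //=.
  by move=> _ -> -> x12; left; rewrite inE in x12; rewrite inE.
case/andP=> el er [fl1 fr1] [fl2 fr2].
have subl : {subset (nexth G1 (opph G1 h1), nexth G2 (opph G2 h2))
     :: pairs (nexth G1 (opph G1 h1)) (nexth G2 (opph G2 h2)) l1 l2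
     <= pairs h1 h2 (Node l1 r1) (Node l2 r2)}.
  by move=> z zl; rewrite pairs_node //= inE -cat_cons mem_cat zl orbT.
have subr : {subset (nexth G1 (nexth G1 (opph G1 h1)), nexth G2 (nexth G2 (opph G2 h2)))
     :: pairs (nexth G1 (nexth G1 (opph G1 h1))) (nexth G2 (nexth G2 (opph G2 h2))) r1 r2
     <= pairs h1 h2 (Node l1 r1) (Node l2 r2)}.
  by move=> z zr; rewrite pairs_node //= 2!inE mem_cat zr !orbT.
rewrite [zip _ _]zip_cat ?(size_leaves_shape el) // => x12.
have [[-> ->]|[-> ->]|xl|xr] := pairs_nodeP el x12.
- by right; rewrite pairs_node // !inE eqxx orbT.
- by right; rewrite !opphK inE eqxx.
- have [zl|o] := IHl _ _ _ el fl1 fl2 xl; first by left; rewrite mem_cat zl.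
  by right; rewrite inE subl ?orbT.
- have [zr|o] := IHr _ _ _ er fr1 fr2 xr; first by left; rewrite mem_cat zr orbT.
  by right; rewrite inE subr ?orbT.
Qed.

Lemma pairs_leaves h1 h2 t1 t2 x1 x2 : same_shape t1 t2 ->
    fits G1 h1 t1 -> fits G2 h2 t2 ->
  (x1, x2) \in zip (leaves t1) (leaves t2) -> (x1, x2) \in (h1, h2) :: pairs h1 h2 t1 t2.
Proof.
elim: t1 t2 h1 h2 => [y1|l1 IHl r1 IHr] [y2|l2 r2] h1 h2 //=.
  by move=> _ -> -> xl; rewrite inE in xl; rewrite inE xl.
case/andP=> el er [fl1 fr1] [fl2 fr2].
rewrite zip_cat ?(size_leaves_shape el) // mem_cat pairs_node //= !(inE, mem_cat).
case/orP=> [/(IHl _ _ _ el fl1 fl2)|/(IHr _ _ _ er fr1 fr2)];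
  by rewrite inE => /orP[]->; rewrite ?orbT.
Qed.

Lemma pairs_mark h1 h2 t1 t2 x1 x2 : same_shape t1 t2 ->
    fits G1 h1 t1 -> fits G2 h2 t2 ->
    root G1 \notin below G1 h1 t1 -> root G2 \notin below G2 h2 t2 ->
    map (mark G1) (leaves t1) = map (mark G2) (leaves t2) ->
    (x1, x2) \in (h1, h2) :: pairs h1 h2 t1 t2 -> mark G1 x1 = mark G2 x2.
Proof.
elim: t1 t2 h1 h2 => [y1|l1 IHl r1 IHr] [y2|l2 r2] h1 h2 //=.
  by move=> _ -> -> _ _ [e]; rewrite inE => /eqP[-> ->].
case/andP=> el er [fl1 fr1] [fl2 fr2] n1 n2 e.
have eh : mark G1 h1 = mark G2 h2.
  rewrite (@mark_leaves _ _ G1 h1 (Node l1 r1)) // (@mark_leaves _ _ G2 h2 (Node l2 r2)) //.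
  have big_mark H (G : marked_fatgraph g H) s :
      (\prod_(l <- s) mark G l = \prod_(m <- map (mark G) s) m)%g by rewrite big_map.
  by rewrite !big_mark /= e.
move: e n1 n2; rewrite !map_cat !(inE, mem_cat) !negb_or => /eqP.
rewrite eqseq_cat ?size_map ?(size_leaves_shape el) // => /andP[/eqP eml /eqP emr].
case/and5P=> _ _ n1 _ n1' /and5P[_ _ n2 _ n2'] x12.
have [[-> ->]|[-> ->]|xl|xr] := pairs_nodeP el x12.
- by [].
- by rewrite !mark_opp eh.
- exact: IHl xl.
- exact: IHr xr.
Qed.

(** The pairing of the two trees respects vertices and the edges inside the trees
because the shapes agree.  It respects the chords because these are recognised by
their marks: the ends of a chord are the two leaves with inverse marks. *)
Lemma same_shape_iso t1 t2 : spans G1 t1 -> spans G2 t2 -> same_shape t1 t2 ->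
    map (mark G1) (leaves t1) = map (mark G2) (leaves t2) ->
    uniq (map (mark G1) (leaves t1)) ->
  marked_iso G1 G2.
Proof.
case=> f1 u1 a1 [f2 u2 a2] e em um.
pose s1 := root G1 :: below G1 (root G1) t1.
pose s2 := root G2 :: below G2 (root G2) t2.
pose Z := (root G1, root G2) :: pairs (root G1) (root G2) t1 t2.
have ZE : Z = zip s1 s2 by [].
have es : size s1 = size s2 by congr _.+1; apply: size_below_shape.
pose f x := nth (root G2) s2 (index x s1).
pose f' y := nth (root G1) s1 (index y s2).
have is1 x : index x s1 < size s1 by rewrite index_mem a1.
have is2 y : index y s2 < size s2 by rewrite index_mem a2.
have fZ x : (x, f x) \in Z.
  rewrite ZE -{1}(nth_index (root G1) (a1 x)) -nth_zip // mem_nth // size_zip -es.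
  by rewrite minnn.
have Zf x y : (x, y) \in Z -> y = f x.
  rewrite ZE => /(nthP (root G1, root G2))[i]; rewrite size_zip -es minnn => lti.
  by rewrite nth_zip // => -[<- <-]; rewrite /f index_uniq.
have [nr1 nr2] : root G1 \notin below G1 (root G1) t1 /\ root G2 \notin below G2 (root G2) t2.
  by case/andP: u1 => -> _; case/andP: u2 => ->.
have fm x : mark G2 (f x) = mark G1 x.
  exact/esym/(pairs_mark e f1 f2 nr1 nr2 em (fZ x)).
have st1 : spans G1 t1 by []. have st2 : spans G2 t2 by [].
have fo x : f (opph G1 x) = opph G2 (f x).
  have [xl|/Zf //] := pairs_opph e f1 f2 (fZ x).
  have el := size_leaves_shape e.
  have fxl : f x \in leaves t2.
    case/(nthP (x, f x)): xl => i; rewrite size_zip el minnn => lti.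
    by rewrite nth_zip // => -[_ <-]; rewrite mem_nth.
  have xl1 : x \in leaves t1.
    case/(nthP (x, f x)): xl => i; rewrite size_zip el minnn => lti.
    by rewrite nth_zip // => -[<- _]; rewrite mem_nth ?el.
  have fol : f (opph G1 x) \in leaves t2.
    pose i := index (opph G1 x) (leaves t1).
    have lti : i < size (leaves t1) by rewrite index_mem (leaves_opph st1).
    have -> : f (opph G1 x) = nth (f x) (leaves t2) i.
      apply/esym/Zf/(pairs_leaves e f1 f2).
      rewrite -{1}(nth_index x (leaves_opph st1 xl1)) -/i -nth_zip // mem_nth //.
      by rewrite size_zip el minnn -el.
    by rewrite mem_nth // -el.
  have mi : {in leaves t2 &, injective (mark G2)}.
    by apply: uniq_map_inj; rewrite -em.
  by apply: mi => //; [exact: leaves_opph|rewrite fm !mark_opp fm].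
exists f.
  exists f'; move=> x; rewrite /f /f'.
    by rewrite index_uniq // ?nth_index // -?es.
  by rewrite index_uniq // ?nth_index // ?es.
split=> // [x|]; last first.
  rewrite /tail fo; congr (opph G2 _); apply/esym/Zf.
  by rewrite /Z inE eqxx.
apply/esym/Zf; have := fZ x; rewrite /Z !inE => /orP[/eqP[-> fr]|/(pairs_next e) ->].
  by rewrite fr !next_root eqxx.
by rewrite orbT.
Qed.

End SameShape.

(** * Nielsen reduction of words with a short product *)

Section Words.
Variable I : finType.
Local Notation letter := (I * bool)%type.
Local Notation F := (free_group I).
Implicit Types (p q r s w : seq letter) (u v x y : F).

Lemma word_inv_cat p q : word_inv (p ++ q) = word_inv q ++ word_inv p.
Proof. by rewrite /word_inv map_cat rev_cat. Qed.

Lemma word_invK : involutive (@word_inv I).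
Proof.
by move=> p; rewrite /word_inv map_rev revK -map_comp (eq_map (@linvK I)) map_id.
Qed.

Lemma size_word_inv p : size (word_inv p) = size p.
Proof. by rewrite /word_inv size_rev size_map. Qed.

Lemma fg_wordV u : fg_word u^-1%g = word_inv u. Proof. by []. Qed.
Lemma fg_wordM u v : fg_word (u * v)%g = reduce (u ++ v). Proof. by []. Qed.
Lemma fg_word1 : fg_word (1%g : F) = [::]. Proof. by []. Qed.

Lemma fg_word_eq0 u : (fg_word u == [::]) = (u == 1%g).
Proof. by rewrite -fg_word1 -val_eqE. Qed.

Lemma size_gt0 u : (0 < size u) = (u != 1%g).
Proof. by rewrite -fg_word_eq0; case: (fg_word u). Qed.

Lemma reduced_catl p q : reduced (p ++ q) -> reduced p.
Proof. by case: p => //= x p; rewrite /reduced /= cat_path => /andP[]. Qed.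

Lemma reduced_catr p q : reduced (p ++ q) -> reduced q.
Proof.
case: p => //= x p; rewrite /reduced /= cat_path => /andP[_].
exact: path_sorted.
Qed.

Lemma reduced_overlap p a q r : reduced (p ++ a :: q) -> reduced ((a :: q) ++ r) ->
  reduced (p ++ (a :: q) ++ r).
Proof.
case: p => //= x p; rewrite /reduced /= !cat_path /= cat_path.
by case/and3P=> -> -> _ ->.
Qed.

Lemma reduce_cancel p q w : reduce (p ++ word_inv q ++ q ++ w) = reduce (p ++ w).
Proof.
rewrite [LHS]reduce_cat [RHS]reduce_cat; congr foldr.
elim: q w => //= a q IHq w.
rewrite /word_inv map_cons rev_cons -cats1 -catA /=.
have -> : rev (map (@linv I) q) ++ linv a :: a :: q ++ w =
  word_inv q ++ [:: linv a; a] ++ q ++ w by [].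
rewrite [LHS]reduce_cat -[RHS]IHq [RHS]reduce_cat; congr foldr.
by have := cons_redK (linv a) (reduce_reduced (q ++ w)); rewrite linvK.
Qed.

(** The part that cancels in a product: y = r / p and x = p s as reduced words, with
r s reduced. *)
Lemma cancel_split y x : exists r p s,
  [/\ fg_word y = r ++ word_inv p, fg_word x = p ++ s & fg_word (y * x)%g = r ++ s].
Proof.
suff split n (yw xw : seq letter) : size xw <= n -> reduced yw -> reduced xw ->
    exists r p s, [/\ yw = r ++ word_inv p, xw = p ++ s & reduced (r ++ s)].
  have [r [p [s [ey ex rs]]]] := split _ y x (leqnn _) (fg_reduced y) (fg_reduced x).
  exists r, p, s; split=> //; rewrite fg_wordM ey ex -catA reduce_cancel.
  exact: reduce_id.
elim: n yw xw => [|n IHn] yw xw.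
  rewrite leqn0 => /nilP-> ry _; exists yw, [::], [::].
  by rewrite /word_inv /= cats0.
case: xw => [|a xw]; first by move=> _ ry _; exists yw, [::], [::]; rewrite /= cats0.
case: (lastP yw) => [|yw' b] sx ry rx.
  by exists [::], [::], (a :: xw).
have [eb|nb] := eqVneq a (linv b); last first.
  exists (rcons yw' b), [::], (a :: xw); split=> //; first by rewrite cats0.
  case: yw' ry => [_|c yw' /=]; first by rewrite /reduced /= nb; exact: rx.
  rewrite /reduced /= rcons_path => /andP[pc cb].
  by rewrite -cats1 -catA cat_path pc /= cb nb; exact: rx.
have [|||r [p [s [ey ex rs]]]] := IHn yw' xw.
- by [].
- by move: ry; rewrite -cats1 => /reduced_catl.
- by move: rx; rewrite -cat1s => /reduced_catr.
exists r, (a :: p), s; rewrite ex ey; split=> //.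
by rewrite rcons_cat; congr (_ ++ _); rewrite /word_inv map_cons rev_cons eb linvK.
Qed.

Definition rank_step (n : nat) (a : letter) : nat := n * #|{: letter}| + enum_rank a.
(** A word is read as a number whose digits are its letters, first letter most
significant; for words of the same length this is the lexicographic order. *)
Definition rank w : nat := foldl rank_step 0 w.

Lemma rank_cat p q : rank (p ++ q) = rank p * #|{: letter}| ^ size q + rank q.
Proof.
have foldE n w : foldl rank_step n w = n * #|{: letter}| ^ size w + rank w.
  rewrite /rank; elim/last_ind: w n => [|w a IHw] n /=; first by rewrite muln1 addn0.
  rewrite -cats1 !foldl_cat /= IHw size_cat addn1 expnSr /rank_step.
  by rewrite mulnDl -mulnA addnA.
by rewrite /rank foldl_cat foldE.
Qed.

Lemma rank_inj p q : size p = size q -> rank p = rank q -> p = q.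
Proof.
elim/last_ind: p q => [|p a IHp] q.
  by move=> /esym/size0nil->.
case/lastP: q => [|q b]; first by rewrite size_rcons.
rewrite !size_rcons => -[es]; rewrite -!cats1 !rank_cat /= expn1 /rank /= => e.
have B0 : 0 < #|{: letter}| by apply/card_gt0P; exists a.
have ra : forall c : letter, rank_step 0 c < #|{: letter}| by move=> c;
  rewrite /rank_step mul0n add0n.
have eab : rank_step 0 a = rank_step 0 b.
  by have := congr1 (modn^~ #|{: letter}|) e; rewrite !modnMDl !modn_small.
have epq : rank p = rank q.
  by move: e; rewrite /rank eab => /addIn/eqP; rewrite eqn_pmul2r // => /eqP.
rewrite (IHp q) //; congr (_ ++ [:: _]).
by move: eab; rewrite /rank_step !mul0n !add0n => /val_inj/enum_rank_inj.
Qed.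

Lemma ltn_rank_catl p q w : rank p * #|{: letter}| ^ size w <= rank q * #|{: letter}| ^ size w ->
  size p = size q -> p != q -> rank p < rank q.
Proof.
move=> le sz ne.
have B0 : 0 < #|{: letter}|.
  by case: p q sz ne {le} => [|a p] [|b q] // _ _; apply/card_gt0P; exists a.
rewrite ltn_neqAle; apply/andP; split; last by rewrite leq_pmul2r ?expn_gt0 ?B0 in le.
by apply: contra ne => /eqP/(rank_inj sz) ->.
Qed.

(** Only the first half of a word is ranked: for a middle part that cancels by
exactly one half on either side, the rank decides on which side it should be
replaced. *)
Definition half_rank u : nat := rank (take (size u)./2 u).

Definition measure u : nat * nat := (size u, half_rank u + half_rank u^-1%g).

Definition measure_lt (m n : nat * nat) : bool :=
  (m.1 < n.1) || (m.1 == n.1) && (m.2 < n.2).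

Lemma measureV u : measure u^-1%g = measure u.
Proof. by rewrite /measure fg_wordV size_word_inv invgK addnC. Qed.

(** Neither of the two slides that replace x or y by yx is an improvement. *)
Definition irreducible y x : bool :=
  ~~ measure_lt (measure (y * x)%g) (measure x) && ~~ measure_lt (measure (y * x)%g) (measure y).

Lemma irreducibleV y x : irreducible x^-1%g y^-1%g = irreducible y x.
Proof. by rewrite /irreducible -invMg !measureV andbC. Qed.

(** The number of letters of u that may be lost on the left.  The margins of u and
of its inverse leave one letter of u untouched: the middle one in odd length; in
even length the innermost letter of the half that has the larger rank, when each
half is read from its own end of u. *)
Definition margin u : nat :=
  let n := (size u)./2 in
  if odd (size u) || (half_rank u < half_rank u^-1%g) then n else n.-1.

Lemma halves_neq u : u != 1%g -> ~~ odd (size u) ->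
  take (size u)./2 u != take (size u)./2 u^-1%g.
Proof.
move=> u1 ev; apply: contra u1 => /eqP; set n := (size u)./2.
have sz : size u = n + n by rewrite /n -[LHS]odd_double_half (negPf ev) addnn.
rewrite fg_wordV -{2}(cat_take_drop n u) word_inv_cat take_size_cat; last first.
  by rewrite size_word_inv size_drop sz addnK.
move=> e; rewrite -fg_word_eq0 -(reduce_id (fg_reduced u)) -(cat_take_drop n u) e.
by have /= := reduce_cancel [::] (drop n u) [::]; rewrite cats0 => ->.
Qed.

Lemma half_rank_neq u : u != 1%g -> ~~ odd (size u) -> half_rank u != half_rank u^-1%g.
Proof.
move=> u1 ev; apply: contra (halves_neq u1 ev) => /eqP.
rewrite /half_rank fg_wordV size_word_inv => /rank_inj ->; rewrite ?size_take //.
by rewrite size_word_inv.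
Qed.

(** In even length the first halves of u and of its inverse are different, since
otherwise u would cancel completely.  So their ranks differ, and exactly one of the
two margins falls short of one half. *)
Lemma margin_sum u : u != 1%g -> margin u + margin u^-1%g + 1 = size u.
Proof.
move=> u1; rewrite /margin invgK fg_wordV size_word_inv.
have := odd_double_half (size u); have u0 := u1; rewrite -size_gt0 in u0.
have [od|ev] /= := boolP (odd (size u)); first by rewrite -addnn; lia.
have := half_rank_neq u1 ev; rewrite neq_ltn -addnn.
by case: (ltngtP (half_rank u)) => //= _ _; move: u0; move: (size u)./2 (size u) => n m;
  clear; lia.
Qed.

Lemma measure_ltPn u v : ~~ measure_lt (measure u) (measure v) ->
  size v <= size u /\
  (size u = size v ->
     half_rank v + half_rank v^-1%g <= half_rank u + half_rank u^-1%g).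
Proof.
rewrite /measure_lt /measure; case: (ltngtP (size u) (size v)) => //= [lt|e].
  by split=> // e; rewrite e ltnn in lt.
by rewrite -leqNgt; split; rewrite // e.
Qed.

Lemma take_catl p q n : n <= size p -> take n (p ++ q) = take n p.
Proof. by move=> le; rewrite take_cat; case: ltngtP le => // ->;
  rewrite subnn take0 cats0 take_size. Qed.

(** Since yx is at least as long as y and as x, the cancelled part p is at most half
of each of them.  If p is exactly half of x, say x = p s, then replacing y = r / p by
yx = r s keeps the length and changes the half of the inverse of y that begins with
p into the one that begins with 1/s.  This is no improvement, so p has the smaller
rank and it is the half that the margin of x allows to cancel. *)
Lemma irreducible_marginR y x r p s :
    fg_word y = r ++ word_inv p -> fg_word x = p ++ s ->
    fg_word (y * x)%g = r ++ s -> x != 1%g -> irreducible y x ->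
  size p <= margin x.
Proof.
move=> ey ex eyx x1 /andP[/measure_ltPn[le1 _] /measure_ltPn[le2 eq2]].
have x0 := x1; rewrite -size_gt0 in x0.
have sy : size y = size r + size p by rewrite ey size_cat size_word_inv.
have sx : size x = size p + size s by rewrite ex size_cat.
have syx : size (y * x)%g = size r + size s by rewrite eyx size_cat.
rewrite syx sx leq_add2r in le1; rewrite syx sy leq_add2l in le2 eq2.
have hx := odd_double_half (size x); rewrite -addnn in hx.
rewrite /margin; have [ltps|] := ltnP (size p) (size s).
  case: ifP => [_|/negbT]; first by move: hx ltps sx; move: (odd _) (_./2) => b n; clear; lia.
  rewrite negb_or => /andP[/negPf od _]; move: hx ltps sx; rewrite od.
  by move: (_./2) => n; clear; lia.
move=> les; have {le2 les} eps : size p = size s by apply/eqP; rewrite eqn_leq le2 les.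
have hn : (size x)./2 = size p by rewrite sx -eps addnn doubleK.
have od : odd (size x) = false by rewrite sx -eps addnn odd_double.
rewrite od hn /=.
have hr : half_rank x = rank p by rewrite /half_rank hn ex take_size_cat.
have hrV : half_rank x^-1%g = rank (word_inv s).
  rewrite /half_rank fg_wordV size_word_inv hn ex word_inv_cat take_size_cat //.
  by rewrite size_word_inv.
suff -> : half_rank x < half_rank x^-1%g by [].
rewrite hr hrV.
have syxy : size (y * x)%g = size y by rewrite syx sy eps.
set n := (size y)./2; have pn : size p <= n by rewrite /n sy geq_half_double -addnn leq_add2r.
have nr : n <= size r.
  by rewrite /n sy leq_half_double -addnn -addnS leq_add2l leqW.
have := eq2 (congr1 (addn _) (esym eps)).
rewrite /half_rank syxy !fg_wordV !size_word_inv syxy -/n.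
rewrite [in take n y]ey [in take n (y * x)%g]eyx !take_catl // leq_add2l.
rewrite ey eyx !word_inv_cat word_invK !take_cat size_word_inv -eps [n < _]ltnNge pn /=.
rewrite !rank_cat leq_add2r => le.
apply: (ltn_rank_catl le); first by rewrite size_word_inv.
have := halves_neq x1; rewrite od => /(_ isT); rewrite hn {1}ex take_size_cat //.
by rewrite fg_wordV ex word_inv_cat take_size_cat // size_word_inv.
Qed.

Lemma irreducible_marginL y x r p s :
    fg_word y = r ++ word_inv p -> fg_word x = p ++ s ->
    fg_word (y * x)%g = r ++ s -> y != 1%g -> irreducible y x ->
  size p <= margin y^-1%g.
Proof.
move=> ey ex eyx y1 irr; apply: (@irreducible_marginR x^-1%g y^-1%g (word_inv s) p (word_inv r)).
- by rewrite fg_wordV ex word_inv_cat.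
- by rewrite fg_wordV ey word_inv_cat word_invK.
- by rewrite -invMg fg_wordV eyx word_inv_cat.
- by rewrite invg_eq1.
- by rewrite irreducibleV.
Qed.

(** An upper bound for the total cancellation between neighbours of the list. *)
Fixpoint overlap u us : nat :=
  if us is v :: us' then minn (margin u^-1%g) (margin v) + overlap v us' else 0.

Lemma overlap_cons u v us :
  overlap u (v :: us) = minn (margin u^-1%g) (margin v) + overlap v us.
Proof. by []. Qed.

Lemma margin_lt u : u != 1%g -> margin u < size u.
Proof. by move/margin_sum <-; rewrite addn1 ltnS leq_addr. Qed.

(** The first letters of u up to and including the one after its margin survive in
the product.  So the cancellation between u and the product of the remaining
elements stops inside the part of the next element that is known to survive, and
nothing beyond neighbours interacts. *)
Lemma irreducible_prod u us : all (fun v => v != 1%g) (u :: us) -> path irreducible u us ->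
  let P := (\prod_(v <- u :: us) v)%g in
  (exists z, fg_word P = take (margin u).+1 u ++ z) /\
  \sum_(v <- u :: us) size v <= size P + (overlap u us).*2.
Proof.
elim: us u => [|v us IHus] u; cbv zeta.
  rewrite /= andbT => u1 _; rewrite !big_seq1 addn0; split=> //.
  by exists (drop (margin u).+1 u); rewrite cat_take_drop.
rewrite [all _ _]/= [path _ _ _]/= => /andP[u1 us1] /andP[irr ps].
have v1 : v != 1%g by case/andP: us1.
have [[z eP] sP] := IHus v us1 ps; set P := (\prod_(w <- v :: us) w)%g in eP sP.
have [r [p [s [eu ev euv]]]] := cancel_split u v.
have pv := irreducible_marginR eu ev euv v1 irr.
have pu := irreducible_marginL eu ev euv u1 irr.
have mv := margin_lt v1.
(* The part of v that survives in P reaches beyond p, which lies within the margin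
   of v; the excess a :: s1 stops the cancellation. *)
have [a [s1 [s2 es]]] : exists a s1 s2, s = (a :: s1) ++ s2 /\
    take (margin v).+1 v = p ++ a :: s1.
  have : take (margin v).+1 v = p ++ take ((margin v).+1 - size p) s.
    by rewrite ev take_cat ltnNge (leq_trans pv) // subSn.
  have : 0 < size (take ((margin v).+1 - size p) s).
    rewrite size_take; case: ifP => _; first by rewrite subn_gt0 ltnS.
    by move: mv; rewrite ev size_cat => /(leq_ltn_trans pv);
      rewrite -{1}[size p]addn0 ltn_add2l.
  case def_s1: (take _ s) => [//|a s1] _ et.
  exists a, s1, (drop ((margin v).+1 - size p) s).
  by split=> //; rewrite -def_s1 cat_take_drop.
case: es => es et.
have -> : (\prod_(w <- [:: u, v & us]) w)%g = (u * P)%g by rewrite big_cons.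
have euP : fg_word (u * P)%g = r ++ (a :: s1) ++ z.
  rewrite fg_wordM eu eP et -!catA reduce_cancel; apply: reduce_id.
  apply: (@reduced_overlap r a s1 z).
    apply: (@reduced_catl _ s2); rewrite -catA -es -euv; exact: fg_reduced.
  by apply: (@reduced_catr p); rewrite catA -et -eP; apply: fg_reduced.
have szr : (margin u).+1 <= size r.
  have := margin_sum u1; rewrite eu size_cat size_word_inv.
  by move: pu; move: (margin u^-1%g) (margin u) (size p) (size r) => ? ? ? ?; clear; lia.
split.
  exists (drop (margin u).+1 r ++ (a :: s1) ++ z).
  by rewrite euP [in RHS]eu take_catl // [RHS]catA cat_take_drop.
rewrite big_cons; apply: leq_trans (leq_add (leqnn _) sP) _.
rewrite eP et euP eu !size_cat size_word_inv overlap_cons.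
have : size p <= minn (margin u^-1%g) (margin v) by rewrite leq_min pu pv.
move: (minn _ _) (overlap v us) (size p) (size (a :: s1)) (size r) (size z).
by move=> m o sp sa sr sz; rewrite doubleD -!addnn; clear; lia.
Qed.

Lemma overlap_leR u us : overlap u us <= \sum_(v <- us) margin v.
Proof.
elim: us u => [|v us IHus] u; first by rewrite big_nil.
by rewrite big_cons overlap_cons leq_add // geq_minr.
Qed.

Lemma overlap_leL u us :
  overlap u us + margin (last u us)^-1%g <= \sum_(v <- u :: us) margin v^-1%g.
Proof.
elim: us u => [|v us IHus] u; first by rewrite big_seq1.
by rewrite big_cons overlap_cons -addnA leq_add ?geq_minl ?IHus.
Qed.

Lemma overlap_eqR u us : \sum_(v <- us) margin v <= overlap u us ->
  path (fun y x => margin x <= margin y^-1%g) u us.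
Proof.
elim: us u => // v us IHus u; rewrite big_cons overlap_cons => le.
have ov := overlap_leR v us; have := geq_minr (margin u^-1%g) (margin v).
have mE : minn (margin u^-1%g) (margin v) = margin v.
  apply/eqP; rewrite eqn_leq geq_minr andTb; move: le ov;
    move: (\sum_(w <- us) margin w) (overlap v us).
  by move: (minn (margin u^-1%g) (margin v)) (margin v) => m n s o; clear; lia.
by move=> _ /=; rewrite -{1}mE geq_minl IHus //; rewrite mE leq_add2l in le.
Qed.

Lemma overlap_eqL u us :
    \sum_(v <- u :: us) margin v^-1%g <= overlap u us + margin (last u us)^-1%g ->
  path (fun y x => margin y^-1%g <= margin x) u us.
Proof.
elim: us u => // v us IHus u; rewrite big_cons overlap_cons [last _ _]/= => le.
have ov := overlap_leL v us; have := geq_minl (margin u^-1%g) (margin v).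
have mE : minn (margin u^-1%g) (margin v) = margin u^-1%g.
  apply/eqP; rewrite eqn_leq geq_minl andTb; move: le ov;
    move: (last v us)^-1%g (\sum_(w <- v :: us) margin w^-1%g) (overlap v us) => l s o.
  move: (minn (margin u^-1%g) (margin v)) (margin u^-1%g) (margin l) => m n ml.
  by clear; lia.
by move=> _ /=; rewrite -{1}mE geq_minr IHus //; rewrite mE -addnA leq_add2l in le.
Qed.

(** The lengths add up to twice the sum of the margins plus the number of elements.
If the product is as short as the number of elements, the overlap is at least the
sum of the margins; but it is at most that sum without the margin of the first
element, and also at most that sum without the margin at the end of the last one. *)
Lemma irreducible_margins u us : all (fun v => v != 1%g) (u :: us) ->
    path irreducible u us ->
    size (\prod_(v <- u :: us) v)%g = size (u :: us) ->
    \sum_(v <- u :: us) margin v = \sum_(v <- u :: us) margin v^-1%g ->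
  [/\ margin u = 0, margin (last u us)^-1%g = 0
    & path (fun y x => margin y^-1%g == margin x) u us].
Proof.
move=> us1 irr sz sm; have [_ le] := irreducible_prod us1 irr.
have sE : \sum_(v <- u :: us) size v =
    \sum_(v <- u :: us) margin v + \sum_(v <- u :: us) margin v^-1%g + size (u :: us).
  rewrite -big_split -sum1_size -big_split /=; apply: eq_big_seq => v vin.
  by rewrite margin_sum //; apply: (allP us1).
rewrite sE sz -sm addnn [X in _ <= X]addnC leq_add2r leq_double in le.
have oR := overlap_leR u us; have oL := overlap_leL u us.
have e1 : margin u = 0 by move: le; rewrite big_cons; move: oR; clear; lia.
have e2 : margin (last u us)^-1%g = 0 by move: le oL; rewrite sm; clear; lia.
have p1 : path (fun y x => margin x <= margin y^-1%g) u us.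
  by apply: overlap_eqR; move: le; rewrite big_cons e1.
have p2 : path (fun y x => margin y^-1%g <= margin x) u us.
  by apply: overlap_eqL; rewrite e2 addn0 -sm.
split=> //; elim: us u p1 p2 {us1 irr sz sm le sE oR oL e1 e2} => //= v us IHus u.
by case/andP=> le1 p1 /andP[le2 p2]; rewrite eqn_leq le1 le2 IHus.
Qed.

End Words.

(** * Rank of the free group, and the boundary word *)

Section Rank.
Variable I : finType.
Local Notation F := (free_group I).

(** The homomorphisms to the group with two elements are the functions on the
generators, so there are 2 to the rank of them. *)
Definition parity (f : I -> bool) (w : seq (I * bool)) : bool :=
  foldr (fun x b => f x.1 (+) b) false w.

Lemma parity_cat f p q : parity f (p ++ q) = parity f p (+) parity f q.
Proof. by elim: p => //= x p ->; rewrite addbA. Qed.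

Lemma parity_reduce f w : parity f (reduce w) = parity f w.
Proof.
elim: w => //= x w <-; case: (reduce w) => //= y s; case: eqP => [->|//] /=.
by rewrite addbA addbb.
Qed.

Lemma parity_inv f w : parity f (word_inv w) = parity f w.
Proof.
elim: w => //= x w IHw; rewrite /word_inv map_cons rev_cons -cats1 parity_cat.
by rewrite [parity f (rev _)]IHw /= addbF addbC.
Qed.

(** A homomorphism to the group with two elements is determined by its values on a
generating set. *)
Lemma generators_ge (r : seq F) :
    (forall S : F -> Prop, S 1%g -> (forall x y, S x -> S y -> S (x * y)%g) ->
       (forall x, S x -> S x^-1%g) -> (forall x, x \in r -> S x) -> forall x, S x) ->
  #|I| <= size r.
Proof.
move=> gen; rewrite -(leq_exp2l (m := 2)) //.
have -> : 2 ^ #|I| = #|{ffun I -> bool}| by rewrite card_ffun card_bool.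
have -> : 2 ^ size r = #|{: (size r).-tuple bool}| by rewrite card_tuple card_bool.
pose chi (f : {ffun I -> bool}) : (size r).-tuple bool :=
  map_tuple (fun x : F => parity f x) (in_tuple r).
apply: (@leq_card _ _ chi) => f f' /(congr1 val)/= /eq_in_map e.
apply/ffunP=> i.
suff : parity f (fg_gen i) = parity f' (fg_gen i) by rewrite /= !addbF.
apply: (gen (fun x : F => parity f x = parity f' x)) => //.
- by move=> x y ex ey; rewrite !fg_wordM !parity_reduce !parity_cat ex ey.
- by move=> x ex; rewrite !fg_wordV !parity_inv.
Qed.

End Rank.

Lemma reduce_reduce_cat (I : countType) (p q : seq (I * bool)) :
  reduce (reduce p ++ q) = reduce (p ++ q).
Proof. by rewrite !reduce_cat foldr_reduce ?reduce_reduced. Qed.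

Section BoundaryWord.
Variable g : nat.

Definition handle (i : 'I_g) : seq ('I_g * bool * bool) :=
  [:: (i, false, false); (i, true, false); (i, false, true); (i, true, true)].

Definition boundary_word : seq ('I_g * bool * bool) := flatten (map handle (enum 'I_g)).

Lemma handles_reduced s : reduced (flatten (map handle s)).
Proof.
elim: s => // i s IHs; apply/and4P; split.
1-3: by rewrite /linv !xpair_eqE /= ?andbF.
case: s IHs => // j s IHs; apply/andP; split; last exact: IHs.
by rewrite /linv !xpair_eqE /= andbF.
Qed.

Lemma boundaryE : fg_word (boundary g) = boundary_word.
Proof.
rewrite /boundary /boundary_word /index_enum; case: index_enum_key; rewrite /= -enumT.
elim: (enum _) => [|i s IHs] /=; first by rewrite big_nil.
rewrite big_cons fg_wordM IHs.
have -> : fg_word (alpha i * beta i * (alpha i)^-1 * (beta i)^-1)%g = handle i.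
  rewrite !fg_wordM reduce_reduce_cat -catA reduce_reduce_cat.
  transitivity (reduce (handle i)); first by [].
  by apply: reduce_id; apply: (handles_reduced [:: i]).
exact: reduce_id (handles_reduced (i :: s)).
Qed.

Lemma size_boundary_word : size boundary_word = 4 * g.
Proof.
rewrite /boundary_word -[in RHS](size_enum_ord g).
by elim: (enum _) => //= i s ->; rewrite mulnS.
Qed.

Lemma boundary_word_uniq : uniq boundary_word.
Proof.
rewrite /boundary_word; have := enum_uniq 'I_g.
elim: (enum _) => //= i s IHs /andP[is' /IHs us].
have hs b1 b2 : (i, b1, b2) \notin flatten (map handle s).
  apply: contra is' => /flattenP[w /mapP[j js ->]].
  by rewrite !inE !xpair_eqE => /or4P[] /andP[/andP[/eqP-> _] _].
by rewrite us !inE !xpair_eqE !(negPf (hs _ _)) !eqxx ?andbF.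
Qed.

End BoundaryWord.

(** * Reducing the marks of the chords *)

Lemma unsorted_split (T : Type) (e : rel T) s : ~~ sorted e s ->
  exists s1 y x s2, s = s1 ++ y :: x :: s2 /\ ~~ e y x.
Proof.
elim: s => //= y [//|x s] IHs /=; have [exy|nexy _] := boolP (e y x); last first.
  by exists [::], y, x, s.
by case/IHs=> s1 [y' [x' [s2 [-> ne]]]]; exists (y :: s1), y', x', s2.
Qed.

Lemma measure_ltP (I : finType) (u v : free_group I) :
  measure_lt (measure u) (measure v) -> size u < size v \/ size u = size v /\
    half_rank u + half_rank u^-1%g < half_rank v + half_rank v^-1%g.
Proof. by case/orP=> [lt|/andP[/eqP eq lt]]; [left|right]. Qed.

Section Reduction.
Variables (g : nat) (H : finType).
Implicit Types G K : marked_fatgraph g H.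

(** A trivial mark could be dropped, and then fewer than 2g chords would generate a
free group of rank 2g. *)
Lemma mark_leaf_neq1 G t l : spans G t -> l \in leaves t -> mark G l != 1%g.
Proof.
move=> st lt; apply/negP=> /eqP m1; set w := leaves t in lt.
(* one end of each chord *)
pose rep l := (enum_rank l < enum_rank (opph G l))%N.
have uw : uniq w := leaves_uniq st.
have ow k : k \in w -> opph G k \in w by apply: leaves_opph.
have rep_opp k : rep (opph G k) = ~~ rep k.
  rewrite /rep opphK -leqNgt ltn_neqAle; case: eqVneq => // /val_inj/enum_rank_inj e.
  by have := opph_neq G k; rewrite e eqxx.
have pw : perm_eq (map (opph G) w) w.
  apply: uniq_perm => //; first by rewrite map_inj_uniq //; apply: perm_inj.
  move=> k; apply/mapP/idP=> [[j jw ->]|kw]; first exact: ow.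
  by exists (opph G k); rewrite ?ow ?opphK.
have crep : (count rep w).*2 = size w.
  rewrite -(count_predC rep w) -addnn; congr (_ + _).
  rewrite -(seq.permP pw rep) count_map; apply: eq_count => k /=; exact: rep_opp.
pose l' := if rep l then l else opph G l.
have rl' : rep l' by rewrite /l'; case: ifP => // /negbT; rewrite rep_opp.
have lw' : l' \in w by rewrite /l'; case: ifP => // _; apply: ow.
have ml' : mark G l' = 1%g by rewrite /l'; case: ifP => _; rewrite ?mark_opp m1 ?invg1.
pose r := [seq k <- w | rep k && (k != l')].
have : #|{: 'I_g * bool}| <= size (map (mark G) r).
  apply: generators_ge => S S1 SM SV Sr; apply: (leaves_generate st) => // k kw.
  have [rk|nrk] := boolP (rep k).
    have [->|kl] := eqVneq k l'; first by rewrite ml'.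
    by apply: Sr; apply: map_f; rewrite mem_filter rk kl.
  rewrite -(@opphK _ G k) mark_opp; apply: SV.
  have [->|kl] := eqVneq (opph G k) l'; first by rewrite ml'.
  by apply: Sr; apply: map_f; rewrite mem_filter rep_opp nrk kl ow.
have cr : count rep w = (count (fun k => rep k && (k != l')) w).+1.
  have := count_predUI (predI rep (predC1 l')) (pred1 l') w.
  rewrite (@eq_count _ (predI (predI _ _) _) pred0); last first.
    by move=> k /=; case: (k == l'); rewrite ?andbF.
  rewrite count_pred0 addn0 [count (pred1 _) _]count_uniq_mem // lw' addn1 => <-.
  by apply: eq_count => k /=; have [->|] := eqVneq k l'; rewrite ?rl' ?andbT ?orbF.
rewrite size_map size_filter card_prod card_ord card_bool.
move: crep; rewrite cr (size_leaves st); move: (count _ w) => c; clear; lia.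
Qed.

Definition total_size G t := \sum_(u <- map (mark G) (leaves t)) size u.
Definition total_rank G t :=
  \sum_(u <- map (mark G) (leaves t)) (half_rank u + half_rank u^-1%g).

Lemma irreducible_tree G t : spans G t -> exists G' t',
  [/\ linked G G', spans G' t' & sorted (@irreducible _) (map (mark G') (leaves t'))].
Proof.
have [n] := ubnP (total_size G t); elim: n G t => // n IHn G t ltn st.
have [m] := ubnP (total_rank G t); elim: m G t ltn st => // m IHm G t ltn st ltr.
have [srt|/unsorted_split[u1 [y' [x' [u2 [em nirr]]]]]] :=
    boolP (sorted (@irreducible _) (map (mark G) (leaves t))).
  by exists G, t; split=> //; apply: linked_refl.
have [w1 [y [x [w2 [lt ey ex]]]]] : exists w1 y x w2,
    [/\ leaves t = w1 ++ y :: x :: w2, y' = mark G y & x' = mark G x].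
  have sw := congr1 size em; rewrite size_map size_cat /= in sw.
  exists (take (size u1) (leaves t)).
  move: em; rewrite -{1 2}(cat_take_drop (size u1) (leaves t)) map_cat => /eqP.
  rewrite eqseq_cat; last by rewrite size_map size_takel // sw leq_addr.
  case/andP=> _ /eqP; case: (drop _ _) => [|y [|x w2]] // [ey ex _].
  by exists y, x, w2.
rewrite ey ex /irreducible negb_and !negbK in nirr.
pose v := (mark G y * mark G x)%g; rewrite -/v in nirr.
have [z zin lev] : exists2 z, z \in [:: x; y] & measure_lt (measure v) (measure (mark G z)).
  case/orP: nirr => lv; [exists x|exists y]; rewrite ?inE ?eqxx ?orbT //.
have [G' [t' [lG sG pG]]] := slide st lt zin; rewrite -/v in pG.
have tot (f : surface_group g -> nat) :
    \sum_(u <- map (mark G') (leaves t')) f u + (f (mark G z) + f (mark G z)^-1%g) =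
    \sum_(u <- map (mark G) (leaves t)) f u + (f v + f v^-1%g).
  have := perm_big _ pG : \sum_(u <- _) f u = \sum_(u <- _) f u.
  by rewrite !big_cat /= !big_cons !big_nil !addn0.
have ts := tot (fun u : free_group _ => size u); rewrite -!/(total_size _ _) in ts.
have tr := tot (fun u : free_group _ => half_rank u + half_rank u^-1%g).
rewrite -!/(total_rank _ _) !invgK in tr.
have {}ts : total_size G' t' + (size (mark G z)).*2 = total_size G t + (size v).*2.
  by move: ts; rewrite !fg_wordV !size_word_inv !addnn.
suff [G'' [t'' [lG' sG' irr]]] : exists G'' t'', [/\ linked G' G'', spans G'' t''
      & sorted (@irreducible _) (map (mark G'') (leaves t''))].
  by exists G'', t''; split=> //; apply: linked_trans lG'.
case: (measure_ltP lev) => [lt1|[eq1 lt2]].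
  apply: IHn sG; move: ltn ts lt1.
  move: (total_size G' t') (total_size G t) (size v) (size (mark G z)) => a b c d.
  by clear; lia.
apply: IHm sG _; first by move: ltn ts; rewrite eq1 => ltn /addIn ->.
move: ltr tr lt2; rewrite [half_rank (mark G z)^-1%g + _]addnC [half_rank v^-1%g + _]addnC.
move: (total_rank G' t') (total_rank G t) => a b.
move: (half_rank v + _) (half_rank (mark G z) + _) => c d.
by clear; lia.
Qed.

End Reduction.

(** * Reduced marks are the letters of the boundary word *)

Section Propagation.
Variables (g : nat) (H : finType) (G : marked_fatgraph g H).

Definition first_leaf (t : btree H) h := head h (leaves t).
Definition last_leaf (t : btree H) h := last h (leaves t).

Lemma inner_below h t : {subset inner G h t <= h :: below G h t}.
Proof.
elim: t h => [y|t1 IH1 t2 IH2] h x //=.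
rewrite !(inE, mem_cat) => /or4P[->|->|/IH1|/IH2]; rewrite ?orbT //;
  by rewrite inE => /orP[]->; rewrite ?orbT.
Qed.

(** The boundary cycle runs around the tree and passes from each leaf y to the
opposite half of the next leaf x.  A function Z that agrees at these two places is
extended to the edges inside the tree so as to be constant along the boundary. *)
Lemma extend_along_boundary (Z : H -> nat) h t :
    fits G h t -> uniq (h :: below G h t) ->
    sorted (fun y x => Z y == Z (opph G x)) (leaves t) ->
  exists Q : H -> nat,
    [/\ forall x, x \notin inner G h t -> Q x = Z x,
        Q (opph G h) = Z (opph G (first_leaf t h)), Q h = Z (last_leaf t h)
      & forall z, z \in below G h t -> Q (opph G (nexth G z)) = Q z].
Proof.
elim: t h => [x|t1 IH1 t2 IH2] h /=.
  by move=> -> _ _; exists Z.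
set k := opph G h; set a := nexth G k; set b := nexth G a.
case=> f1 f2; rewrite -[_ && _]/(uniq ([:: h;
  k] ++ ((a :: below G a t1) ++ (b :: below G b t2)))).
rewrite cat_uniq => /and3P[hk /hasPn d0]; rewrite cat_uniq => /and3P[u1 /hasPn d12 u2] srt.
have [l1 [s1 e1]] := leaves_neq0 t1; have [l2 [s2 e2]] := leaves_neq0 t2.
move: srt; rewrite e1 e2 /= cat_path /= => /and3P[p1 adj p2].
have [|Q1 [out1 Qk1 Qa1 st1]] := IH1 a f1 u1; first by rewrite e1.
have [|Q2 [out2 Qk2 Qb2 st2]] := IH2 b f2 u2; first by rewrite e2.
rewrite /first_leaf /last_leaf ?e1 ?e2 /= in Qk1 Qa1 Qk2 Qb2.
rewrite /first_leaf /last_leaf /= e1 e2 /= last_cat /=.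
(* The values on the edge of h are forced by the first and the last leaf. *)
pose Q x := if x == h then Z (last l2 s2) else if x == k then Z (opph G l1)
  else if x \in inner G a t1 then Q1 x else if x \in inner G b t2 then Q2 x else Z x.
have kk : opph G k = h by apply: opphK.
have i1 x : x \in inner G a t1 -> x \notin inner G b t2.
  by move=> /inner_below xa; apply/negP=> /inner_below /d12 /negP.
have QE1 x : x \notin [:: h; k] -> x \notin inner G b t2 -> Q x = Q1 x.
  rewrite !inE negb_or => /andP[/negPf xh /negPf xk] /negPf x2.
  by rewrite /Q xh xk x2; case: ifP => // /negbT /out1.
have QE2 x : x \notin [:: h; k] -> x \notin inner G a t1 -> Q x = Q2 x.
  rewrite !inE negb_or => /andP[/negPf xh /negPf xk] /negPf x1.
  by rewrite /Q xh xk x1; case: ifP => // /negbT /out2.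
have ohk x : x \notin [:: h; k] -> opph G x \notin [:: h; k].
  apply: contra; rewrite !inE => /orP[]/eqP e.
    by rewrite -[x](@opphK _ G) e -/k eqxx orbT.
  by rewrite -[x](@opphK _ G) e kk eqxx.
have oin c s x : x \notin inner G c s -> opph G x \notin inner G c s.
  by apply: contra => /inner_opph; rewrite opphK.
have in1 x : x \in a :: below G a t1 -> x \notin [:: h; k] /\ x \notin inner G b t2.
  move=> xa; split; first by apply: d0; rewrite mem_cat xa.
  by apply/negP=> /inner_below /d12 /negP.
have in2 x : x \in b :: below G b t2 -> x \notin [:: h; k] /\ x \notin inner G a t1.
  move=> xb; split; first by apply: d0; rewrite mem_cat xb orbT.
  by apply/negP=> /inner_below; apply/negP/d12.
have Qo1 x : x \in a :: below G a t1 -> Q x = Q1 x /\ Q (opph G x) = Q1 (opph G x).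
  by case/in1=> n1 n2; rewrite !QE1 ?ohk ?oin.
have Qo2 x : x \in b :: below G b t2 -> Q x = Q2 x /\ Q (opph G x) = Q2 (opph G x).
  by case/in2=> n1 n2; rewrite !QE2 ?ohk ?oin.
have Qh : Q h = Z (last l2 s2) by rewrite /Q eqxx.
have Qk : Q k = Z (opph G l1) by rewrite /Q eqxx (negPf (opph_neq _ _)).
have [Qa Qoa] := Qo1 a (mem_head _ _); have [Qb Qob] := Qo2 b (mem_head _ _).
exists Q; split=> //.
  move=> x; rewrite !(inE, mem_cat) !negb_or => /and4P[xh xk x1 x2].
  by rewrite /Q (negPf xh) (negPf xk) (negPf x1) (negPf x2).
move=> z; rewrite !(inE, mem_cat) => /or4P[/eqP->|/eqP->|za|/orP[/eqP->|zb]].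
- by rewrite -/a Qoa Qk1 Qk.
- by rewrite -/b Qob Qk2 Qa Qa1 (eqP adj).
- have zn : nexth G z \in a :: below G a t1 by rewrite inE below_next ?orbT.
  have [_ ->] := Qo1 _ zn; rewrite st1 //.
  by have [|-> _] := Qo1 z; rewrite // inE za orbT.
- by rewrite /b /a next3 kk Qh Qb.
- have zn : nexth G z \in b :: below G b t2 by rewrite inE below_next ?orbT.
  have [_ ->] := Qo2 _ zn; rewrite st2 //.
  by have [|-> _] := Qo2 z; rewrite // inE zb orbT.
Qed.

(** The margin at the far end of a half-edge is constant along the boundary cycle by
[irreducible_margins] and vanishes at its beginning. *)
Lemma irreducible_sizes t : spans G t -> 0 < g ->
    sorted (@irreducible _) (map (mark G) (leaves t)) ->
  forall l, l \in leaves t -> size (mark G l) = 1.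
Proof.
move=> st g0 srt.
have n1 l := mark_leaf_neq1 st (l := l).
pose f x := margin (mark G x).
have ow l : l \in leaves t -> opph G l \in leaves t by apply: leaves_opph.
suff f0 l : l \in leaves t -> f l = 0.
  move=> l lt; rewrite -(margin_sum (n1 _ lt)) -mark_opp.
  by rewrite [margin (mark G l)](f0 l lt) [margin (mark G _)](f0 _ (ow _ lt)).
have [l0 [w el]] := leaves_neq0 t.
have mE : map (mark G) (leaves t) = mark G l0 :: map (mark G) w by rewrite el.
have pw : perm_eq (map (opph G) (leaves t)) (leaves t).
  apply: uniq_perm; rewrite ?map_inj_uniq ?(leaves_uniq st) //; first exact: perm_inj.
  move=> k; apply/mapP/idP=> [[j jw ->]|kw]; first exact: ow.
  by exists (opph G k); rewrite ?ow ?opphK.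
have [||||m0 ml pm] := @irreducible_margins _ (mark G l0) (map (mark G) w).
- rewrite -mE all_map; apply/allP=> x /n1; exact.
- by move: srt; rewrite mE.
- rewrite -mE size_map (size_leaves st) big_map (prod_leaves st).
  by rewrite boundaryE size_boundary_word.
- rewrite -mE !big_map -(perm_big _ pw) /= big_map.
  by apply: eq_bigr => x _; rewrite mark_opp.
have srt' : sorted (fun y x => f (opph G y) == f (opph G (opph G x))) (leaves t).
  rewrite el /=; move: pm; rewrite path_map; apply: sub_path => y x /=.
  by rewrite /f opphK mark_opp.
have [Q [out Qt Qr stQ]] :=
  @extend_along_boundary (fun x => f (opph G x)) _ _ (spans_fits st) (spans_uniq st) srt'.
have Q0 : forall y, Q y == 0.
  apply: (@boundary_all _ _ G (fun y => Q y == 0) (root G)).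
    rewrite Qr /last_leaf el /= /f mark_opp -(last_map (mark G)); exact/eqP.
  move=> y /eqP y0; have := spans_all st y; rewrite inE => /orP[/eqP->|/stQ ->]; last exact/eqP.
  by rewrite next_root Qt opphK /first_leaf el /= /f m0.
move=> lt; have := Q0 (opph G l); rewrite out ?opphK => [/eqP //|].
apply/negP=> oi; have := spans_uniq st.
rewrite (perm_uniq (perm_below (spans_fits st))) cat_uniq => /and3P[_ /hasPn/(_ _ oi)].
by rewrite ow.
Qed.

End Propagation.

Section Canonical.
Variable g : nat.

Lemma leq_size_reduce (I : countType) (w : seq (I * bool)) : size (reduce w) <= size w.
Proof.
elim: w => //= x w; case: (reduce w) => //= y s IHw; case: ifP => _ //=.
exact: leq_trans (leq_trans (leqnSn _) IHw) (leqnSn _).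
Qed.

Lemma reduce_eq_size (I : countType) (w : seq (I * bool)) :
  size (reduce w) = size w -> reduce w = w.
Proof.
elim: w => //= x w; have := leq_size_reduce w; case: (reduce w) => [|y s] /=.
  by case: w => // *; congr cons; apply: IHw.
case: ifP => _ /= le IHw e; first by move: le; rewrite -ltnS -e; clear; lia.
by rewrite IHw //; case: e.
Qed.

Definition letters : seq (surface_group g) :=
  map (fun x => @FreeGroup ('I_g * bool)%type [:: x] isT) (boundary_word g).

Lemma letters_uniq : uniq letters.
Proof. by rewrite map_inj_uniq ?boundary_word_uniq // => x y []. Qed.

Lemma fg_word_prod (us : seq (free_group ('I_g * bool)%type)) :
  fg_word (\prod_(u <- us) u)%g = reduce (flatten (map (@fg_word _) us)).
Proof.
elim: us => [|u us IHus] /=; first by rewrite big_nil.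
rewrite big_cons fg_wordM IHus !reduce_cat; congr foldr.
by rewrite reduce_id // reduce_reduced.
Qed.

(** No cancellation can take place in the product, because the boundary word has as
many letters as there are factors. *)
Lemma singletons_boundary (us : seq (surface_group g)) :
    (forall u, u \in us -> size (fg_word u) = 1) -> (\prod_(u <- us) u)%g = boundary g ->
    size us = 4 * g -> us = letters.
Proof.
move=> s1 eP su; have := boundaryE g; rewrite -eP fg_word_prod.
have sf : size (flatten (map (@fg_word _) us)) = size us.
  elim: us s1 {eP su} => //= u us IHus s1; rewrite size_cat IHus.
    by rewrite s1 ?mem_head.
  by move=> v vu; apply: s1; rewrite inE vu orbT.
move=> e; have := e; rewrite reduce_eq_size; last first.
  by rewrite e size_boundary_word sf su.
rewrite /letters => <-; elim: us s1 {eP su sf e} => //= u us IHus s1.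
have := s1 u (mem_head _ _); case: u s1 => -[|x []] //= rx s1 _.
rewrite -IHus; last by move=> v vu; apply: s1; rewrite inE vu orbT.
by congr cons; apply: val_inj.
Qed.

(** Reduction, followed by rotations that put the tree into normal form. *)
Lemma linked_canonical (H : finType) (G : marked_fatgraph g H) : 0 < g ->
  exists G' x s, [/\ linked G G', spans G' (comb x s) &
     map (mark G') (x :: s) = letters].
Proof.
move=> g0; have [t st] := spanning_tree G.
have [G1 [t1 [l1 s1 irr]]] := irreducible_tree st.
have [x [s e]] := leaves_neq0 t1.
have [G2 [l2 s2 m2]] := spans_rots (rots_comb e) s1.
exists G2, x, s; split=> //; first exact: linked_trans l2.
rewrite -e; have -> : map (mark G2) (leaves t1) = map (mark G1) (leaves t1) by apply/eq_in_map.
apply: singletons_boundary.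
- by move=> _ /mapP[l lt ->]; apply: (irreducible_sizes s1 g0 irr).
- by rewrite big_map (prod_leaves s1).
- by rewrite size_map (size_leaves s1).
Qed.

Theorem linked_any (H : finType) (G K : marked_fatgraph g H) : 0 < g -> linked G K.
Proof.
move=> g0; have [G' [x [s [lG sG mG]]]] := linked_canonical G g0.
have [K' [y [r [lK sK mK]]]] := linked_canonical K g0.
apply: (linked_trans lG); apply: linked_trans (linked_sym lK); apply: linked_iso.
apply: (same_shape_iso sG sK).
- apply: same_shape_comb; have := congr1 size (etrans mG (esym mK)).
  by rewrite !size_map => -[].
- by rewrite !leaves_comb mG mK.
- by rewrite leaves_comb mG letters_uniq.
Qed.

End Canonical.

(** * Functions computed by programs *)

Lemma computes_comp1 f g v x y :
  computes g v x -> computes f [:: x] y -> computes (PComp f [:: g]) v y.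
Proof. by move=> gx fy; exists [:: x]. Qed.

Lemma computes_comp2 f g1 g2 v x1 x2 y :
  computes g1 v x1 -> computes g2 v x2 -> computes f [:: x1; x2] y ->
  computes (PComp f [:: g1; g2]) v y.
Proof. by move=> gx1 gx2 fy; exists [:: x1; x2]. Qed.

(** The step is only required below the value of the recursion argument, so that it
may rely on that value being positive. *)
Lemma computes_rec f h v (F : nat -> nat) :
    computes f (behead v) (F 0) ->
    (forall m, m < head 0 v -> computes h [:: m, F m & behead v] (F m.+1)) ->
  computes (PRec f h) v (F (head 0 v)).
Proof.
move=> f0; rewrite /=; elim: (head 0 v) => [|n IHn] //= hS.
by exists (F n); [apply: IHn => m lt; apply/hS/ltnW|apply: hS].
Qed.

Section Arithmetic.

Definition binary (p : program) (F : nat -> nat -> nat) : Prop :=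
  forall m n, computes p [:: m; n] (F m n).
Definition unary (p : program) (F : nat -> nat) : Prop :=
  forall n, computes p [:: n] (F n).

Lemma add_program : exists p, binary p addn.
Proof.
exists (PRec (PProj 0) (PComp PSucc [:: PProj 1])) => m n.
apply: (@computes_rec _ _ [:: m; n] (addn^~ n)) => [|k _] //.
by apply: computes_comp1.
Qed.

Lemma pred_program : exists p, unary p predn.
Proof.
exists (PRec PZero (PProj 0)) => n.
by apply: (@computes_rec _ _ [:: n] predn).
Qed.

(** The recursion runs over the first argument, here the number to be subtracted. *)
Lemma rsub_program : exists p, binary p (fun m n => n - m).
Proof.
have [pred predP] := pred_program.
exists (PRec (PProj 0) (PComp pred [:: PProj 1])) => m n.
apply: (@computes_rec _ _ [:: m; n] (fun m => n - m)) => [|k _]; first by rewrite subn0.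
by apply: (computes_comp1 (x := n - k)) => //; rewrite subnS; apply: predP.
Qed.

Lemma sub_program : exists p, binary p subn.
Proof.
have [rsub rsubP] := rsub_program.
exists (PComp rsub [:: PProj 1; PProj 0]) => m n.
by apply: (@computes_comp2 _ _ _ _ n m) => //; apply: rsubP.
Qed.

Lemma mul_program : exists p, binary p muln.
Proof.
have [add addP] := add_program.
exists (PRec PZero (PComp add [:: PProj 2; PProj 1])) => m n.
apply: (@computes_rec _ _ [:: m; n] (muln^~ n)) => [|k _] //.
by apply: (@computes_comp2 _ _ _ _ n (k * n)) => //; apply: addP.
Qed.

Lemma double_program : exists p, unary p double.
Proof.
have [add addP] := add_program.
exists (PComp add [:: PProj 0; PProj 0]) => n.
by apply: (@computes_comp2 _ _ _ _ n n) => //; rewrite -addnn; apply: addP.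
Qed.

Lemma const_program c : exists p, forall v, computes p v c.
Proof.
elim: c => [|c [p pP]]; first by exists PZero.
by exists (PComp PSucc [:: p]) => v; apply: computes_comp1.
Qed.

Lemma odd_program : exists p, unary p odd.
Proof.
have [sub subP] := sub_program; have [one oneP] := const_program 1.
exists (PRec PZero (PComp sub [:: one; PProj 1])) => n.
apply: (@computes_rec _ _ [:: n] odd) => [|k _] //.
apply: (@computes_comp2 _ _ _ _ 1 (odd k)) => //.
by have := subP 1 (odd k); rewrite -[odd k.+1]/(~~ odd k); case: (odd k).
Qed.

Lemma eq0_program : exists p, unary p (fun n => n == 0).
Proof.
have [one oneP] := const_program 1; exists (PRec one PZero) => n.
by apply: (@computes_rec _ _ [:: n] (fun n => n == 0)).
Qed.

Lemma eqn_program : exists p, binary p (fun m n => m == n).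
Proof.
have [add addP] := add_program; have [sub subP] := sub_program.
have [rsub rsubP] := rsub_program; have [eq0 eq0P] := eq0_program.
exists (PComp eq0 [:: PComp add [:: sub; rsub]]) => m n.
apply: (@computes_comp1 _ _ _ (m - n + (n - m))).
  by apply: computes_comp2 (subP m n) (rsubP m n) (addP _ _).
by have := eq0P (m - n + (n - m)); rewrite addn_eq0 !subn_eq0 -eqn_leq.
Qed.

Lemma ltn_program : exists p, binary p (fun m n => m < n).
Proof.
have [sub subP] := sub_program; have [eq0 eq0P] := eq0_program.
exists (PComp eq0 [:: PComp sub [:: PComp PSucc [:: PProj 0]; PProj 1]]) => m n.
apply: (@computes_comp1 _ _ _ (m.+1 - n)).
  by apply: (@computes_comp2 _ _ _ _ m.+1 n) => //; apply: computes_comp1.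
by have := eq0P (m.+1 - n); rewrite subn_eq0.
Qed.

Lemma half_program : exists p, unary p half.
Proof.
have [add addP] := add_program; have [odd oddP] := odd_program.
exists (PRec PZero (PComp add [:: PComp odd [:: PProj 0]; PProj 1])) => n.
apply: (@computes_rec _ _ [:: n] half) => [|k _] //.
apply: (@computes_comp2 _ _ _ _ (ssrnat.odd k) k./2) => //; first exact: computes_comp1.
by rewrite -[k.+1./2]/(uphalf k) uphalf_half; apply: addP.
Qed.

Lemma pow2_program : exists p, unary p (expn 2).
Proof.
have [double doubleP] := double_program; have [one oneP] := const_program 1.
exists (PRec one (PComp double [:: PProj 1])) => n.
apply: (@computes_rec _ _ [:: n] (expn 2)) => [|k _] //.
by apply: (@computes_comp1 _ _ _ (2 ^ k)) => //; rewrite expnS mul2n; apply: doubleP.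
Qed.

Lemma halves_program : exists p, binary p (fun k n => iter k half n).
Proof.
have [half halfP] := half_program.
exists (PRec (PProj 0) (PComp half [:: PProj 1])) => m n.
apply: (@computes_rec _ _ [:: m; n] (fun k => iter k ssrnat.half n)) => [|k _] //.
by apply: (@computes_comp1 _ _ _ (iter k ssrnat.half n)).
Qed.

Lemma cons_program : exists p, binary p (fun x s => 2 ^ x * s.*2.+1).
Proof.
have [mul mulP] := mul_program; have [pow powP] := pow2_program.
have [double doubleP] := double_program.
exists (PComp mul [:: PComp pow [:: PProj 0];
                      PComp PSucc [:: PComp double [:: PProj 1]]]) => x s.
apply: (@computes_comp2 _ _ _ _ (2 ^ x) s.*2.+1) => //; first exact: computes_comp1.
by apply: (@computes_comp1 _ _ _ s.*2) => //; apply: computes_comp1.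
Qed.

(** The components of a pair, read off from its code and extended to the one number
that codes no pair, because the search runs through all numbers. *)
Definition ufst (y : nat) : nat := head 0 (CodeSeq.decode y).
Definition usnd (y : nat) : nat := CodeSeq.code (behead (CodeSeq.decode y)).

Lemma halves_code k x s : k <= x -> iter k half (2 ^ x * s.*2.+1) = 2 ^ (x - k) * s.*2.+1.
Proof.
elim: k => [|k IHk] kx; first by rewrite subn0.
by rewrite iterS IHk ?(ltnW kx) // -(subnSK kx) expnS -mulnA mul2n doubleK.
Qed.

Lemma decode_pos y : y != 0 -> exists x s, CodeSeq.decode y = x :: s /\
  y = 2 ^ x * (CodeSeq.code s).*2.+1.
Proof.
move=> y0; have := CodeSeq.decodeK y; case: (CodeSeq.decode y) => [|x s] /= e.
  by rewrite -e in y0.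
by exists x, s.
Qed.

(** The first component of 2^x (2s + 1) is the least x for which the x-th iterated
half is odd.  The factor y in the test makes the search stop when y = 0. *)
Lemma ufst_program : exists p, unary p ufst.
Proof.
have [mul mulP] := mul_program; have [odd oddP] := odd_program.
have [halves halvesP] := halves_program; have [sub subP] := sub_program.
have [one oneP] := const_program 1.
pose test := PComp mul [:: PComp sub [:: one; PComp odd [:: PComp halves [:: PProj 0;
  PProj 1]]]; PProj 1].
have testP k y : computes test [:: k; y] ((1 - ssrnat.odd (iter k half y)) * y).
  apply: (@computes_comp2 _ _ _ _ (1 - ssrnat.odd (iter k half y)) y) => //.
  apply: (@computes_comp2 _ _ _ _ 1 (ssrnat.odd (iter k half y))) => //.
  by apply: (@computes_comp1 _ _ _ (iter k half y)) => //; apply: (@computes_comp2 _ _ _ _ k y).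
exists (PMin test) => y; have [->|/decode_pos[x [s [dy ey]]]] := eqVneq y 0.
  by split=> [|//]; have := testP 0 0; rewrite muln0.
have -> : ufst y = x by rewrite /ufst dy.
split.
  by have := testP x y; rewrite {2}ey halves_code // subnn mul1n /= odd_double.
move=> k kx; exists y.-1; have := testP k y.
rewrite {2}ey halves_code ?(ltnW kx) // -(subnSK kx) expnS -mulnA mul2n odd_double mul1n.
by rewrite prednK // ey muln_gt0 expn_gt0.
Qed.

Lemma usnd_program : exists p, unary p usnd.
Proof.
have [halves halvesP] := halves_program; have [fst fstP] := ufst_program.
have [half halfP] := half_program.
exists (PComp half [:: PComp halves [:: PComp fst [:: PProj 0]; PProj 0]]) => y.
apply: (@computes_comp1 _ _ _ (iter (ufst y) ssrnat.half y)).
  apply: (@computes_comp2 _ _ _ _ (ufst y) y) => //.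
  by apply: (@computes_comp1 _ _ _ y).
suff -> : usnd y = (iter (ufst y) ssrnat.half y)./2 by apply: halfP.
have [->|/decode_pos[x [s [dy ey]]]] := eqVneq y 0; first by [].
rewrite /usnd /ufst dy /= ey halves_code // subnn mul1n.
by rewrite -[_./2]/(uphalf _) uphalf_double.
Qed.

End Arithmetic.

(** Values of different types are coded by numbers in such a way that a nonempty list
has the code of the pair of its head and its tail. *)
Class coded (A : Type) := enc : A -> nat.
#[export] Instance coded_nat : coded nat := id.
#[export] Instance coded_bool : coded bool := nat_of_bool.
#[export] Instance coded_pair A B (cA : coded A) (cB : coded B) : coded (A * B) :=
  fun x => 2 ^ enc x.1 * (enc x.2).*2.+1.
#[export] Instance coded_seq A (cA : coded A) : coded (seq A) :=
  fun s => CodeSeq.code (map enc s).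

(** Contexts with several variables are tuples, so that programs of one argument
suffice and functions can be composed freely. *)
Definition computable A B (cA : coded A) (cB : coded B) (f : A -> B) : Prop :=
  exists p, forall a, computes p [:: enc a] (enc (f a)).
Arguments computable {A B cA cB} f.

Section Combinators.
Context {A B C X : Type} {cA : coded A} {cB : coded B} {cC : coded C} {cX : coded X}.

Lemma computable_id : computable (fun a : A => a).
Proof. by exists (PProj 0). Qed.

Lemma computable_const (b : B) : computable (fun _ : A => b).
Proof. by have [p pP] := const_program (enc b); exists p. Qed.

Lemma computable_comp (f : A -> B) (h : B -> C) :
  computable f -> computable h -> computable (fun a => h (f a)).
Proof.
move=> [p pP] [q qP]; exists (PComp q [:: p]) => a.
exact: computes_comp1 (pP a) (qP _).
Qed.

Lemma computable_pair (f : A -> B) (h : A -> C) :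
  computable f -> computable h -> computable (fun a => (f a, h a)).
Proof.
move=> [p pP] [q qP]; have [c cP] := cons_program.
by exists (PComp c [:: p; q]) => a; apply: computes_comp2 (pP a) (qP a) (cP _ _).
Qed.

Lemma decode_pair x s : CodeSeq.decode (2 ^ x * s.*2.+1) = x :: CodeSeq.decode s.
Proof. by rewrite -{1}[s]CodeSeq.decodeK -[RHS]CodeSeq.codeK. Qed.

Lemma ufst_enc (x : B * C) : ufst (enc x) = enc x.1.
Proof. by rewrite /ufst [enc x]/(2 ^ _ * _) decode_pair. Qed.

Lemma usnd_enc (x : B * C) : usnd (enc x) = enc x.2.
Proof. by rewrite /usnd [enc x]/(2 ^ _ * _) decode_pair /= CodeSeq.decodeK. Qed.

Lemma computable_fst (f : A -> B * C) : computable f -> computable (fun a => (f a).1).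
Proof.
move=> [p pP]; have [q qP] := ufst_program; exists (PComp q [:: p]) => a.
by apply: computes_comp1 (pP a) _; rewrite -ufst_enc.
Qed.

Lemma computable_snd (f : A -> B * C) : computable f -> computable (fun a => (f a).2).
Proof.
move=> [p pP]; have [q qP] := usnd_program; exists (PComp q [:: p]) => a.
by apply: computes_comp1 (pP a) _; rewrite -usnd_enc.
Qed.

Lemma computable_natrec (n : A -> nat) (z : A -> B) (h : A -> nat -> B -> B) :
    computable n -> computable z ->
    computable (fun t : A * (nat * B) => h t.1 t.2.1 t.2.2) ->
  computable (fun a => nat_rect (fun=> B) (z a) (h a) (n a)).
Proof.
move=> [pn nP] [pz zP] [ph hP]; have [c cP] := cons_program.
pose step := PComp ph [:: PComp c [:: PProj 2; PComp c [:: PProj 0; PProj 1]]].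
exists (PComp (PRec pz step) [:: pn; PProj 0]) => a.
apply: (@computes_comp2 _ _ _ _ (n a) (enc a)) => //.
apply: (@computes_rec _ _ [:: n a; enc a]
  (fun m => enc (nat_rect (fun=> B) (z a) (h a) m))) => [|m _]; first exact: (zP a).
apply: computes_comp1 (hP (a, (m, nat_rect (fun=> B) (z a) (h a) m))).
by apply: (@computes_comp2 _ _ _ _ (enc a)); last exact: cP; [|apply: computes_comp2;
  last exact: cP].
Qed.

Lemma computable_if (b : A -> bool) (f h : A -> B) :
    computable b -> computable f -> computable h ->
  computable (fun a => if b a then f a else h a).
Proof.
move=> [pb bP] [pf fP] [ph hP].
exists (PComp (PRec ph (PComp pf [:: PProj 2])) [:: pb; PProj 0]) => a.
apply: (@computes_comp2 _ _ _ _ (b a) (enc a)) => //.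
have := @computes_rec ph (PComp pf [:: PProj 2]) [:: nat_of_bool (b a); enc a]
  (fun m => if m is 0 then enc (h a) else enc (f a)).
rewrite (_ : enc (if b a then f a else h a) =
  (fun m => if m is 0 then enc (h a) else enc (f a)) (b a)); last by case: (b a).
apply=> [|m _]; first exact: (hP a).
by apply: (@computes_comp1 _ _ _ (enc a)).
Qed.

Lemma computable_case (f : A -> seq X) (z : A -> B) (h : A -> X -> seq X -> B) :
    computable f -> computable z ->
    computable (fun t : A * (X * seq X) => h t.1 t.2.1 t.2.2) ->
  computable (fun a => if f a is x :: s then h a x s else z a).
Proof.
move=> [pf fP] [pz zP] [ph hP]; have [c cP] := cons_program.
have [fst fstP] := ufst_program.
exists (PComp (PRec (PComp pz [:: fst]) (PComp ph [:: PProj 2]))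
              [:: pf; PComp c [:: PProj 0; pf]]) => a.
pose y := 2 ^ @enc A cA a * (@enc (seq X) (coded_seq cX) (f a)).*2.+1.
apply: (@computes_comp2 _ _ _ _ (enc (f a)) y) => //.
  exact: (@computes_comp2 _ _ _ _ (enc a) (enc (f a))).
have z0 : computes (PComp pz [:: fst]) [:: y] (enc (z a)).
  apply: (@computes_comp1 _ _ _ (enc a)) => //.
  by have := fstP y; rewrite /ufst decode_pair.
move: z0; rewrite {}/y; case: (f a) => [|x s] z0.
  by apply: (@computes_rec _ _ [:: 0; _] (fun=> enc (z a))).
have step := hP (a, (x, s)).
pose F m := if m is 0 then @enc B cB (z a) else @enc B cB (h a x s).
rewrite (_ : enc (h a x s) = F (enc (x :: s))).
  have := @computes_rec (PComp pz [:: fst]) (PComp ph [:: PProj 2])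
    [:: enc (x :: s); 2 ^ enc a * (enc (x :: s)).*2.+1] F.
  apply=> [|m _]; first exact: z0.
  by apply: computes_comp1 step.
have : enc (x :: s) != 0 by rewrite /enc /coded_seq /= -lt0n muln_gt0 expn_gt0.
by rewrite /F; case: (enc (x :: s)).
Qed.

Lemma eq_computable (f h : A -> B) : f =1 h -> computable f -> computable h.
Proof. by move=> e [p pP]; exists p => a; rewrite -e. Qed.

Lemma computable_cons (f : A -> X) (h : A -> seq X) :
  computable f -> computable h -> computable (fun a => f a :: h a).
Proof.
move=> [p pP] [q qP]; have [c cP] := cons_program.
by exists (PComp c [:: p; q]) => a; apply: computes_comp2 (pP a) (qP a) (cP _ _).
Qed.

Lemma computable_enc (f : A -> seq X) :
  computable f -> computable (fun a => enc (f a)).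
Proof. by case=> p pP; exists p. Qed.

Lemma computable_nat1 (F : nat -> nat) (f : A -> nat) :
  (exists p, unary p F) -> computable f -> computable (fun a => F (f a)).
Proof. by case=> q qP [p pP]; exists (PComp q [:: p]) => a;
  apply: computes_comp1 (pP a) (qP _). Qed.

Lemma computable_succ (f : A -> nat) : computable f -> computable (fun a => (f a).+1).
Proof. by apply: (@computable_nat1 succn); exists PSucc. Qed.

Lemma computable_half (f : A -> nat) : computable f -> computable (fun a => (f a)./2).
Proof. exact: (computable_nat1 half_program). Qed.

Lemma computable_pred (f : A -> nat) : computable f -> computable (fun a => (f a).-1).
Proof. exact: (computable_nat1 pred_program). Qed.

Lemma computable_odd (f : A -> nat) : computable f -> computable (fun a => odd (f a)).
Proof. exact: (computable_nat1 odd_program). Qed.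

Lemma computable_decode (f : A -> nat) :
  computable f -> computable (fun a => CodeSeq.decode (f a)).
Proof.
case=> p pP; exists p => a.
by rewrite /enc /coded_seq map_id CodeSeq.decodeK.
Qed.

Lemma computable_eqn (f h : A -> nat) :
  computable f -> computable h -> computable (fun a => f a == h a).
Proof.
case=> p pP [q qP]; have [r rP] := eqn_program; exists (PComp r [:: p; q]) => a.
exact: computes_comp2 (pP a) (qP a) (rP _ _).
Qed.

Lemma computable_ltn (f h : A -> nat) :
  computable f -> computable h -> computable (fun a => f a < h a).
Proof.
case=> p pP [q qP]; have [r rP] := ltn_program; exists (PComp r [:: p; q]) => a.
exact: computes_comp2 (pP a) (qP a) (rP _ _).
Qed.

End Combinators.

Ltac projections :=
  repeat lazymatch goal with
  | |- computable (fun t => t) => exact: computable_id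
  | |- computable (@fst _ _) => exact: (computable_fst computable_id)
  | |- computable (@snd _ _) => exact: (computable_snd computable_id)
  | |- computable (fun t => (_, _)) => apply: computable_pair
  | |- computable (fun t => fst _) => apply: computable_fst
  | |- computable (fun t => snd _) => apply: computable_snd
  end.

Section Booleans.
Context {A : Type} {cA : coded A}.

Lemma computable_negb (f : A -> bool) : computable f -> computable (fun a => ~~ f a).
Proof.
move=> fP; apply: (@eq_computable _ _ _ _ (fun a => if f a then false else true)).
  by move=> a; case: (f a).
by apply: computable_if => //; apply: computable_const.
Qed.

Lemma computable_and (f h : A -> bool) :
  computable f -> computable h -> computable (fun a => f a && h a).
Proof.
move=> fP hP; apply: (@eq_computable _ _ _ _ (fun a => if f a then h a else false)) => //.
by apply: computable_if => //; apply: computable_const.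
Qed.

End Booleans.

Section Lists.
Context {A B X : Type} {cA : coded A} {cB : coded B} {cX : coded X}.

Lemma computable_iter (n : A -> nat) (z : A -> B) (h : A -> B -> B) :
    computable n -> computable z -> computable (fun t : A * B => h t.1 t.2) ->
  computable (fun a => iter (n a) (h a) (z a)).
Proof.
move=> nP zP hP.
apply: (@eq_computable _ _ _ _ (fun a => nat_rect (fun=> B) (z a) (fun=> h a) (n a))).
  by move=> a; elim: (n a) => //= m ->.
apply: (@computable_natrec _ _ _ _ n z (fun a _ => h a)) => //.
apply: (@computable_comp _ _ _ _ _ _ (fun t : A * (nat * B) => (t.1, t.2.2)) _ _ hP).
by projections.
Qed.

End Lists.

Section Folds.
Context {A B X : Type} {cA : coded A} {cB : coded B} {cX : coded X}.

Definition foldl_step (h : B -> X -> B) (t : seq X * B) : seq X * B :=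
  if t.1 is x :: s then (s, h t.2 x) else t.

Lemma iter_foldl_step h (s : seq X) b n : size s <= n ->
  iter n (foldl_step h) (s, b) = ([::], foldl h b s).
Proof.
elim: s b n => [|x s IHs] b n /=; first by move=> _; elim: n => //= n ->.
by case: n => // n lt; rewrite iterSr; apply: IHs.
Qed.

Lemma leq_size_enc (s : seq X) : size s <= enc s.
Proof.
rewrite /enc /coded_seq; elim: s => //= x s IHs.
rewrite (leq_trans (n := (CodeSeq.code (map enc s)).*2.+1)) ?leq_pmull ?expn_gt0 //.
by rewrite ltnS (leq_trans IHs) // -addnn leq_addr.
Qed.

(** The loop is run as often as the code of the list says, which is more than enough;
once the list is empty nothing changes any more. *)
Lemma computable_foldl (h : A -> B -> X -> B) (z : A -> B) (s : A -> seq X) :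
    computable (fun t : A * (B * X) => h t.1 t.2.1 t.2.2) ->
    computable z -> computable s ->
  computable (fun a => foldl (h a) (z a) (s a)).
Proof.
move=> hP zP sP.
apply: (@eq_computable _ _ _ _ (fun a => (iter (enc (s a)) (foldl_step (h a)) (s a, z a)).2)).
  by move=> a; rewrite iter_foldl_step ?leq_size_enc.
apply: computable_snd.
apply: (computable_iter (h := fun a => foldl_step (h a))).
- exact: computable_enc.
- exact: computable_pair.
rewrite /foldl_step.
apply: (@computable_case _ _ _ _ _ _ (fun t : A * (seq X * B) => t.2.1) (fun t => t.2)
   (fun t x s => (s, h t.1 t.2.2 x))).
1-2: by projections.
apply: computable_pair; first by projections.
apply: (@computable_comp _ _ _ _ _ _
  (fun t : A * (seq X * B) * (X * seq X) => (t.1.1, (t.1.2.2, t.2.1))) _ _ hP).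
by projections.
Qed.

End Folds.

(** * Computable functions on lists *)

Section Currying.
Context {A X Y Z W : Type}.
Context {cA : coded A} {cX : coded X} {cY : coded Y} {cZ : coded Z} {cW : coded W}.

Lemma computable2 (F : X -> Y -> Z) (f : A -> X) (h : A -> Y) :
  computable (fun t : X * Y => F t.1 t.2) ->
  computable f -> computable h -> computable (fun a => F (f a) (h a)).
Proof.
move=> FP fP hP.
by apply: (computable_comp (f := fun a => (f a, h a)) _ FP); apply: computable_pair.
Qed.

Lemma computable3 (F : X -> Y -> Z -> W) (f : A -> X) (h : A -> Y) (k : A -> Z) :
  computable (fun t : X * (Y * Z) => F t.1 t.2.1 t.2.2) ->
  computable f -> computable h -> computable k -> computable (fun a => F (f a) (h a) (k a)).
Proof.
move=> FP fP hP kP.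
apply: (computable_comp (f := fun a => (f a, (h a, k a))) _ FP).
by apply: computable_pair => //; apply: computable_pair.
Qed.

End Currying.

Section ListFolds.
Context {A B X : Type} {cA : coded A} {cB : coded B} {cX : coded X}.

Lemma computable_rev (s : A -> seq X) : computable s -> computable (fun a => rev (s a)).
Proof.
move=> sP; apply: (@eq_computable _ _ _ _ (fun a => foldl (fun r x => x :: r) [::] (s a))).
  move=> a; rewrite /rev; elim: (s a) [::] => //= x r IHr t; exact: IHr.
apply: (computable_foldl (h := fun _ r x => x :: r)) => //; last exact: computable_const.
by apply: computable_cons; projections.
Qed.

Lemma computable_foldr (h : A -> X -> B -> B) (z : A -> B) (s : A -> seq X) :
    computable (fun t : A * (B * X) => h t.1 t.2.2 t.2.1) ->
    computable z -> computable s ->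
  computable (fun a => foldr (h a) (z a) (s a)).
Proof.
move=> hP zP sP.
apply: (@eq_computable _ _ _ _ (fun a => foldl (fun b x => h a x b) (z a) (rev (s a)))).
  by move=> a; rewrite foldl_rev.
by apply: (computable_foldl (h := fun a b x => h a x b)) => //; apply: computable_rev.
Qed.

Lemma computable_head (d : A -> X) (s : A -> seq X) :
  computable d -> computable s -> computable (fun a => head (d a) (s a)).
Proof.
move=> dP sP; apply: (@eq_computable _ _ _ _ (fun a => if s a is x :: _ then x else d a)) => //.
by apply: (computable_case (h := fun _ x _ => x)) => //; projections.
Qed.

Lemma computable_behead (s : A -> seq X) :
  computable s -> computable (fun a => behead (s a)).
Proof.
move=> sP; apply: (@eq_computable _ _ _ _ (fun a => if s a is _ :: r then r else [::])) => //.
by apply: (computable_case (h := fun _ _ r => r)) => //; [exact: computable_const|projections].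
Qed.

End ListFolds.

Section ListMaps.
Context {A X Y : Type} {cA : coded A} {cX : coded X} {cY : coded Y}.

Lemma computable_map (h : A -> X -> Y) (s : A -> seq X) :
    computable (fun t : A * X => h t.1 t.2) -> computable s ->
  computable (fun a => map (h a) (s a)).
Proof.
move=> hP sP.
apply: (@eq_computable _ _ _ _ (fun a => foldr (fun x r => h a x :: r) [::] (s a))) => //.
apply: (computable_foldr (h := fun a x r => h a x :: r)) => //; last exact: computable_const.
apply: computable_cons; last by projections.
by apply: (computable2 hP); projections.
Qed.

Lemma computable_all (p : A -> X -> bool) (s : A -> seq X) :
    computable (fun t : A * X => p t.1 t.2) -> computable s ->
  computable (fun a => all (p a) (s a)).
Proof.
move=> pP sP.
apply: (@eq_computable _ _ _ _ (fun a => foldr (fun x b => p a x && b) true (s a))) => //.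
apply: (computable_foldr (h := fun a x b => p a x && b)) => //; last exact: computable_const.
apply: computable_and; last by projections.
by apply: (computable2 pP); projections.
Qed.

Lemma computable_cat (s r : A -> seq X) :
  computable s -> computable r -> computable (fun a => s a ++ r a).
Proof.
move=> sP rP.
apply: (@eq_computable _ _ _ _ (fun a => foldr cons (r a) (s a))).
  by move=> a; elim: (s a) => //= x l ->.
by apply: (computable_foldr (h := fun _ => cons)) => //; apply: computable_cons; projections.
Qed.

Lemma computable_nth (d : A -> X) (s : A -> seq X) (n : A -> nat) :
  computable d -> computable s -> computable n ->
  computable (fun a => nth (d a) (s a) (n a)).
Proof.
move=> dP sP nP.
apply: (@eq_computable _ _ _ _ (fun a => head (d a) (iter (n a) behead (s a)))).
  move=> a; elim: (n a) (s a) => [|k IHk] l; first by rewrite nth0.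
  by rewrite iterSr IHk nth_behead.
apply: computable_head => //; apply: (computable_iter (h := fun _ => behead)) => //.
by apply: computable_behead; projections.
Qed.

Lemma computable_size (s : A -> seq X) : computable s -> computable (fun a => size (s a)).
Proof.
move=> sP; apply: (@eq_computable _ _ _ _ (fun a => foldr (fun _ n => n.+1) 0 (s a))).
  by move=> a; elim: (s a) => //= x r ->.
apply: (computable_foldr (h := fun _ _ n => n.+1)) => //; last exact: computable_const.
by apply: computable_succ; projections.
Qed.

End ListMaps.

Lemma computable_flatten A X (cA : coded A) (cX : coded X) (s : A -> seq (seq X)) :
  computable s -> computable (fun a => flatten (s a)).
Proof.
move=> sP; apply: (computable_foldr (h := fun _ => cat)) => //; last exact: computable_const.
by apply: computable_cat; projections.
Qed.

Lemma computable_iota A (cA : coded A) (n : A -> nat) :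
  computable n -> computable (fun a => iota 0 (n a)).
Proof.
move=> nP.
apply: (@eq_computable _ _ _ _ (fun a =>
    nat_rect (fun=> seq nat) [::] (fun m s => s ++ [:: m]) (n a))).
  by move=> a; elim: (n a) => //= m ->; rewrite -[RHS]/(iota 0 m.+1) -addn1 iotaD.
apply: (computable_natrec (h := fun _ m s => s ++ [:: m])) => //; first exact: computable_const.
apply: computable_cat; first by projections.
by apply: computable_cons; [projections|apply: computable_const].
Qed.

Lemma enc_seq_nat (s : seq nat) : enc s = CodeSeq.code s.
Proof. by rewrite /enc /coded_seq map_id. Qed.

Lemma computable_eqseq A (cA : coded A) (s r : A -> seq nat) :
  computable s -> computable r -> computable (fun a => s a == r a).
Proof.
move=> sP rP; apply: (@eq_computable _ _ _ _ (fun a => enc (s a) == enc (r a))).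
  by move=> a; rewrite !enc_seq_nat (can_eq CodeSeq.codeK).
by apply: computable_eqn; apply: computable_enc.
Qed.

(** Goes through the syntax of a function and applies the lemma for its outermost
operation; what it does not recognise is left to be proved. *)
Ltac computability :=
  repeat lazymatch goal with
  | |- computable (fun t => t) => exact: computable_id
  | |- computable (@fst _ _) => exact: (computable_fst computable_id)
  | |- computable (@snd _ _) => exact: (computable_snd computable_id)
  | |- computable odd => exact: (computable_odd computable_id)
  | |- computable half => exact: (computable_half computable_id)
  | |- computable predn => exact: (computable_pred computable_id)
  | |- computable S => exact: (computable_succ computable_id)
  | |- computable (fun t => (_, _)) => apply: computable_pair
  | |- computable (fun t => fst _) => apply: computable_fst
  | |- computable (fun t => snd _) => apply: computable_snd
  | |- computable (fun t => ~~ _) => apply: computable_negb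
  | |- computable (fun t => andb _ _) => apply: computable_and
  | |- computable (fun t => cons _ _) => apply: computable_cons
  | |- computable (fun t => cat _ _) => apply: computable_cat
  | |- computable (fun t => rev _) => apply: computable_rev
  | |- computable (fun t => size _) => apply: computable_size
  | |- computable (fun t => flatten _) => apply: computable_flatten
  | |- computable (fun t => iota 0 _) => apply: computable_iota
  | |- computable (fun t => nth _ _ _) => apply: computable_nth
  | |- computable (fun t => leq (S _) _) => apply: computable_ltn
  | |- computable (fun t => S _) => apply: computable_succ
  | |- computable (fun t => predn _) => apply: computable_pred
  | |- computable (fun t => half _) => apply: computable_half
  | |- computable (fun t => odd _) => apply: computable_odd
  | |- computable (fun t => map (@?h t) (@?s t)) =>
      apply: (computable_map (h := h) (s := s)); cbv beta
  | |- computable (fun t => all (@?h t) (@?s t)) =>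
      apply: (computable_all (p := h) (s := s)); cbv beta
  | |- computable (fun t => foldr (@?h t) (@?z t) (@?s t)) =>
      apply: (computable_foldr (h := h) (z := z) (s := s)); cbv beta
  | |- computable (fun t => foldl (@?h t) (@?z t) (@?s t)) =>
      apply: (computable_foldl (h := h) (z := z) (s := s)); cbv beta
  | |- computable (fun t => if _ then _ else _) => apply: computable_if
  | |- computable (fun t => @eq_op Datatypes_nat__canonical__eqtype_Equality _ _) =>
      apply: computable_eqn
  | |- computable (fun t => ?c) => exact: computable_const
  end.

(** * The search criterion as a computable function *)

(** Operations on codes of letters, words and moves; the letter n in front of a name
stands for numbers.  The last binary digit of the code of a letter is the sign. *)
Definition nlinv (x : nat) : nat := if odd x then x.-1 else x.+1.
Definition ncons_red (x : nat) (w : seq nat) : seq nat :=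
  if w is y :: w' then if y == nlinv x then w' else x :: w else [:: x].
Definition nreduce (w : seq nat) : seq nat := foldr ncons_red [::] w.
Definition ninv (w : seq nat) : seq nat := rev (map nlinv w).
Definition nmul (u v : seq nat) : seq nat := nreduce (u ++ v).
Definition nsubst (phi : seq (seq nat)) (w : seq nat) : seq nat :=
  nreduce (flatten (map (fun x => if odd x then ninv (nth [::] phi x./2)
                                  else nth [::] phi x./2) w)).

Definition ncollapsible (nx op : seq nat) (e : nat) : bool :=
  (nth 0 nx e != e) && (nth 0 nx (nth 0 op e) != nth 0 op e) &&
  (nth 0 nx e != nth 0 op e) && (nth 0 nx (nth 0 nx e) != nth 0 op e).

Definition nflip_next (nx op : seq nat) (e : nat) : seq nat :=
  map (fun x =>
    let e' := nth 0 op e in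
    let a := nth 0 nx e in let b := nth 0 nx a in
    let c := nth 0 nx e' in let d := nth 0 nx c in
    if x == e then b else if x == b then c else if x == c then e
    else if x == e' then d else if x == d then a else if x == a then e'
    else nth 0 nx x) (iota 0 (size nx)).

Definition nflip_mark (nx op : seq nat) (mk : seq (seq nat)) (e : nat) : seq (seq nat) :=
  map (fun x =>
    let e' := nth 0 op e in
    let b := nth 0 nx (nth 0 nx e) in let c := nth 0 nx e' in
    if x == e then ninv (nmul (nth [::] mk b) (nth [::] mk c))
    else if x == e' then nmul (nth [::] mk b) (nth [::] mk c)
    else nth [::] mk x) (iota 0 (size nx)).

(** The boolean records whether all the moves so far were possible. *)
Definition nstep (op : seq nat) (st : bool * (seq nat * seq (seq nat))) (e : nat) :=
  (st.1 && ((e < size st.2.1) && ncollapsible st.2.1 op e),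
   (nflip_next st.2.1 op e, nflip_mark st.2.1 op st.2.2 e)).

Definition nrun (op nx : seq nat) (mk : seq (seq nat)) (es : seq nat) :=
  foldl (nstep op) (true, (nx, mk)) es.

(** The lists f and f' are a bijection from the half-edges of the outcome to those of
phi(G) and its inverse. *)
Definition niso (op nx0 : seq nat) (mk0 phi : seq (seq nat))
    (nx : seq nat) (mk : seq (seq nat)) (f f' : seq nat) : bool :=
  all (fun i => (nth 0 f i < size nx0) && (nth 0 f' (nth 0 f i) == i) &&
     (nth 0 f (nth 0 nx i) == nth 0 nx0 (nth 0 f i)) &&
     (nth 0 f (nth 0 op i) == nth 0 op (nth 0 f i)) &&
     (nsubst phi (nth [::] mk0 (nth 0 f i)) == nth [::] mk i)) (iota 0 (size nx0)).

Definition accepts (nx op : seq nat) (mk phi : seq (seq nat)) (y : nat) : bool :=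
  let st := nrun op nx mk (CodeSeq.decode (ufst y)) in
  st.1 && niso op nx mk phi st.2.1 st.2.2
    (CodeSeq.decode (ufst (usnd y))) (CodeSeq.decode (usnd (usnd y))).

Lemma computable_nlinv : computable nlinv.
Proof. rewrite /nlinv; computability. Qed.

Lemma computable_ncons_red : computable (fun t : nat * seq nat => ncons_red t.1 t.2).
Proof.
apply: (computable_case (f := snd) (z := fun t => [:: t.1])
  (h := fun t y w' => if y == nlinv t.1 then w' else t.1 :: t.2)); computability.
by apply: (computable_comp _ computable_nlinv); computability.
Qed.

Lemma computable_nreduce : computable nreduce.
Proof.
rewrite /nreduce.
apply: (computable_foldr (h := fun _ => ncons_red) (z := fun _ => [::]) (s := fun w => w));
  computability.
by apply: (computable2 computable_ncons_red); computability.
Qed.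

Lemma computable_ninv : computable ninv.
Proof.
rewrite /ninv; apply: computable_rev.
apply: (computable_map (h := fun _ => nlinv) (s := fun w => w)); computability.
by apply: (computable_comp _ computable_nlinv); computability.
Qed.

Lemma computable_nmul : computable (fun t : seq nat * seq nat => nmul t.1 t.2).
Proof. by apply: (computable_comp _ computable_nreduce); computability. Qed.

Lemma computable_nsubst : computable (fun t : seq (seq nat) * seq nat => nsubst t.1 t.2).
Proof.
apply: (computable_comp _ computable_nreduce); computability.
by apply: (computable_comp _ computable_ninv); computability.
Qed.

Lemma computable_ncollapsible :
  computable (fun t : seq nat * (seq nat * nat) => ncollapsible t.1 t.2.1 t.2.2).
Proof. by rewrite /ncollapsible; computability. Qed.

Lemma computable_nflip_next :
  computable (fun t : seq nat * (seq nat * nat) => nflip_next t.1 t.2.1 t.2.2).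
Proof. by rewrite /nflip_next; cbv zeta; computability. Qed.

Lemma computable_nflip_mark :
  computable (fun t : (seq nat * seq (seq nat)) * (seq nat * nat) =>
    nflip_mark t.1.1 t.2.1 t.1.2 t.2.2).
Proof.
rewrite /nflip_mark; cbv zeta; computability.
- by apply: (computable_comp _ computable_ninv); apply: (computable2 computable_nmul);
  computability.
- by apply: (computable2 computable_nmul); computability.
Qed.

Lemma computable_nstep :
  computable (fun t : seq nat * ((bool * (seq nat * seq (seq nat))) * nat) =>
    nstep t.1 t.2.1 t.2.2).
Proof.
rewrite /nstep; computability.
- by apply: (computable3 computable_ncollapsible); computability.
- by apply: (computable3 computable_nflip_next); computability.
- exact: (computable2 (F := fun x y => nflip_mark x.1 y.1 x.2 y.2) computable_nflip_mark
    (f := fun t : seq nat * ((bool * (seq nat * seq (seq nat))) * nat) => t.2.1.2)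
    (h := fun t => (t.1, t.2.2)) ltac:(computability) ltac:(computability)).
Qed.

Lemma computable_nrun :
  computable (fun t : (seq nat * seq nat) * (seq (seq nat) * seq nat) =>
    nrun t.1.1 t.1.2 t.2.1 t.2.2).
Proof.
rewrite /nrun; apply: (computable_foldl (h := fun t => nstep t.1.1)); computability.
by apply: (computable3 computable_nstep); computability.
Qed.

Lemma computable_niso :
  computable (fun t : ((seq nat * seq nat) * (seq (seq nat) * seq (seq nat))) *
                      ((seq nat * seq (seq nat)) * (seq nat * seq nat)) =>
    niso t.1.1.1 t.1.1.2 t.1.2.1 t.1.2.2 t.2.1.1 t.2.1.2 t.2.2.1 t.2.2.2).
Proof.
rewrite /niso; computability; apply: computable_eqseq; computability.
by apply: (computable2 computable_nsubst); computability.
Qed.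

Lemma computable_ufst A (cA : coded A) (f : A -> nat) :
  computable f -> computable (fun a => ufst (f a)).
Proof. exact: (computable_nat1 ufst_program). Qed.

Lemma computable_usnd A (cA : coded A) (f : A -> nat) :
  computable f -> computable (fun a => usnd (f a)).
Proof. exact: (computable_nat1 usnd_program). Qed.

Lemma computable_accepts :
  computable (fun t : ((seq nat * seq nat) * (seq (seq nat) * seq (seq nat))) * nat =>
    accepts t.1.1.1 t.1.1.2 t.1.2.1 t.1.2.2 t.2).
Proof.
pose D := (((seq nat * seq nat) * (seq (seq nat) * seq (seq nat))) * nat)%type.
have runP : computable (fun t : D =>
    nrun t.1.1.2 t.1.1.1 t.1.2.1 (CodeSeq.decode (ufst t.2))).
  apply: (computable_comp (f := fun t : D =>
    ((t.1.1.2, t.1.1.1), (t.1.2.1, CodeSeq.decode (ufst t.2)))) _ computable_nrun).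
  by computability; apply: computable_decode; apply: computable_ufst; computability.
rewrite /accepts; cbv zeta; apply: computable_and; first exact: computable_fst.
apply: (computable_comp (f := fun t : D =>
   (((t.1.1.2, t.1.1.1), (t.1.2.1, t.1.2.2)),
    ((nrun t.1.1.2 t.1.1.1 t.1.2.1 (CodeSeq.decode (ufst t.2))).2,
     (CodeSeq.decode (ufst (usnd t.2)), CodeSeq.decode (usnd (usnd t.2)))))) _ computable_niso).
computability; first exact: runP.
- by apply/computable_decode/computable_ufst/computable_usnd; computability.
- by apply/computable_decode/computable_usnd/computable_usnd; computability.
Qed.

(** * Codes of elements, maps and moves *)

(** The least number that passes the test is found by unbounded search, provided
there is one. *)
Lemma search_program : exists P, forall nx op mk phi y0, accepts nx op mk phi y0 ->
  exists2 y, accepts nx op mk phi y &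
    computes P [:: enc nx; enc op; enc mk; enc phi] (ufst y).
Proof.
have [q qP] := computable_negb computable_accepts.
have [c cP] := cons_program; have [fst fstP] := ufst_program.
pose pack := PComp c [:: PComp c [:: PComp c [:: PProj 1; PProj 2];
                                     PComp c [:: PProj 3; PProj 4]]; PProj 0].
exists (PComp fst [:: PMin (PComp q [:: pack])]) => nx op mk phi y0 acc0.
have [y acc min_y] := find_ex_minn (ex_intro (accepts nx op mk phi) y0 acc0).
exists y => //; apply: (@computes_comp1 _ _ _ y) => //.
have test z : computes (PComp q [:: pack])
    [:: z; enc nx; enc op; enc mk; enc phi] (~~ accepts nx op mk phi z).
  apply: computes_comp1 (qP (((nx, op), (mk, phi)), z)).
  apply: computes_comp2 (cP _ _) => //.
  by apply: computes_comp2 (cP _ _); apply: computes_comp2 (cP _ _).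
split; first by have := test y; rewrite acc.
move=> z zy; exists 0; have := test z; case: (boolP (accepts nx op mk phi z)) => // /min_y.
by rewrite leqNgt zy.
Qed.

Section Encoding.
Variable g : nat.
Local Notation letter := ('I_g * bool * bool)%type.
Local Notation code_letter := (@code_letter g).

Definition wcode (w : seq letter) : seq nat := map code_letter w.

Lemma code_letter_odd (x : letter) : odd (code_letter x) = x.2.
Proof. by case: x => [[i b] s] /=; rewrite oddD odd_double /= oddb. Qed.

Lemma code_letter_half (x : letter) : (code_letter x)./2 = x.1.1.*2 + x.1.2.
Proof. by case: x => [[i b] s] /=; rewrite addnC half_bit_double. Qed.

Lemma code_letter_inj : injective code_letter.
Proof.
move=> x y e; have := code_letter_odd x; have := code_letter_half x.
rewrite e code_letter_odd code_letter_half.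
case: x y {e} => [[i b] s] [[j c] r] /= e ->.
have ebc : b = c by have := congr1 odd e; rewrite !oddD !odd_double /= !oddb.
by move: e; rewrite ebc => /addIn/double_inj/val_inj ->.
Qed.

Lemma nlinvE x : nlinv (code_letter x) = code_letter (linv x).
Proof.
rewrite /nlinv code_letter_odd; case: x => [[i b] []] /=; last by rewrite addn0 addn1.
by rewrite addn1 addn0.
Qed.

Lemma nreduceE w : nreduce (wcode w) = wcode (reduce w).
Proof.
elim: w => //= x w ->; case: (reduce w) => //= y s.
by rewrite nlinvE (inj_eq code_letter_inj); case: ifP.
Qed.

Lemma ninvE w : ninv (wcode w) = wcode (word_inv w).
Proof.
rewrite /ninv /wcode /word_inv map_rev -!map_comp; congr rev.
by apply: eq_map => x /=; rewrite nlinvE.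
Qed.

Lemma nmulE (u v : surface_group g) :
  nmul (wcode (fg_word u)) (wcode (fg_word v)) = wcode (fg_word (u * v)%g).
Proof. by rewrite /nmul /wcode -map_cat nreduceE fg_wordM. Qed.

(** In this order the image of the generator with sign bit removed is found at half
the code of the letter. *)
Definition images (phi : mapping_class g) : seq (seq nat) :=
  flatten [seq [:: wcode (fg_word (phi (alpha i))); wcode (fg_word (phi (beta i)))]
          | i <- enum 'I_g].

Lemma nth_images phi (i : 'I_g) (b : bool) :
  nth [::] (images phi) (i.*2 + b) = wcode (fg_word (phi (fg_gen (i, b)))).
Proof.
have gen s k : k < size s -> nth [::] (flatten
    [seq [:: wcode (fg_word (phi (alpha j))); wcode (fg_word (phi (beta j)))] | j <- s])
    (k.*2 + b) = wcode (fg_word (phi (fg_gen (nth i s k, b)))).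
  elim: s k => // j s IHs [|k] lt /=; first by case: b {IHs}.
  by rewrite -IHs // doubleS.
by rewrite gen ?size_enum_ord // nth_ord_enum.
Qed.

Lemma nsubstE phi (u : surface_group g) :
  nsubst (images phi) (wcode (fg_word u)) = wcode (fg_word (phi u)).
Proof.
pose im (x : letter) : seq letter :=
  if x.2 then word_inv (fg_word (phi (fg_gen x.1))) else fg_word (phi (fg_gen x.1)).
have -> : nsubst (images phi) (wcode (fg_word u)) = wcode (reduce (flatten (map im (fg_word u)))).
  rewrite /nsubst -nreduceE /wcode map_flatten -!map_comp; congr (nreduce (flatten _)).
  apply: eq_map => -[[i b] s] /=.
  rewrite -[(_ + _)]/(code_letter (i, b, s)) code_letter_odd code_letter_half nth_images.
  by case: s; rewrite /im /= ?ninvE.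
congr wcode; case: u => w; elim: w => [|x w IHw] rw.
  rewrite /= -[RHS]/(fg_word (phi _)) (_ : FreeGroup rw = 1%g) ?mc1 //.
  exact: val_inj.
have rw' : reduced w by apply: path_sorted rw.
pose l : surface_group g := @FreeGroup _ [:: x] isT.
have eu : FreeGroup rw = (l * FreeGroup rw')%g :> surface_group g.
  by apply: val_inj; rewrite /= -[RHS]/(reduce (x :: w)) reduce_id.
rewrite [in RHS]eu gmulfM fg_wordM -(IHw rw') /= !reduce_cat.
rewrite (reduce_id (reduce_reduced _)); congr foldr.
have -> : l = if x.2 then ((fg_gen x.1 : surface_group g)^-1)%g else fg_gen x.1.
  by apply: val_inj; rewrite /l; case: (x) => y [].
by rewrite /im; case: (x.2); rewrite ?mcV.
Qed.

Variable n : nat.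

Definition vals (h : 'I_n -> 'I_n) : seq nat := [seq val (h i) | i <- enum 'I_n].
Definition words (m : 'I_n -> surface_group g) : seq (seq nat) :=
  [seq wcode (fg_word (m i)) | i <- enum 'I_n].

Lemma nth_vals h (i : 'I_n) : nth 0 (vals h) i = h i.
Proof. by rewrite (nth_map i) ?size_enum_ord // nth_ord_enum. Qed.

Lemma nth_words m (i : 'I_n) : nth [::] (words m) i = wcode (fg_word (m i)).
Proof. by rewrite (nth_map i) ?size_enum_ord // nth_ord_enum. Qed.

Lemma size_vals h : size (vals h) = n.
Proof. by rewrite size_map size_enum_ord. Qed.

Lemma inputE (G : marked_fatgraph g 'I_n) phi :
  input G phi = [:: enc (vals (nexth G)); enc (vals (opph G)); enc (words (mark G));
                    enc (images phi)].
Proof.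
have ss (s : seq (seq nat)) : enc s = CodeSeq.code (map CodeSeq.code s).
  by congr CodeSeq.code; apply: eq_map => w; rewrite enc_seq_nat.
have im : CodeSeq.code (map CodeSeq.code (images phi)) = code_mapping_class phi.
  by rewrite /images map_flatten -map_comp.
have mk : CodeSeq.code (map CodeSeq.code (words (mark G))) = code_mark (mark G).
  by rewrite /words -map_comp.
by rewrite /input !enc_seq_nat !ss im mk.
Qed.

Lemma ncollapsibleE (G : marked_fatgraph g 'I_n) (e : 'I_n) :
  ncollapsible (vals (nexth G)) (vals (opph G)) e = collapsible G e.
Proof.
rewrite /ncollapsible !(nth_vals, val_eqE) collapsibleE !next_neq.
by rewrite -!andbA.
Qed.

Lemma map_iota (T : Type) (F : nat -> T) : map F (iota 0 n) = [seq F (val i) | i <- enum 'I_n].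
Proof. by rewrite -val_enum_ord -map_comp. Qed.

Section Step.
Variables (G : marked_fatgraph g 'I_n) (e : 'I_n) (ce : collapsible G e).

Lemma nflip_nextE :
  nflip_next (vals (nexth G)) (vals (opph G)) e = vals (nexth (flip ce)).
Proof.
rewrite /nflip_next size_vals map_iota; apply: eq_map => i.
rewrite flip_nextE /flip_map !(nth_vals, val_eqE).
by do !case: ifP => // _.
Qed.

Lemma nflip_markE :
  nflip_mark (vals (nexth G)) (vals (opph G)) (words (mark G)) e = words (mark (flip ce)).
Proof.
rewrite /nflip_mark size_vals map_iota; apply: eq_map => i.
rewrite /= /flip_mark !(nth_vals, nth_words, val_eqE) !nmulE ninvE.
by do !case: ifP => // _.
Qed.

End Step.
End Encoding.

(** * Correctness of the search *)

Section Runs.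
Variables (g n : nat).
Implicit Types G K L : marked_fatgraph g 'I_n.

Definition state G : seq nat * seq (seq nat) := (vals (nexth G), words (mark G)).

Lemma nstep_flip G e (ce : collapsible G e) :
  nstep (vals (opph G)) (true, state G) (val e) = (true, state (flip ce)).
Proof.
by rewrite /nstep /= size_vals ltn_ord ncollapsibleE ce nflip_nextE nflip_markE.
Qed.

Lemma foldl_nstep_ok op st es : (foldl (nstep op) st es).1 -> st.1.
Proof. by elim: es st => //= e es IHes st /IHes /andP[]. Qed.

(** Completeness of the simulation on codes. *)
Lemma flip_path_run G es L : flip_path G es L -> exists K,
  [/\ marked_iso K L, opph K =1 opph G &
      foldl (nstep (vals (opph G))) (true, state G) (map val es) = (true, state K)].
Proof.
elim: es G => [|e es IHes] G /=; first by exists G.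
by case=> ce /IHes[K [iK oK rK]]; exists K; rewrite nstep_flip.
Qed.

(** Soundness of the simulation: a run without failure comes from actual moves. *)
Lemma run_flip_path G es : (foldl (nstep (vals (opph G))) (true, state G) es).1 ->
  exists es' K, [/\ map val es' = es, opph K =1 opph G,
      foldl (nstep (vals (opph G))) (true, state G) es = (true, state K)
    & forall L, marked_iso K L -> flip_path G es' L].
Proof.
elim: es G => [|e es IHes] G; first by exists [::], G.
rewrite [foldl _ _ _]/= => ok.
have /andP[lt ce] : (e < size (vals (nexth G))) &&
    ncollapsible (vals (nexth G)) (vals (opph G)) e by apply: foldl_nstep_ok ok.
rewrite size_vals in lt; pose e' := Ordinal lt.
rewrite -[e]/(val e') ncollapsibleE in ce.
rewrite -[e]/(val e') nstep_flip in ok *; have [es' [K [<- oK rK pK]]] := IHes (flip ce) ok.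
by exists (e' :: es'), K; split=> // L iK; exists ce; apply: pK.
Qed.

(** A bijection compatible with the cyclic orders preserves the only half-edge that
is followed by itself, the root; so it respects the tails. *)
Lemma niso_iso G K (phi : mapping_class g) f f' : opph K =1 opph G ->
  niso (vals (opph G)) (vals (nexth G)) (words (mark G)) (images phi)
       (vals (nexth K)) (words (mark K)) f f' -> marked_iso K (mc_act phi G).
Proof.
move=> oK; rewrite /niso size_vals => /allP ok.
have {}ok (i : 'I_n) := ok (val i) (etrans (mem_iota 0 n i) (ltn_ord i)).
have lt (i : 'I_n) : nth 0 f i < n.
  by have /andP[/andP[/andP[/andP[]]]] := ok i.
pose F i := Ordinal (lt i).
have {}ok i : [/\ nth 0 f' (val (F i)) = val i, F (nexth K i) = nexth G (F i),
    F (opph K i) = opph G (F i) & mark (mc_act phi G) (F i) = mark K i].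
  have := ok i; rewrite -![nth 0 f (val i)]/(val (F i)) !nth_vals nth_words nth_words nsubstE.
  rewrite -oK -[nth 0 f (nexth K i)]/(val (F (nexth K i)))
    -[nth 0 f (opph K i)]/(val (F (opph K i))).
  rewrite !val_eqE -!andbA => /and5P[_ /eqP-> /eqP-> /eqP-> /eqP em]; split=> //.
  by apply: val_inj; apply: (inj_map (@code_letter_inj g)); exact: em.
have Finj : injective F.
  move=> i j e; apply: val_inj; have [<- _ _ _] := ok i; have [<- _ _ _] := ok j.
  by rewrite e.
exists F; first exact: injF_bij.
split=> [i|i||i]; try by have [] := ok i.
have Fr : F (root K) = root G.
  apply/eqP; rewrite -(next_neq G); have [_ <- _ _] := ok (root K).
  by rewrite next_root.
by rewrite /tail; have [_ _ -> _] := ok (root K); rewrite Fr.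
Qed.

Lemma iso_niso G K (phi : mapping_class g) : opph K =1 opph G ->
  marked_iso K (mc_act phi G) -> exists f f',
  niso (vals (opph G)) (vals (nexth G)) (words (mark G)) (images phi)
       (vals (nexth K)) (words (mark K)) f f'.
Proof.
move=> oK [F [F' FK F'K] [Fn Fo _ Fm]]; exists (vals F), (vals F').
rewrite /niso size_vals; apply/allP=> k; rewrite mem_iota => /= lt.
rewrite -[k]/(nat_of_ord (Ordinal lt)); move: (Ordinal lt) => i.
rewrite !(nth_vals, nth_words) nsubstE FK ltn_ord eqxx -oK.
have fm : phi (mark G (F i)) = mark K i by apply: Fm.
by rewrite Fn Fo fm !eqxx.
Qed.

End Runs.

Theorem corollary1p2 (g : nat) (hg : 1 <= g) :
  exists P : program,
    forall (n : nat) (G : marked_fatgraph g 'I_n) (phi : mapping_class g),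
      exists es : seq 'I_n,
        computes P (input G phi) (CodeSeq.code (map val es)) /\
        represents G es phi.
Proof.
have [P computesP] := search_program; exists P => n G phi; rewrite inputE.
have [es /flip_path_run[K [iK oK rK]]] := linked_any G (mc_act phi G) hg.
have [f [f' acc_iso]] := iso_niso oK iK.
have acc0 : accepts (vals (nexth G)) (vals (opph G)) (words (mark G)) (images phi)
    (enc (map val es, (f, f'))).
  rewrite /accepts /nrun usnd_enc !ufst_enc usnd_enc !enc_seq_nat !CodeSeq.codeK.
  by rewrite rK.
have [y /andP[ok acc] cy] := computesP _ _ _ _ _ acc0.
have [es' [K' [ees oK' rK' pK']]] := run_flip_path ok.
exists es'; split; first by rewrite ees CodeSeq.decodeK.
apply/flip_path_whitehead/pK'; apply: (niso_iso oK').
by move: acc; rewrite /nrun rK'; exact.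
Qed.
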